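(* Let $A$ be an irreducible non-permutation matrix with entries in $\{0,1\}$ and let $f\in C(X_A,\mathbb{Z})$. There exist short exact sequences $$1\longrightarrow U(\mathcal{D}_A)\overset{\mathrm{id}}{\longrightarrow}U(\mathcal{F}_{A,f},\mathcal{D}_A)\overset{\mathrm{Ad}}{\longrightarrow}\Gamma_{A,f}\longrightarrow 1,$$ $$1\longrightarrow U(\mathcal{D}_A)\overset{\mathrm{Ad}}{\longrightarrow}\mathrm{Inn}(\mathcal{F}_{A,f},\mathcal{D}_A)\longrightarrow\Gamma_{A,f}\longrightarrow 1.$$ The latter exact sequence splits.
   Context: Let $A=[A(i,j)]_{i,j=1}^N$ be irreducible, with entries in $\{0,1\}$, not a permutation matrix. $\mathbb{Z}_+$ is the set of nonnegative integers, $\mathbb{T}=\mathbb{R}/\mathbb{Z}$. Shift space: $X_A=\{(x_n)_{n\in\mathbb{N}}\in\{1,\dots,N\}^{\mathbb{N}}\mid A(x_n,x_{n+1})=1,\ n\in\mathbb{N}\}$ with the relative product topology, $\sigma_A((x_n)_n)=(x_{n+1})_n$. $C(X_A,\mathbb{Z})$, $C(X_A,\mathbb{Z}_+)$ denote the continuous functions with values in $\mathbb{Z}$, $\mathbb{Z}_+$. $\Gamma_A$ is the group of homeomorphisms $\tau$ of $X_A$ for which there exist $k_\tau,l_\tau\in C(X_A,\mathbb{Z}_+)$ with $\sigma_A^{k_\tau(x)}(\tau(x))=\sigma_A^{l_\tau(x)}(x)$ for all $x\in X_A$. For $f\in C(X_A,\mathbb{Z})$, $\rho^f(x,\tau)=\sum_{i=0}^{l_\tau(x)}f(\sigma_A^i(x))-\sum_{i=0}^{k_\tau(x)}f(\sigma_A^i(\tau(x)))$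 (independent of the choice of $k_\tau,l_\tau$), and $\Gamma_{A,f}=\{\tau\in\Gamma_A\mid\rho^f(x,\tau)=0\text{ for all }x\in X_A\}$, a subgroup of $\Gamma_A$. $\mathcal{O}_A$ is the Cuntz–Krieger algebra generated by partial isometries $S_1,\dots,S_N$ with $\sum_{j=1}^N S_jS_j^*=1$, $S_i^*S_i=\sum_{j=1}^N A(i,j)S_jS_j^*$. For an admissible word $\mu=(\mu_1,\dots,\mu_m)$ (occurring as an initial segment of some point of $X_A$), $S_\mu=S_{\mu_1}\cdots S_{\mu_m}$ and $U_\mu=\{x\in X_A\mid x_1=\mu_1,\dots,x_m=\mu_m\}$. $\mathcal{D}_A$ is the commutative $C^*$-subalgebra generated by the projections $S_\mu S_\mu^*$, identified with $C(X_A)$ via $S_\mu S_\mu^*\leftrightarrow\chi_{U_\mu}$. For $f\in C(X_A,\mathbb{Z})\subset\mathcal{D}_A$, $\rho^{A,f}_t$ ($t\in\mathbb{T}$) are the automorphisms of $\mathcal{O}_A$ with $\rho^{A,f}_t(S_j)=\exp(2\pi\sqrt{-1}ft)S_j$, $j=1,\dots,N$, and $\mathcal{F}_{A,f}$ is the fixed point algebra of $\mathcal{O}_A$ under $\rho^{A,f}$. One has $\mathcal{D}_A\subset\mathcal{F}_{A,f}$. $U(\mathcal{D}_A)$ and $U(\mathcal{F}_{A,f})$ denote the unitary groups of $\mathcal{D}_A$ and $\mathcal{F}_{A,f}$; $U(\mathcal{F}_{A,f},\mathcal{D}_A)=\{u\in U(\mathcal{F}_{A,f})\mid u\mathcal{D}_Au^*=\mathcal{D}_A\}$.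 $\mathrm{Inn}(\mathcal{F}_{A,f},\mathcal{D}_A)$ is the group of inner automorphisms of $\mathcal{F}_{A,f}$ keeping the subalgebra $\mathcal{D}_A$ globally; here $\mathrm{Ad}(u)=u\,\cdot\,u^*$. For $u\in U(\mathcal{F}_{A,f},\mathcal{D}_A)$, $\mathrm{Ad}(u)$ gives an element of $\mathrm{Inn}(\mathcal{F}_{A,f},\mathcal{D}_A)$ and defines a homeomorphism $\tau_u$ of $X_A$ with $\mathrm{Ad}(u)(a)=a\circ\tau_u^{-1}$ for all $a\in\mathcal{D}_A$. Maps: in the first sequence, $\mathrm{id}$ is the inclusion and $\mathrm{Ad}$ sends $u$ to $\tau_u$; in the second sequence, $\mathrm{Ad}$ sends $u\in U(\mathcal{D}_A)$ to the inner automorphism $\mathrm{Ad}(u)$, and the map to $\Gamma_{A,f}$ sends $\mathrm{Ad}(u)$ to $\tau_u$.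
   Formalization: Ad is not injective on U(D_A) (Ad(-1)=id), so the second sequence is proved with U(D_A) replaced by its quotient by the kernel of Ad, which is shown to be exactly the unitaries of D_A commuting with all of F_{A,f}; exactness elsewhere and the splitting are as stated. *)

(* Defs.v *)
From HB Require Import structures.
From mathcomp Require Import all_boot all_order all_algebra.
From mathcomp Require Import all_classical all_reals all_analysis.
From mathcomp Require Import complex.

Set Implicit Arguments.
Unset Strict Implicit.
Unset Printing Implicit Defensive.

Import Order.TTheory GRing.Theory Num.Theory.
Import numFieldNormedType.Exports.

Local Open Scope classical_set_scope.
Local Open Scope ring_scope.

(* R[i] packaged as a numClosedFieldType, so that it carries the canonical
   topology of a numFieldType *)
Definition Cplx (R : realType) : numClosedFieldType := R[i].

Definition expi2pi (R : realType) (t : R) : Cplx R :=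
  Complex (cos (2 * pi * t)) (sin (2 * pi * t)).

(* The norm is a field of the mixin rather than an inherited normedModType
   structure: Hierarchy-Builder rejects a common extension of
   GRing.Algebra and NormedModule, because NumDomain already joins
   rings with norms. *)
HB.mixin Record isCStarAlgebra (R : realType) V
    of GRing.Algebra (Cplx R) V := {
  star : V -> V;
  starK : involutive star;
  starD : {morph star : a b / a + b};
  starZ : forall (k : Cplx R) a, star (k *: a) = k^* *: star a;
  starM : forall a b, star (a * b) = star b * star a;
  cnorm : V -> R;
  cnorm_eq0 : forall a, cnorm a = 0 -> a = 0;
  cnormD : forall a b, cnorm (a + b) <= cnorm a + cnorm b;
  cnormZ : forall (k : Cplx R) a, cnorm (k *: a) = Normc.normc k * cnorm a;
  cnormM : forall a b, cnorm (a * b) <= cnorm a * cnorm b;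
  cnorm_star : forall a, cnorm (star a * a) = cnorm a ^+ 2;
  cnorm_complete : forall u : nat -> V,
    (forall e : R, 0 < e -> exists n0, forall m n, (n0 <= m)%N -> (n0 <= n)%N ->
       cnorm (u m - u n) < e) ->
    exists l, (fun n => cnorm (u n - l)) @ \oo --> (0 : R)
}.

#[short(type="cstarAlgType")]
HB.structure Definition CStarAlgebra (R : realType) :=
  {V of GRing.Algebra (Cplx R) V & isCStarAlgebra R V}.

Record starHom (R : realType) (O B : cstarAlgType R) := StarHom {
  star_hom :> {lrmorphism O -> B};
  star_homP : forall a, star_hom (star a) = star (star_hom a)
}.

Record starAut (R : realType) (O : cstarAlgType R) := StarAut {
  star_aut :> starHom O O;
  star_aut_bij : bijective star_aut
}.

Record starSub (R : realType) (O : cstarAlgType R) := StarSub {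
  ss_set :> set O;
  ss1 : ss_set 1;
  ssP : forall (k : Cplx R) a b, ss_set a -> ss_set b -> ss_set (k *: a + b);
  ssM : forall a b, ss_set a -> ss_set b -> ss_set (a * b);
  ssS : forall a, ss_set a -> ss_set (star a)
}.

Section CStar.
Variables (R : realType) (O : cstarAlgType R).

Lemma star1 : star (1 : O) = 1.
Proof.
rewrite -[LHS]mulr1 -{2}[1](starK (1 : O)) -starM mulr1.
by rewrite starK.
Qed.

Definition is_cstar_sub (B : set O) : Prop :=
  (forall (u : nat -> O) l, (forall n, B (u n)) ->
     (fun n => cnorm (u n - l)) @ \oo --> (0 : R) -> B l) /\
  exists B' : starSub O, B = B'.

Definition cstar_gen (X : set O) : set O := smallest is_cstar_sub X.

Lemma cstar_gen1 X : cstar_gen X 1.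
Proof. by move=> B [[_ [B' ->]] _]; exact: ss1. Qed.

Lemma cstar_genP X (k : Cplx R) a b :
  cstar_gen X a -> cstar_gen X b -> cstar_gen X (k *: a + b).
Proof.
move=> Xa Xb B BX; have := Xb _ BX; have := Xa _ BX.
by case: BX => [[_ [B' ->]] _]; exact: ssP.
Qed.

Lemma cstar_genM X a b :
  cstar_gen X a -> cstar_gen X b -> cstar_gen X (a * b).
Proof.
move=> Xa Xb B BX; have := Xb _ BX; have := Xa _ BX.
by case: BX => [[_ [B' ->]] _] ? ?; exact: ssM.
Qed.

Lemma cstar_genS X a : cstar_gen X a -> cstar_gen X (star a).
Proof.
move=> Xa B BX; have := Xa _ BX.
by case: BX => [[_ [B' ->]] _]; exact: ssS.
Qed.

Definition cstar_gen_sub (X : set O) : starSub O :=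
  StarSub (@cstar_gen1 X) (@cstar_genP X) (@cstar_genM X) (@cstar_genS X).

Section FixedPoints.
Variables (T : Type) (rho : T -> starAut O).

Definition fixed_set : set O := [set a | forall t, rho t a = a].

Lemma fixed1 : fixed_set 1.
Proof. by move=> t; rewrite rmorph1. Qed.

Lemma fixedP (k : Cplx R) a b :
  fixed_set a -> fixed_set b -> fixed_set (k *: a + b).
Proof. by move=> ra rb t; rewrite linearP /= ra rb. Qed.

Lemma fixedM a b : fixed_set a -> fixed_set b -> fixed_set (a * b).
Proof. by move=> ra rb t; rewrite rmorphM /= ra rb. Qed.

Lemma fixedS a : fixed_set a -> fixed_set (star a).
Proof. by move=> ra t; rewrite star_homP ra. Qed.

Definition fixed_sub : starSub O := StarSub fixed1 fixedP fixedM fixedS.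
End FixedPoints.

Definition unitary_set (B : set O) : set O :=
  [set u | [/\ B u, star u * u = 1 & u * star u = 1]].

End CStar.

Definition unitaryGroup (R : realType) (O : cstarAlgType R)
  (B : starSub O) : Type := set_type (unitary_set B).

Section UnitaryGroup.
Variables (R : realType) (O : cstarAlgType R) (B : starSub O).
Local Notation U := (unitaryGroup B).

HB.instance Definition _ := Choice.on U.

Definition uval (u : U) : O := val u.

Lemma uvalP (u : U) :
  [/\ ss_set B (uval u), star (uval u) * uval u = 1 & uval u * star (uval u) = 1].
Proof. exact: set_mem (valP u). Qed.

Lemma unitary1 : unitary_set B (1 : O).
Proof. by split; rewrite ?star1 ?mulr1 //; exact: ss1. Qed.

Lemma unitaryM (u v : U) : unitary_set B (uval u * uval v).
Proof.
have [Bu su us] := uvalP u; have [Bv sv vs] := uvalP v.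
split; first exact: ssM.
- by rewrite starM mulrA -(mulrA (star _)) su mulr1.
- by rewrite starM mulrA -(mulrA (uval u)) vs mulr1.
Qed.

Lemma unitaryV (u : U) : unitary_set B (star (uval u)).
Proof.
by have [Bu su us] := uvalP u; split; rewrite ?starK //; exact: ssS.
Qed.

Definition mkU a (Ba : unitary_set B a) : U := exist _ a (mem_set Ba).

Lemma uval_inj : injective uval. Proof. exact: val_inj. Qed.

Let mulUA : associative (fun u v : U => mkU (unitaryM u v)).
Proof. by move=> u v w; apply: uval_inj; rewrite /uval /= mulrA. Qed.
Let mul1U : left_id (mkU unitary1) (fun u v : U => mkU (unitaryM u v)).
Proof. by move=> u; apply: uval_inj; rewrite /uval /= mul1r. Qed.
Let mulU1 : right_id (mkU unitary1) (fun u v : U => mkU (unitaryM u v)).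
Proof. by move=> u; apply: uval_inj; rewrite /uval /= mulr1. Qed.
Let mulVU : left_inverse (mkU unitary1) (fun u : U => mkU (unitaryV u))
  (fun u v : U => mkU (unitaryM u v)).
Proof. by move=> u; apply: uval_inj; have [] := uvalP u. Qed.
Let mulUV : right_inverse (mkU unitary1) (fun u : U => mkU (unitaryV u))
  (fun u v : U => mkU (unitaryM u v)).
Proof. by move=> u; apply: uval_inj; have [] := uvalP u. Qed.

HB.instance Definition _ := isGroup.Build U mulUA mul1U mulU1 mulVU mulUV.

End UnitaryGroup.

Record selfBij (T : Type) := SelfBij {
  bij_fun :> T -> T;
  bij_inv : T -> T;
  bij_funK : cancel bij_fun bij_inv;
  bij_invK : cancel bij_inv bij_fun
}.

Section SelfBij.
Variable T : Type.
Local Notation G := (selfBij T).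

HB.instance Definition _ := gen_eqMixin G.
HB.instance Definition _ := gen_choiceMixin G.

Lemma selfBijP (f g : G) : bij_fun f =1 bij_fun g -> f = g.
Proof.
case: f g => [f f' fK f'K] [g g' gK g'K] /= /funext fg.
have fg' : f' = g' by apply/funext => x; rewrite -{1}(g'K x) -fg fK.
move: fK f'K gK g'K; rewrite fg fg' => *.
by congr SelfBij; exact: Prop_irrelevance.
Qed.

Definition bij_id : G := @SelfBij T id id (fun=> erefl) (fun=> erefl).
Definition bij_comp (f g : G) : G :=
  SelfBij (can_comp (@bij_funK _ f) (@bij_funK _ g))
          (can_comp (@bij_invK _ g) (@bij_invK _ f)).
Definition bij_opp (f : G) : G := SelfBij (@bij_invK _ f) (@bij_funK _ f).

Let compA : associative bij_comp.
Proof. by move=> f g h; exact: selfBijP. Qed.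
Let comp1 : left_id bij_id bij_comp.
Proof. by move=> f; exact: selfBijP. Qed.
Let compr1 : right_id bij_id bij_comp.
Proof. by move=> f; exact: selfBijP. Qed.
Let compV : left_inverse bij_id bij_opp bij_comp.
Proof. by move=> f; apply: selfBijP => x; exact: bij_funK. Qed.
Let compVr : right_inverse bij_id bij_opp bij_comp.
Proof. by move=> f; apply: selfBijP => x; exact: bij_invK. Qed.

HB.instance Definition _ := isGroup.Build G compA comp1 compr1 compV compVr.

End SelfBij.

Record subgroup (G : groupType) := Subgroup {
  sg_set :> set G;
  sg1 : sg_set 1%g;
  sgB : forall x y, sg_set x -> sg_set y -> sg_set (x / y)%g
}.

Definition subGrp (G : groupType) (H : subgroup G) : Type := set_type H.

Section SubGrp.
Variables (G : groupType) (H : subgroup G).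

HB.instance Definition _ := SubChoice.on (subGrp H).

Lemma subGrp_closed : group_closed (fun x : G => x \in sg_set H).
Proof.
by split=> [|x y /set_mem Hx /set_mem Hy]; apply: mem_set; [exact: sg1|exact: sgB].
Qed.

HB.instance Definition _ :=
  SubChoice_isSubGroup.Build G _ (subGrp H) subGrp_closed.

Definition gval (x : subGrp H) : G := val x.

End SubGrp.

(* ker i = Z and 1 -> G1 / Z -> G2 -> G3 -> 1 is exact *)
Definition short_exact_mod (G1 G2 G3 : groupType) (Z : set G1)
    (i : {multiplicative G1 -> G2}) (p : {multiplicative G2 -> G3}) : Prop :=
  [/\ forall x, i x = 1%g <-> Z x,
      forall y, p y = 1%g <-> exists x, i x = y
    & forall z, exists y, p y = z].

Definition short_exact (G1 G2 G3 : groupType)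
    (i : {multiplicative G1 -> G2}) (p : {multiplicative G2 -> G3}) : Prop :=
  short_exact_mod [set 1%g] i p.

Definition splits (G2 G3 : groupType) (p : {multiplicative G2 -> G3}) : Prop :=
  exists s : {multiplicative G3 -> G2}, forall z, p (s z) = z.

Section Normalizers.
Variables (R : realType) (O : cstarAlgType R) (F D : starSub O).

Definition normalizer_set : set (unitaryGroup F) :=
  [set u | [set uval u * a * star (uval u) | a in D] = D :> set O].

Lemma normalizerE (u : unitaryGroup F) : normalizer_set u <->
  forall a, ss_set D (uval u * a * star (uval u)) <-> ss_set D a.
Proof.
have [_ su us] := uvalP u; split => [uD a|uD].
  split=> [|Da]; last by rewrite -uD; exists a.
  rewrite -{1}uD => -[b Db] /(congr1 (fun c => star (uval u) * c * uval u)).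
  by rewrite !mulrA !su !mul1r -!mulrA !su !mulr1 => <-.
apply/seteqP; split=> [_ [a Da <-]|a Da]; first exact/uD.
exists (star (uval u) * a * uval u); last first.
  by rewrite !mulrA us mul1r -mulrA us mulr1.
by apply/uD; rewrite !mulrA us mul1r -mulrA us mulr1.
Qed.

Lemma normalizer1 : normalizer_set 1%g.
Proof. by apply/normalizerE => a; rewrite /uval/= star1 mul1r mulr1. Qed.

Lemma normalizerB u v :
  normalizer_set u -> normalizer_set v -> normalizer_set (u / v)%g.
Proof.
move=> /normalizerE uD /normalizerE vD; apply/normalizerE => a.
have [_ sv vs] := uvalP v.
have -> : uval (u / v)%g = uval u * star (uval v) by [].
rewrite starM starK.
have -> : uval u * star (uval v) * a * (uval v * star (uval u)) =
    uval u * (star (uval v) * a * uval v) * star (uval u) by rewrite !mulrA.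
apply: (iff_trans (uD _)); apply: (iff_trans (iff_sym (vD _))).
by rewrite !mulrA vs mul1r -mulrA vs mulr1.
Qed.

Definition normalizer : subgroup (unitaryGroup F) :=
  Subgroup normalizer1 normalizerB.

Definition is_Ad (u : unitaryGroup F) (alpha : selfBij (set_type F)) : Prop :=
  forall a, val (alpha a) = uval u * val a * star (uval u).

(* This is Inn(F, D) when D is contained in F; set_type F is the type of
   elements of F. *)
Definition inner_set : set (selfBij (set_type F)) :=
  [set alpha | (exists u, is_Ad u alpha) /\
     alpha @` [set a | ss_set D (val a)] = [set a | ss_set D (val a)]].

Lemma inner1 : inner_set 1%g.
Proof.
split; last by rewrite image_id.
by exists 1%g => a; rewrite /uval/= star1 mul1r mulr1.
Qed.

Lemma innerB al be : inner_set al -> inner_set be -> inner_set (al / be)%g.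
Proof.
move=> [[u uE] alD] [[v vE] beD].
have [_ sv vs] := uvalP v; split.
  exists (u / v)%g => a.
  have -> : (al / be)%g a = al (bij_inv be a) by [].
  rewrite uE; have := vE (bij_inv be a); rewrite bij_invK => ->.
  have -> : uval (u / v)%g = uval u * star (uval v) by [].
  rewrite starM starK !mulrA -(mulrA _ (star _) (uval v)) sv mulr1.
  by rewrite -!mulrA (mulrA (star _) (uval v)) sv mul1r.
rewrite -{1}beD image_comp -[RHS]alD; apply: eq_imagel => a _.
by change (al (bij_inv be (be a)) = al a); rewrite bij_funK.
Qed.

Definition inner : subgroup (selfBij (set_type F)) := Subgroup inner1 innerB.

(* The kernel of Ad on U(D). It contains the scalars of modulus 1, so Ad is
   injective only modulo this subgroup. *)
Definition central_unitaries : set (unitaryGroup D) :=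
  [set u | forall a, ss_set F a -> uval u * a = a * uval u].

End Normalizers.

Arguments central_unitaries {R O} F D _.

Definition irreducible N (A : 'M[nat]_N) : Prop :=
  forall i j, exists2 n, (0 < n)%N & (A ^+ n) i j != 0%N.

(* points are indexed from 0 instead of 1; a set_type carries the relative
   topology *)
Definition shift_set N (A : 'M[nat]_N) :
    set {ptws nat -> discrete_topology 'I_N} :=
  [set x | forall n, A (x n) (x n.+1) = 1%N].

Definition shift_space N (A : 'M[nat]_N) : Type := set_type (shift_set A).

HB.instance Definition _ N (A : 'M[nat]_N) :=
  Topological.copy (shift_space A) (set_type (shift_set A)).

Section Shift.
Variables (N : nat) (A : 'M[nat]_N).
Local Notation X := (shift_space A).

Definition pt (x : X) : nat -> 'I_N := val x.

Lemma sigma_subproof (x : X) :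
  shift_set A (fun n => pt x n.+1 : discrete_topology 'I_N).
Proof. by move=> n; have := set_mem (valP x) n.+1. Qed.

Definition sigma (x : X) : X := 
  exist (fun y => y \in shift_set A) _ (mem_set (sigma_subproof x)).

Definition cylinder (mu : seq 'I_N) : set X :=
  [set x | mkseq (pt x) (size mu) = mu].

Definition admissible (mu : seq 'I_N) : Prop := cylinder mu !=set0.

Definition homeomorphism (tau : selfBij X) : Prop :=
  continuous tau /\ continuous (bij_inv tau).

Definition orbit_cocycles (tau : selfBij X) (k l : X -> nat) : Prop :=
  [/\ continuous k, continuous l &
      forall x, iter (k x) sigma (tau x) = iter (l x) sigma x].

Definition Gamma_set : set (selfBij X) :=
  [set tau | homeomorphism tau /\ exists k l, orbit_cocycles tau k l].

Section Cocycle.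
Variable f : X -> int.

Definition rho_cocycle (k l : X -> nat) (x : X) (tau : selfBij X) : int :=
  \sum_(0 <= i < (l x).+1) f (iter i sigma x)
  - \sum_(0 <= i < (k x).+1) f (iter i sigma (tau x)).

(* the value of rho_cocycle does not depend on the choice of k and l when A is
   irreducible and not a permutation matrix *)
Definition Gamma_f_set : set (selfBij X) :=
  [set tau | Gamma_set tau /\
     exists k l, orbit_cocycles tau k l /\
       forall x, rho_cocycle k l x tau = 0].

Let E n x : int := \sum_(0 <= i < n) f (iter i sigma x).

Lemma rho_cocycleE tau k l x : orbit_cocycles tau k l ->
  rho_cocycle k l x tau = E (l x) x - E (k x) (tau x).
Proof.
move=> [_ _ kl]; rewrite /rho_cocycle !big_nat_recr //= kl.
by rewrite opprD addrACA subrr addr0.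
Qed.

Lemma ED m n x : E (m + n) x = E m x + E n (iter m sigma x).
Proof.
rewrite /E (big_cat_nat (n := m)) //= ?leq_addr//; congr (_ + _).
rewrite -{1}[m]add0n big_addn addKn; apply: eq_bigr => i _.
by rewrite iterD.
Qed.

Lemma continuousD_nat (g h : X -> nat) :
  continuous g -> continuous h -> continuous (fun x => (g x + h x)%N).
Proof.
move=> cg ch x.
have gx : \forall y \near x, g y = g x.
  exact: (cg x [set g x] (discrete_set1 (g x))).
have hx : \forall y \near x, h y = h x.
  exact: (ch x [set h x] (discrete_set1 (h x))).
apply: (@cvg_near_cst X nat _ _ (nbhs x) (nbhs_filter x)).
by apply: (@filterS2 X (nbhs x) (nbhs_filter x) _ _ _ _ gx hx) => y -> ->.
Qed.

Lemma Gamma_f1 : Gamma_f_set 1%g.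
Proof.
have c0 : orbit_cocycles 1%g (fun=> 0%N) (fun=> 0%N).
  by split=> //; exact: cst_continuous.
split; first by split; [split=> x U | exists (fun=> 0%N), (fun=> 0%N)].
exists (fun=> 0%N), (fun=> 0%N); split=> // x.
by rewrite (rho_cocycleE _ c0) /E !big_nil subrr.
Qed.

Lemma Gamma_fB s t : Gamma_f_set s -> Gamma_f_set t -> Gamma_f_set (s / t)%g.
Proof.
move=> [[[cs cs'] _] [k1 [l1 [kl1 r1]]]] [[[ct ct'] _] [k2 [l2 [kl2 r2]]]].
have [ck1 cl1 e1] := kl1; have [ck2 cl2 e2] := kl2.
pose t' := bij_inv t.
have kl : orbit_cocycles (s / t)%g (fun x => (k1 (t' x) + l2 (t' x))%N)
                                   (fun x => (k2 (t' x) + l1 (t' x))%N).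
  have ct'' g : continuous g -> continuous (fun x => g (t' x) : nat).
    by move=> cg x; apply: continuous_comp; [exact: ct'|exact: cg].
  split; try by apply: continuousD_nat; exact: ct''.
  move=> x.
  change (iter (k1 (t' x) + l2 (t' x)) sigma (s (t' x)) =
          iter (k2 (t' x) + l1 (t' x)) sigma x).
  rewrite addnC iterD e1 -iterD addnC (addnC (k2 _)) !iterD; congr iter.
  by rewrite -e2 /t' bij_invK.
have hst : homeomorphism (s / t)%g.
  split=> x.
    by apply: (@continuous_comp _ _ _ t' s); [exact: ct'|exact: cs].
  by apply: (@continuous_comp _ _ _ (bij_inv s) t); [exact: cs'|exact: ct].
split; first by split=> //; do 2!eexists; exact: kl.
do 2!eexists; split; first exact: kl.
move=> x; rewrite (rho_cocycleE _ kl).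
change (E (k2 (t' x) + l1 (t' x)) x
        - E (k1 (t' x) + l2 (t' x)) (s (t' x)) = 0).
have := r1 (t' x); rewrite (rho_cocycleE _ kl1) => /subr0_eq E1.
have := r2 (t' x); rewrite (rho_cocycleE _ kl2) => /subr0_eq.
have := e2 (t' x); rewrite /t' bij_invK -/t' => e E2.
by rewrite !ED e -E1 -E2 e1 -!ED addnC subrr.
Qed.

Definition Gamma_f : subgroup (selfBij X) := Subgroup Gamma_f1 Gamma_fB.

End Cocycle.
End Shift.

Section CuntzKrieger.
Variables (R : realType) (N : nat) (A : 'M[nat]_N).
Local Notation X := (shift_space A).

Definition ck_family (O : cstarAlgType R) (S : 'I_N -> O) : Prop :=
  [/\ forall i, S i * star (S i) * S i = S i,
      \sum_j S j * star (S j) = 1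
    & forall i, star (S i) * S i = \sum_j (S j * star (S j)) *+ A i j].

(* O is the universal C*-algebra generated by a Cuntz-Krieger A-family; the
   homomorphism below is unique since O is generated by the S i *)
Definition is_cuntz_krieger (O : cstarAlgType R) (S : 'I_N -> O) : Prop :=
  [/\ ck_family S,
      cstar_gen (range S) = setT
    & forall (B : cstarAlgType R) (T : 'I_N -> B), ck_family T ->
        exists phi : starHom O B, forall i, phi (S i) = T i].

Variables (O : cstarAlgType R) (S : 'I_N -> O).

Definition Sword (mu : seq 'I_N) : O := \prod_(i <- mu) S i.

Definition DA : starSub O :=
  cstar_gen_sub [set Sword mu * star (Sword mu) | mu in @admissible N A].

(* Phi is the identification of C(X_A) with D_A; its values outside the
   continuous functions are irrelevant *)
Definition is_diagonal_iso (Phi : (X -> Cplx R) -> O) : Prop :=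
  [/\ forall g h : X -> Cplx R, continuous g -> continuous h ->
        [/\ forall k : Cplx R, Phi (k *: g + h) = k *: Phi g + Phi h,
            Phi (g * h) = Phi g * Phi h,
            Phi (fun x => (g x)^* ) = star (Phi g)
          & Phi g = Phi h -> g = h],
      Phi @` [set g : X -> Cplx R | continuous g] = DA
    & forall mu, admissible A mu ->
        Phi \1_(cylinder mu) = Sword mu * star (Sword mu)].

(* rho t is the automorphism attached to the class of t in R/Z *)
Definition is_gauge_action (Phi : (X -> Cplx R) -> O) (f : X -> int)
    (rho : R -> starAut O) : Prop :=
  forall t j, rho t (S j) = Phi (fun x => expi2pi ((f x)%:~R * t)) * S j.

End CuntzKrieger.

(* Main.v *)
Require Import Defs.
From HB Require Import structures.
From mathcomp Require Import all_boot all_order all_algebra.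
From mathcomp Require Import all_classical all_reals all_analysis.
From mathcomp Require Import complex ring lra zify perm.

(** Write X for the shift space, D = C(X) for the diagonal and F for the fixed point
    algebra.

    A unitary u normalizing D acts on D by an automorphism, dual to a homeomorphism
    t of X ([dual_map]). The kernel of u |-> t consists of the unitaries commuting
    with D, so exactness in the middle says that D is maximal abelian
    ([diagonal_maximal_abelian]). Let b commute with D. Its Fourier coefficients b_m
    under the gauge action S_i |-> z S_i, which exists by universality, commute with
    D as well. The coefficient b_0 is a limit of combinations of S_mu S_nu^* with mu
    and nu of the same length; pinching by projections of D fixes b_0 and removes
    the terms with mu <> nu, so b_0 lies in D ([homog0_D]). For m <> 0 the element
    b_m^* b_m is homogeneous of degree 0, hence a continuous function on X; it
    vanishes at every aperiodic point x, because the compression of S_mu S_nu^* to a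
    small cylinder around x is zero when mu and nu have different lengths. Aperiodic
    points are dense since A is irreducible and not a permutation matrix, so b_m = 0
    ([homog_zero]). Fejer's theorem then gives b = b_0. The averages that define the
    b_m converge because *-homomorphisms are contractive, which follows from the
    existence of square roots of 1 - c for |c| < 1 ([starHom_contr]).

    The homeomorphism t of a normalizing unitary u belongs to the group
    ([covers_Gamma]): approximate u by a combination of finitely many S_mu S_nu^*.
    The compression of u^* S_mu S_nu^* to all cylinders around x can only be nonzero
    if t (nu z) = mu z where x = nu z, and for one of the finitely many pairs it
    must be bounded below. Compressions to small cylinders around aperiodic points
    being approximately scalars that depend on finitely many coordinates
    ([approx_diagonal]), the pair (mu, nu) can be kept constant on a cylinder. If u
    is fixed by the automorphisms rho_t, these scalars are fixed too, and this says
    that the cocycle of t vanishes ([cocycle_zero]).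

    Conversely t in the group replaces prefixes nu by prefixes mu on a finite
    partition into cylinders, and u = sum S_mu S_nu^* is a unitary inducing t; it is
    fixed by rho because the cocycle vanishes ([ex_implements]). Having only
    coefficients 1, it does not depend on the partition ([implements_uniq]) and is
    multiplicative in t ([implementsM]). So t |-> Ad(u) splits the second sequence. *)

Set Implicit Arguments.
Unset Strict Implicit.
Unset Printing Implicit Defensive.

Import Order.TTheory GRing.Theory Num.Theory.
Import numFieldNormedType.Exports.

Local Open Scope classical_set_scope.
Local Open Scope ring_scope.

(** * Norms in a C*-algebra *)

Section NormBasics.
Variables (R : realType) (O : cstarAlgType R).
Implicit Types (a b c : O) (k : Cplx R).
Local Notation "'N[ a ]" := (cnorm (a : O)) (format "''N[' a ]").
Local Notation nc := (@Normc.normc R).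

Lemma cnorm0 : 'N[0] = 0.
Proof. by rewrite -[X in cnorm X](scale0r (0 : O)) cnormZ Normc.normc0 mul0r. Qed.

Lemma cnormN a : 'N[- a] = 'N[a].
Proof.
rewrite -scaleN1r cnormZ /Normc.normc /=.
by rewrite oppr0 sqrrN expr0n /= addr0 expr1n sqrtr1 mul1r.
Qed.

Lemma cnorm_ge0 a : 0 <= 'N[a].
Proof.
have := cnormD a (- a); rewrite subrr cnorm0 cnormN.
by rewrite -mulr2n pmulrn_lge0.
Qed.

Lemma cnorm_distC a b : 'N[a - b] = 'N[b - a].
Proof. by rewrite -cnormN opprB. Qed.

Lemma cnormB a b : 'N[a - b] <= 'N[a] + 'N[b].
Proof. by rewrite -(cnormN b); exact: cnormD. Qed.

Lemma cnorm_triangle c a b : 'N[a - b] <= 'N[a - c] + 'N[c - b].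
Proof. by rewrite -[a - b](subrKA c); exact: cnormD. Qed.

Lemma cnorm_leD a b : 'N[a] <= 'N[a - b] + 'N[b].
Proof. by rewrite -{1}(subrK b a); exact: cnormD. Qed.

Lemma star0 : star (0 : O) = 0.
Proof. by have := starD (0 : O) 0; rewrite addr0 => /esym/eqP; rewrite -subr_eq0 addrK => /eqP. Qed.

Lemma starN a : star (- a) = - star a.
Proof. by apply/eqP; rewrite -subr_eq0 opprK -starD addNr star0. Qed.

Lemma starB a b : star (a - b) = star a - star b.
Proof. by rewrite starD starN. Qed.

Lemma star_sum (I : Type) (r : seq I) (P : pred I) (F : I -> O) :
  star (\sum_(i <- r | P i) F i) = \sum_(i <- r | P i) star (F i).
Proof. by apply: (big_morph star starD star0). Qed.

Lemma cnorm_star_le a : 'N[a] <= 'N[star a].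
Proof.
have [->|a0] := eqVneq 'N[a] 0; first exact: cnorm_ge0.
have a_gt0 : 0 < 'N[a] by rewrite lt_def a0 cnorm_ge0.
by rewrite -(ler_pM2r a_gt0) -expr2 -cnorm_star; exact: cnormM.
Qed.

Lemma cnorm_starE a : 'N[star a] = 'N[a].
Proof. by apply/le_anti; rewrite cnorm_star_le -{2}(starK a) cnorm_star_le. Qed.

Lemma cnorm_sum (I : Type) (r : seq I) (P : pred I) (F : I -> O) :
  'N[\sum_(i <- r | P i) F i] <= \sum_(i <- r | P i) 'N[F i].
Proof.
elim/big_rec2: _ => [|i x y _ yx]; first by rewrite cnorm0.
by apply: le_trans (cnormD _ _) _; rewrite lerD2l.
Qed.

(** By the C*-identity the norm of a projection is its own square. *)
Lemma cnorm_proj_cases a : star a = a -> a * a = a -> 'N[a] = 0 \/ 'N[a] = 1.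
Proof.
move=> sa aa; have := cnorm_star a; rewrite sa aa => /eqP.
rewrite eq_sym expr2 -subr_eq0 -{3}['N[a]]mulr1 -mulrBr mulf_eq0 subr_eq0.
by case/orP=> /eqP; [left|right].
Qed.

Lemma cnorm_proj a : star a = a -> a * a = a -> 'N[a] <= 1.
Proof. by move=> sa aa; case: (cnorm_proj_cases sa aa) => ->. Qed.

Lemma cnorm_proj1 a : star a = a -> a * a = a -> a <> 0 -> 'N[a] = 1.
Proof. by move=> sa aa a0; case: (cnorm_proj_cases sa aa) => // /cnorm_eq0. Qed.

Lemma cnorm1_le : 'N[1] <= 1.
Proof. by apply: cnorm_proj; rewrite ?star1 ?mulr1. Qed.

Lemma cnorm_isometry u : star u * u = 1 -> 'N[u] <= 1.
Proof.
move=> uu; have : 'N[u] ^+ 2 <= 1 by rewrite -cnorm_star uu cnorm1_le.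
by rewrite expr_le1 // cnorm_ge0.
Qed.

Lemma cnorm_pinj a p : 'N[p] <= 1 -> 'N[p * a] <= 'N[a].
Proof.
move=> p1; apply: le_trans (cnormM _ _) _.
by rewrite -[leRHS]mul1r ler_wpM2r ?cnorm_ge0.
Qed.

Lemma cnorm_pinjr a p : 'N[p] <= 1 -> 'N[a * p] <= 'N[a].
Proof.
move=> p1; apply: le_trans (cnormM _ _) _.
by rewrite -[leRHS]mulr1 ler_wpM2l ?cnorm_ge0.
Qed.

Lemma cnorm_comp a p : 'N[p] <= 1 -> 'N[p * a * p] <= 'N[a].
Proof. by move=> p1; apply: le_trans (cnorm_pinjr _ p1) (cnorm_pinj _ p1). Qed.

Lemma normc_ge0 k : 0 <= nc k. Proof. by case: k => x y; exact: sqrtr_ge0. Qed.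

Lemma normc_real (x : R) : nc (x%:C : Cplx R)%C = `|x|.
Proof. by rewrite /Normc.normc /= expr0n addr0 sqrtr_sqr. Qed.

Lemma cnorm_small a : (forall e : R, 0 < e -> 'N[a] <= e) -> a = 0.
Proof.
move=> ae; apply: cnorm_eq0; apply/le_anti; rewrite cnorm_ge0 andbT.
by apply/ler_addgt0Pl => e /ae; rewrite addr0.
Qed.

Lemma cvg_cnormP (u : nat -> O) l :
  ((fun n => 'N[u n - l]) @ \oo --> (0 : R)) <->
  (forall e : R, 0 < e -> exists n0, forall n, (n0 <= n)%N -> 'N[u n - l] < e).
Proof.
split=> [/cvgrPdist_lt ul e /ul [n0 _ n0P]|ul].
  by exists n0 => n /n0P /=; rewrite sub0r normrN ger0_norm // cnorm_ge0.
apply/cvgrPdist_lt => e /ul [n0 n0P]; exists n0 => //= n /n0P.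
by rewrite sub0r normrN ger0_norm // cnorm_ge0.
Qed.

End NormBasics.

(** * Square roots and contractivity of *-homomorphisms *)

Section SquareRoot.
Variables (R : realType) (O : cstarAlgType R).
Implicit Types (a b c : O) (k : Cplx R).
Local Notation "'N[ a ]" := (cnorm (a : O)) (format "''N[' a ]").
Local Notation nc := (@Normc.normc R).

Lemma normc_half : nc 2^-1 = 2^-1.
Proof.
have -> : (2^-1 : Cplx R) = (2^-1 : R)%:C%C by rewrite fmorphV rmorph_nat.
by rewrite normc_real ger0_norm // invr_ge0.
Qed.

Lemma conj_half : (2^-1 : Cplx R)^* = 2^-1.
Proof. by rewrite fmorphV rmorph_nat. Qed.

Lemma scaler_halfD a : 2^-1 *: (a + a) = a.
Proof.
rewrite scalerDr -scalerDl.
suff -> : 2^-1 + 2^-1 = 1 :> Cplx R by rewrite scale1r.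
by rewrite -mulr2n -[LHS]mulr_natl mulfV // pnatr_eq0.
Qed.

Lemma cnorm_sqrB a b (r : R) : 'N[a] <= r -> 'N[b] <= r ->
  'N[2^-1 *: (a * a - b * b)] <= r * 'N[a - b].
Proof.
move=> ar br; have r0 : 0 <= r by exact: le_trans (cnorm_ge0 a) ar.
have -> : a * a - b * b = a * (a - b) + (a - b) * b.
  by rewrite mulrBr mulrBl addrA subrK.
rewrite cnormZ normc_half ler_pdivrMl //.
apply: le_trans (cnormD _ _) _; have d0 := cnorm_ge0 (a - b).
have := cnormM a (a - b); have := cnormM (a - b) b.
by have := ler_wpM2r d0 ar; have := ler_wpM2l d0 br; lra.
Qed.

Section Iteration.
Variable c : O.
Hypotheses (sc : star c = c) (c1 : 'N[c] < 1).

Fixpoint sqrt_iter n : O :=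
  if n is n'.+1 then 2^-1 *: (c + sqrt_iter n' * sqrt_iter n') else 0.
Local Notation y := sqrt_iter.

Let c0 := cnorm_ge0 c.

Lemma sqrt_iter_le n : 'N[y n] <= 'N[c].
Proof.
elim: n => [|n IH]; first by rewrite /= cnorm0.
rewrite /= cnormZ normc_half ler_pdivrMl //.
apply: le_trans (cnormD _ _) _; have := cnormM (y n) (y n).
have yy : 'N[y n] * 'N[y n] <= 'N[c] * 1.
  by apply: ler_pM; rewrite ?cnorm_ge0 // (le_trans IH) // ltW.
lra.
Qed.

(** The iteration contracts distances by the factor |c|, since all its terms have
    norm at most |c|. *)
Lemma sqrt_iter_dist n m : 'N[y (n + m) - y n] <= 'N[c] ^+ n.
Proof.
elim: n => [|n IH]; first by rewrite subr0 expr0 (le_trans (sqrt_iter_le _)) ?ltW.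
rewrite addSn /= -scalerBr opprD addrACA subrr add0r exprS.
apply: le_trans (cnorm_sqrB (sqrt_iter_le _) (sqrt_iter_le _)) _.
by rewrite ler_wpM2l.
Qed.

Lemma sqrt_iter_star n : star (y n) = y n.
Proof.
elim: n => [|n IH] /=; first exact: star0.
by rewrite starZ conj_half starD starM IH sc.
Qed.

Lemma sqrt_iter_comm a n : a * c = c * a -> a * y n = y n * a.
Proof.
move=> ac; elim: n => [|n IH] /=; first by rewrite mulr0 mul0r.
by rewrite -scalerAr -scalerAl mulrDl mulrDr ac mulrA IH -mulrA IH mulrA.
Qed.

Lemma expr_small (r e : R) : 0 <= r -> r < 1 -> 0 < e ->
  exists n, forall m, (n <= m)%N -> r ^+ m < e.
Proof.
move=> r0 r1 e0; have : (fun n => r ^+ n) @ \oo --> (0 : R).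
  by apply: cvg_expr; rewrite ger0_norm.
move/cvgrPdist_lt => /(_ _ e0) [n _ nP]; exists n => m /nP /=.
by rewrite sub0r normrN ger0_norm // exprn_ge0.
Qed.

Lemma sqrt_iter_lim : exists l, forall e : R, 0 < e ->
  exists n0, forall n, (n0 <= n)%N -> 'N[y n - l] < e.
Proof.
have [|l /cvg_cnormP lP] := @cnorm_complete _ O y; last by exists l.
move=> e e0; have [n nP] := expr_small c0 c1 (divr_gt0 e0 (ltr0n R 2)).
exists n => p q np nq; apply: le_lt_trans (cnorm_triangle (y n) _ _) _.
rewrite [e](splitr e); apply: ltrD.
  by rewrite -(subnKC np); apply: le_lt_trans (sqrt_iter_dist _ _) (nP _ _).
rewrite cnorm_distC -(subnKC nq).
exact: le_lt_trans (sqrt_iter_dist _ _) (nP _ _).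
Qed.

(** The fixed point y of the contraction y |-> (c + y^2) / 2 satisfies
    (1 - y)^2 = 1 - c, so that square roots exist without spectral theory. *)
Lemma sqrt1B : exists b, [/\ star b = b, b * b = 1 - c &
  forall a, a * c = c * a -> a * b = b * a].
Proof.
have [l lP] := sqrt_iter_lim.
have sl : star l = l.
  apply/eqP; rewrite -subr_eq0; apply/eqP/cnorm_small => e e0.
  have [n /(_ _ (leqnn _)) nP] := lP _ (divr_gt0 e0 (ltr0n R 2)).
  apply: le_trans (cnorm_triangle (y n) _ _) _.
  rewrite [leRHS](splitr e); apply: lerD; last exact: ltW.
  by rewrite -{1}sqrt_iter_star -starB cnorm_starE cnorm_distC ltW.
have cl a : a * c = c * a -> a * l = l * a.
  move=> ac; apply/eqP; rewrite -subr_eq0; apply/eqP/cnorm_small => e e0.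
  have a0 := cnorm_ge0 a.
  have A0 : 0 < 2 * ('N[a] + 1) by lra.
  have [n /(_ _ (leqnn _)) nP] := lP _ (divr_gt0 e0 A0).
  rewrite ltr_pdivlMr // in nP.
  have -> : a * l - l * a = (y n - l) * a - a * (y n - l).
    by rewrite mulrBl mulrBr -sqrt_iter_comm // opprB [RHS]addrC subrKA.
  apply: le_trans (cnormB _ _) _; have := cnormM a (y n - l).
  have := cnormM (y n - l) a; have := cnorm_ge0 (y n - l); nra.
have ll : l + l = c + l * l.
  suff lE : l = 2^-1 *: (c + l * l) by rewrite {1 2}lE -scalerDr scaler_halfD.
  apply/eqP; rewrite -subr_eq0; apply/eqP/cnorm_small => e e0.
  have [n nP] := lP _ (divr_gt0 (divr_gt0 e0 (ltr0n R 2)) (ltr_pwDl ltr01 (cnorm_ge0 l))).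
  have := nP _ (leqnn _); have /nP := leqnSn n => n1 n0.
  have l0 := cnorm_ge0 l.
  have L0 : 0 < 1 + 'N[l] by lra.
  rewrite ltr_pdivlMr // in n1; rewrite ltr_pdivlMr // in n0.
  apply: le_trans (cnorm_triangle (y n.+1) _ _) _.
  rewrite [leRHS](splitr e); apply: lerD.
    rewrite cnorm_distC; apply: le_trans (ltW n1).
    by rewrite ler_peMr ?cnorm_ge0 // lerDl.
  rewrite /= -scalerBr opprD addrACA subrr add0r.
  apply: le_trans (cnorm_sqrB (r := 1 + 'N[l]) _ _) _; last 1 first.
  - by rewrite mulrC ltW.
  - by apply: le_trans (sqrt_iter_le n) (le_trans (ltW c1) _); rewrite lerDl.
  - by rewrite lerDr.
exists (1 - l); split.
- by rewrite starB star1 sl.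
- have -> : c = l + l - l * l by rewrite ll addrK.
  by rewrite mulrBr mulr1 mulrBl mul1r !opprB -addrA; congr (1 + _); rewrite addrCA opprD.
- by move=> a /cl al; rewrite mulrBl mulrBr mulr1 mul1r al.
Qed.

End Iteration.
End SquareRoot.

Section Contractive.
Variables (R : realType) (O B : cstarAlgType R) (phi : starHom O B).

Local Notation i := (@Complex R 0 1 : Cplx R).

Lemma conj_i : (i^* : Cplx R) = - i.
Proof. by rewrite /=; apply/eqP; rewrite eq_complex /= oppr0 !eqxx. Qed.

Lemma i_sqr : i * i = -1.
Proof. by apply/eqP; rewrite eq_complex /=; apply/andP; split; apply/eqP; ring. Qed.

(** Under these hypotheses x + iy is unitary, and x is its real part. *)
Lemma cnorm_sqr_sum1 (x y : B) : star x = x -> star y = y -> x * y = y * x ->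
  x * x + y * y = 1 -> cnorm x <= 1.
Proof.
move=> sx sy xy x2y2; pose u := x + i *: y.
have su : star u = x - i *: y by rewrite starD sx starZ sy conj_i scaleNr.
have uu : star u * u = 1.
  rewrite su /u mulrDr !mulrBl -!scalerAl -!scalerAr xy !scalerA i_sqr.
  by rewrite scaleN1r opprK subrKA.
have -> : x = 2^-1 *: (u + star u) by rewrite su addrACA subrr addr0 scaler_halfD.
rewrite cnormZ normc_half ler_pdivrMl // mulr1.
apply: le_trans (cnormD _ _) _; rewrite cnorm_starE.
by have := cnorm_isometry uu; lra.
Qed.

(** A self-adjoint element of norm less than 1 satisfies a^2 + b^2 = 1 for some
    self-adjoint b commuting with it, a relation that every *-homomorphism
    preserves. *)
Lemma starHom_contr a : cnorm (phi a) <= cnorm a.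
Proof.
wlog sa : a / star a = a.
  move=> sc; rewrite -(@ler_pXn2r _ 2) ?nnegrE ?cnorm_ge0 // -!cnorm_star.
  by rewrite -star_homP -rmorphM; apply: sc; rewrite starM starK.
apply/ler_addgt0Pl => e e0; set s := e + _.
have s0 : 0 < s by rewrite ltr_pwDl // cnorm_ge0.
pose k : Cplx R := (s^-1)%:C%C; pose a' := k *: a.
have kc : k^* = k by rewrite /k /=; apply/eqP; rewrite eq_complex /= oppr0 !eqxx.
have nk : Normc.normc k = s^-1 by rewrite normc_real ger0_norm // invr_ge0 ltW.
have sa' : star a' = a' by rewrite starZ sa kc.
have a'1 : cnorm a' < 1.
  by rewrite cnormZ nk ltr_pdivrMl // mulr1 /s ltrDr.
have : cnorm (phi a') <= 1.
  have [||b [sb bb cb]] := @sqrt1B _ _ (a' * a').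
  - by rewrite starM sa'.
  - by rewrite -{1}sa' cnorm_star expr_lt1 // cnorm_ge0.
  apply: (@cnorm_sqr_sum1 _ (phi b)).
  - by rewrite -star_homP sa'.
  - by rewrite -star_homP sb.
  - by rewrite -!rmorphM cb // mulrA.
  - by rewrite -!rmorphM bb -rmorphD addrC subrK rmorph1.
by rewrite linearZ /= cnormZ nk ler_pdivrMl // mulr1.
Qed.

End Contractive.

(** * Points and cylinders of the shift space *)

Section ShiftSpace.
Variables (N : nat) (A : 'M[nat]_N).
Local Notation X := (shift_space A).
Implicit Types (x y z : X) (mu nu : seq 'I_N).

Lemma pt_edge x n : A (pt x n) (pt x n.+1) = 1%N.
Proof. exact: (set_mem (valP x) n). Qed.

Lemma pt_inj x y : (forall i, pt x i = pt y i) -> x = y.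
Proof. by move=> xy; apply: val_inj; apply/funext. Qed.

Definition mkpt (u : nat -> 'I_N) (uA : forall n, A (u n) (u n.+1) = 1%N) : X :=
  exist (fun y : {ptws nat -> discrete_topology 'I_N} => y \in shift_set A) u
    (mem_set uA).

Lemma pt_mkpt u uA i : pt (@mkpt u uA) i = u i. Proof. by []. Qed.

Lemma pt_iter n x i : pt (iter n (@sigma N A) x) i = pt x (n + i).
Proof.
elim: n i => [//|n IH] i; rewrite iterS.
by rewrite [LHS](_ : _ = pt (iter n (@sigma N A) x) i.+1) // IH addnS.
Qed.

Definition agree n x y := forall i, (i < n)%N -> pt y i = pt x i.

Lemma agree_refl n x : agree n x x. Proof. by []. Qed.

Lemma agree_sym n x y : agree n x y -> agree n y x.
Proof. by move=> xy i /xy. Qed.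

Lemma agree_trans n x y z : agree n x y -> agree n y z -> agree n x z.
Proof. by move=> xy yz i ni; rewrite yz ?xy. Qed.

Lemma agreeW m n x y : (m <= n)%N -> agree n x y -> agree m x y.
Proof. by move=> mn xy i im; apply: xy; exact: leq_trans im mn. Qed.

Lemma agree_eq x y : (forall n, agree n x y) -> x = y.
Proof. by move=> xy; apply: pt_inj => i; rewrite (xy i.+1). Qed.

Lemma agree_iter m n x y : agree (m + n) x y ->
  agree n (iter m (@sigma N A) x) (iter m (@sigma N A) y).
Proof. by move=> xy i ni; rewrite !pt_iter xy // ltn_add2l. Qed.

Definition pre x n := mkseq (pt x) n.

Lemma size_pre x n : size (pre x n) = n. Proof. exact: size_mkseq. Qed.

Lemma nth_pre j x n i : (i < n)%N -> nth j (pre x n) i = pt x i.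
Proof. by move=> ni; rewrite nth_mkseq. Qed.

Lemma eq_pre n x y : agree n x y <-> pre y n = pre x n.
Proof.
split=> [xy|xy i ni]; last by rewrite -(nth_pre (pt x 0) y ni) xy nth_pre.
apply: (@eq_from_nth _ (pt x 0)); rewrite !size_pre // => i ni.
by rewrite !nth_pre ?xy.
Qed.

Lemma cylinder_pre n x y : cylinder (pre x n) y <-> agree n x y.
Proof. by rewrite eq_pre /cylinder /= size_pre. Qed.

Lemma cylinderE mu x : cylinder mu x <-> pre x (size mu) = mu.
Proof. by []. Qed.

Lemma cylinder_agree mu x y : agree (size mu) x y -> cylinder mu x -> cylinder mu y.
Proof. by move=> /eq_pre xy; rewrite !cylinderE xy. Qed.

Lemma preS x n : pre x n.+1 = pt x 0 :: pre (sigma x) n.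
Proof.
rewrite /pre /mkseq [iota _ _]/= -(addn0 1%N) iotaDl /= -map_comp.
by congr cons; apply: eq_map => i.
Qed.

Lemma preD x m n : pre x (m + n) = pre x m ++ pre (iter m (@sigma N A) x) n.
Proof.
elim: m x => [//|m IH] x; rewrite addSn !preS IH cat_cons.
by rewrite iterSr.
Qed.

Lemma cylinder_cons i mu x :
  cylinder (i :: mu) x <-> pt x 0 = i /\ cylinder mu (sigma x).
Proof.
rewrite !cylinderE [size _]/= preS.
by split=> [[-> ->]|[-> ->]].
Qed.

Lemma cylinder_iter mu nu x y : size mu = size nu ->
  cylinder mu x -> cylinder mu y ->
  iter (size nu) (@sigma N A) x = iter (size nu) (@sigma N A) y -> x = y.
Proof.
move=> <- xmu ymu xy; apply: pt_inj => i.
have [im|mi] := ltnP i (size mu).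
  have /eq_pre a : pre y (size mu) = pre x (size mu) by rewrite [LHS]ymu [RHS]xmu.
  by rewrite a.
by rewrite -(subnKC mi) -!pt_iter xy.
Qed.

(** * Topology of the shift space *)

Lemma cvg_pt i : continuous ((fun x => pt x i) : X -> discrete_topology 'I_N).
Proof.
move=> x; apply: (@continuous_comp _ _ _ (set_val : X -> _)
   (@proj nat (fun=> discrete_topology 'I_N) i)).
  exact: initial_continuous.
exact: proj_continuous.
Qed.

(** The topology is initial for the evaluations at finitely many coordinates, so
    that every continuity question becomes one about prefixes. *)
Lemma nbhs_cylP x (P : set X) :
  nbhs x P <-> exists n, forall y, agree n x y -> P y.
Proof.
split=> [|[n nP]]; last first.
  have : nbhs x (agree n x).
    elim: n {nP} => [|n IH]; first by apply: filterS filterT => y _ [].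
    have : nbhs x [set y | pt y n = pt x n].
      exact: (@cvg_pt n x [set pt x n] (discrete_set1 _)).
    apply: filterS2 IH => y ya yn i; rewrite ltnS leq_eqVlt => /orP[/eqP->//|].
    exact: ya.
  by apply: filterS => y /nP.
case=> _ [[B oB <-] /= Bx BP].
pose F := filter_from setT (fun n => [set u : {ptws nat -> discrete_topology 'I_N} |
   forall i, (i < n)%N -> u i = pt x i]).
have FF : Filter F.
  apply: filter_from_filter; first by exists 0%N.
  move=> m n _ _; exists (maxn m n) => // u um; split => i im; apply: um.
    by rewrite leq_max im.
  by rewrite leq_max im orbT.
have Fx : {ptws, F --> (val x : {ptws nat -> discrete_topology 'I_N})}.
  apply/pointwise_cvgP => i U /principal_filterP Ui.
  by exists i.+1 => // u /= ->.
have /Fx [n _ nB] : nbhs (val x : {ptws nat -> discrete_topology 'I_N}) B.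
  exact: open_nbhs_nbhs.
by exists n => y xy; apply: BP; apply: nB.
Qed.

Lemma loc_const_continuous (V : topologicalType) (g : X -> V) :
  (forall x, exists n, forall y, agree n x y -> g y = g x) -> continuous g.
Proof.
move=> gc x U gxU; apply/nbhs_cylP; have [n nP] := gc x; exists n => y /nP gy.
by rewrite /= gy; exact: nbhs_singleton gxU.
Qed.

Lemma continuous_loc_const (V : discreteTopologicalType) (g : X -> V) :
  continuous g -> forall x, exists n, forall y, agree n x y -> g y = g x.
Proof. by move=> gc x; apply/nbhs_cylP; exact: (gc x [set g x] (discrete_set1 _)). Qed.

Lemma continuous_agree (t : X -> X) : continuous t <->
  forall x n, exists m, forall y, agree m x y -> agree n (t x) (t y).
Proof.
split=> [tc x n|tc x U /nbhs_cylP[n nU]].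
  by apply/nbhs_cylP; apply: (tc x (agree n (t x))); apply/nbhs_cylP; exists n.
by apply/nbhs_cylP; have [m mP] := tc x n; exists m => y /mP /nU.
Qed.

(** The i-th coordinate of the limit can be read off from any term of the sequence
    whose fixed prefix is longer than i. *)
Lemma nested_limit (u : nat -> X) (k : nat -> nat) :
  (forall n, (n <= k n)%N) -> (forall n, (k n <= k n.+1)%N) ->
  (forall n, agree (k n) (u n) (u n.+1)) ->
  exists x, forall n, agree (k n) (u n) x.
Proof.
move=> nk kS uS.
have uD n m : agree (k n) (u n) (u (n + m)%N).
  elim: m => [|m IH]; rewrite ?addn0 // addnS; apply: agree_trans IH _.
  apply: agreeW (uS _); elim: m => [|m IH]; rewrite ?addn0 // addnS.
  exact: leq_trans IH (kS _).
have uE n i : (i < k n)%N -> pt (u i.+1) i = pt (u n) i.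
  move=> ik; have ii : (i < k i.+1)%N by exact: leq_trans (nk _).
  have /orP[/subnKC e|/subnKC e] := leq_total n i.+1.
    by have := uD n (i.+1 - n)%N; rewrite e => ->.
  by have := uD i.+1 (n - i.+1)%N; rewrite e => ->.
have uA i : A (pt (u i.+1) i) (pt (u i.+2) i.+1) = 1%N.
  rewrite (uE i.+2 i) ?pt_edge //; apply: leq_trans (kS _); exact: nk.
by exists (mkpt uA) => n i /uE; rewrite pt_mkpt.
Qed.

(** Compactness of the shift space, in the form of Koenig's lemma: a cylinder on
    which P fails at arbitrarily large levels contains a smaller one, because the
    alphabet is finite, and P fails at the point to which these cylinders shrink. *)
Lemma koenig (P : X -> nat -> Prop) :
  (forall x m n, (m <= n)%N -> P x m -> P x n) ->
  (forall x y n, agree n x y -> P x n -> P y n) ->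
  (forall x, exists n, P x n) -> exists n, forall x, P x n.
Proof.
move=> Pmon Pagr Pex; apply: contrapT => noN.
pose bad x n := forall m, (n <= m)%N -> exists y, agree n x y /\ ~ P y m.
have badS x n : bad x n -> exists y, agree n x y /\ bad y n.+1.
  move=> bx; apply: contrapT => nb.
  have /choice[M MP] (j : 'I_N) : exists m, forall y, agree n x y -> pt y n = j ->
      P y m.
    have [[z [xz zj]]|noz] := pselect (exists z, agree n x z /\ pt z n = j);
      last by exists 0%N => y xy yj; case: noz; exists y.
    apply: contrapT => noM; apply: nb; exists z; split=> // m mn.
    apply: contrapT => noy; apply: noM; exists m => y xy yj.
    apply: contrapT => nP; apply: noy; exists y; split=> // i.
    rewrite ltnS leq_eqVlt => /orP[/eqP->|ni]; first by rewrite yj zj.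
    by rewrite xy // xz.
  have [|y [xy nPy]] := bx (n + \max_j M j)%N; first exact: leq_addr.
  apply: nPy; apply: Pmon (MP _ _ xy erefl).
  by apply: leq_trans (leq_addl _ _); exact: (@leq_bigmax _ M).
have [x0 bad0] : exists x, bad x 0%N.
  have [x _] : exists x : X, ~ P x 0%N.
    by apply: contrapT => /forallNP nx; apply: noN; exists 0%N => x; apply: contrapT.
  exists x => m _; apply: contrapT => /forallNP ny; apply: noN; exists m => y.
  by apply: contrapT => nPy; apply: (ny y); split=> // i.
have [|u [u0 uS]] := @dependent_choice (X * nat)
  (fun p q => bad p.1 p.2 -> [/\ agree p.2 p.1 q.1, bad q.1 q.2 & q.2 = p.2.+1]) _ (x0, 0%N).
  move=> [x n]; apply: cid; have [b|nb] := pselect (bad x n); last by exists (x, n).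
  by have [y [xy b']] := badS _ _ b; exists (y, n.+1).
have ub n : bad (u n).1 (u n).2 /\ (u n).2 = n.
  elim: n => [|n [/uS[_ b e] en]]; first by rewrite u0.
  by split; last rewrite e en.
have [|||x xP] := @nested_limit (fun n => (u n).1) id _ _ _ => //.
  by move=> n; have [b e] := ub n; have [] := uS n b; rewrite e.
have [n Pn] := Pex x; have [b e] := ub n.
have [|y [xy nP]] := b n; first by rewrite e.
rewrite e in xy; apply: nP; apply: Pagr Pn.
exact: agree_trans (agree_sym (xP n)) xy.
Qed.

End ShiftSpace.

(** * Aperiodic points *)

Section Aperiodic.
Variables (N : nat) (A : 'M[nat]_N).
Hypotheses (hA01 : forall i j, A i j = 0%N \/ A i j = 1%N)
  (hAirr : irreducible A) (hAperm : ~~ is_perm_mx A).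
Local Notation X := (shift_space A).
Local Notation sg := (@sigma N A).
Implicit Types (x y z : X).

Lemma irr_ind (P : 'I_N -> Prop) j :
  (forall i k, A i k = 1%N -> P k -> P i) -> P j -> forall i, P i.
Proof.
move=> PA Pj i; have [n _] := hAirr i j; elim: n i => [|n IH] i.
  by rewrite expr0 mxE; case: (i =P j) => [->//|_]; rewrite eqxx.
rewrite exprS mxE; have [[k Ak]|Aeq0] := pselect (exists k, A i k * (A ^+ n) k j != 0)%N.
  case: (hA01 i k) Ak => Aik; rewrite Aik ?mul0n ?mul1n => // /IH Pk _.
  exact: PA Aik Pk.
rewrite big1 ?eqxx // => k _; apply/eqP/negPn/negP => Ak; apply: Aeq0.
by exists k.
Qed.

Lemma out_edge i : exists j, A i j = 1%N.
Proof.
have [[//|n] _] := hAirr i i; rewrite exprS mxE => An; apply: contrapT => nj.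
move: An; rewrite big1 ?eqxx // => k _; case: (hA01 i k) => [->|Aik].
  exact: mul0n.
by case: nj; exists k.
Qed.

Lemma in_edge j : exists i, A i j = 1%N.
Proof.
have [[//|n] _] := hAirr j j; rewrite exprSr mxE => An; apply: contrapT => nj.
move: An; rewrite big1 ?eqxx // => k _; case: (hA01 k j) => [->|Aik].
  exact: muln0.
by case: nj; exists k.
Qed.

(** Otherwise every vertex has a unique successor; every vertex being a successor,
    A would be the matrix of a permutation. *)
Lemma ex_branch : exists i j k, [/\ A i j = 1%N, A i k = 1%N & j <> k].
Proof.
apply: contrapT => nobr.
have [s sP] := choice out_edge.
have sE i j : A i j = 1%N -> j = s i.
  by move=> Aij; apply: contrapT => js; apply: nobr; exists i, j, (s i); split.
have [p pP] := choice in_edge.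
have sp : cancel p s by move=> j; rewrite -(sE _ _ (pP j)).
have [g pg gp] := injF_bij (can_inj sp).
have sg' : s =1 g by move=> i; rewrite -{1}(gp i) sp.
have sinj : injective s by move=> i j; rewrite !sg' => /(can_inj gp).
apply: (negP hAperm); apply/is_perm_mxP; exists (perm sinj).
apply/matrixP => i j; rewrite !mxE permE.
case: eqP => [<-|sj]; first by rewrite sP.
by case: (hA01 i j) => [->|/sE/esym] //.
Qed.

Lemma ex_pt i : exists x, pt x 0 = i.
Proof.
have [s sP] := choice out_edge.
have uA n : A (iter n s i) (iter n.+1 s i) = 1%N by exact: sP.
by exists (mkpt uA).
Qed.

Lemma ex_cons i x : A i (pt x 0) = 1%N -> exists y, pt y 0 = i /\ sigma y = x.
Proof.
move=> Aix.
have uA n : A ((fun n => if n is n'.+1 then pt x n' else i) n)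
              ((fun n => if n is n'.+1 then pt x n' else i) n.+1) = 1%N.
  by case: n => [//|n]; exact: pt_edge.
by exists (mkpt uA); split=> //; apply: pt_inj.
Qed.

Lemma two_pt i : exists x y, [/\ pt x 0 = i, pt y 0 = i & x <> y].
Proof.
have [i0 [j [k [Aij Aik jk]]]] := ex_branch.
move: i; apply: (@irr_ind _ i0) => [i l Ail [x [y [xl yl xy]]]|].
  have [|x' [x'i x'x]] := @ex_cons i x; first by rewrite xl.
  have [|y' [y'i y'y]] := @ex_cons i y; first by rewrite yl.
  by exists x', y'; split=> // e; apply: xy; rewrite -x'x e.
have [x xj] := ex_pt j; have [y yk] := ex_pt k.
have [|x' [x'i x'x]] := @ex_cons i0 x; first by rewrite xj.
have [|y' [y'i y'y]] := @ex_cons i0 y; first by rewrite yk.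
by exists x', y'; split=> // e; apply: jk; rewrite -xj -yk -x'x e y'y.
Qed.

(** The shift space has no isolated point, as every vertex leads to one with two
    outgoing edges. *)
Lemma perfect x n : exists y, agree n x y /\ y <> x.
Proof.
suff [y [z [xy xz yz]]] : exists y z, [/\ agree n.+1 x y, agree n.+1 x z & y <> z].
  have [yx|yx] := pselect (y = x).
    by exists z; split; [exact: agreeW xz|move=> e; apply: yz; rewrite e].
  by exists y; split=> //; exact: agreeW xy.
elim: n x => [|n IH] x.
  have [y [z [yx zx yz]]] := two_pt (pt x 0).
  by exists y, z; split=> // -[].
have [y [z [xy xz yz]]] := IH (sigma x).
have [|y' [y'0 y'y]] := @ex_cons (pt x 0) y; first by rewrite (xy 0%N) // pt_edge.
have [|z' [z'0 z'z]] := @ex_cons (pt x 0) z; first by rewrite (xz 0%N) // pt_edge.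
exists y', z'; split; last by move=> e; apply: yz; rewrite -y'y e z'z.
  by case=> // i /xy; rewrite -y'y.
by case=> // i /xz; rewrite -z'z.
Qed.

Definition aperiodic x := forall m n, iter m sg x = iter n sg x -> m = n.

Lemma eventually_periodic_determined m n x y : (m < n)%N ->
  iter m sg x = iter n sg x -> iter m sg y = iter n sg y -> agree n x y -> x = y.
Proof.
move=> mn ex ey xy; apply: pt_inj => i; elim/ltn_ind: i => i IH.
have [/xy->//|ni] := ltnP i n.
have E z : iter m sg z = iter n sg z -> pt z i = pt z (m + (i - n)).
  by move=> ez; rewrite -{1}(subnKC ni) -pt_iter -ez pt_iter.
by rewrite (E _ ex) (E _ ey) IH //; lia.
Qed.

(** If two iterates agree at x, they differ at a nearby point, as a point of their
    coincidence set is determined by a prefix and there are no isolated points. *)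
Lemma separate m n x l : (m < n)%N -> exists y k, [/\ agree l x y, (l <= k)%N &
  forall z, agree k y z -> iter m sg z <> iter n sg z].
Proof.
move=> mn.
suff [y [xy ey]] : exists y, agree l x y /\ iter m sg y <> iter n sg y.
  have [i yi] : exists i, pt y (m + i) <> pt y (n + i).
    apply: contrapT => nd; apply: ey; apply: pt_inj => i; rewrite !pt_iter.
    by apply: contrapT => yi; apply: nd; exists i.
  exists y, (maxn l (n + i).+1); split=> //; first exact: leq_maxl.
  move=> z yz e; apply: yi; rewrite -(yz (m + i)%N) -?(yz (n + i)%N); last 2 first.
  - by rewrite leq_max ltnSn orbT.
  - by rewrite leq_max !ltnS leq_add2r (ltnW mn) orbT.
  by rewrite -!pt_iter e.
have [ex|] := pselect (iter m sg x = iter n sg x); last by exists x.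
have [y [xy yx]] := perfect x (maxn l n).
exists y; split; first exact: agreeW (leq_maxl _ _) xy.
move=> ey; apply: yx; apply/esym; apply: eventually_periodic_determined mn ex ey _.
exact: agreeW (leq_maxr _ _) xy.
Qed.

(** A Baire category argument: at stage k of the construction the k-th pair of
    exponents is separated for good. *)
Lemma aperiodic_dense x n : exists y, agree n x y /\ aperiodic y.
Proof.
pose e k : nat * nat := odflt (0, 0)%N (unpickle k).
pose R (p q : X * nat * nat) := [/\ agree p.1.2 p.1.1 q.1.1, (p.1.2 < q.1.2)%N,
  q.2 = p.2.+1 & ((e p.2).1 < (e p.2).2)%N -> forall z, agree q.1.2 q.1.1 z ->
    iter (e p.2).1 sg z <> iter (e p.2).2 sg z].
have [|u [u0 uS]] := @dependent_choice _ R _ (x, n, 0%N).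
  move=> [[y l] k]; apply: cid.
  have [lt|ge] := ltnP (e k).1 (e k).2; last first.
    by exists (y, l.+1, k.+1); split=> //= lt; move: ge; rewrite leqNgt lt.
  have [z [m [yz lm zm]]] := separate y l lt.
  exists (z, m.+1, k.+1); split=> //= _ w zw; apply: zm; exact: agreeW zw.
have u2 k : (u k).2 = k by elim: k => [|k IH]; [rewrite u0|have [_ _ ->] := uS k; rewrite IH].
have u1 k : (n + k <= (u k).1.2)%N.
  elim: k => [|k IH]; first by rewrite u0 addn0.
  by rewrite addnS; have [_ + _ _] := uS k; exact: leq_ltn_trans.
have [|||y yP] := @nested_limit _ A (fun k => (u k).1.1) (fun k => (u k).1.2).
- by move=> k; apply: leq_trans (u1 k); exact: leq_addl.
- by move=> k; have [_ /ltnW] := uS k.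
- by move=> k; have [] := uS k.
exists y; split; first by have := yP 0%N; rewrite u0.
suff lt p q : (p < q)%N -> iter p sg y <> iter q sg y.
  by move=> p q pq; case: (ltngtP p q) => // /lt; rewrite pq.
have [k ek] : exists k, e k = (p, q) by exists (pickle (p, q)); rewrite /e pickleK.
by move=> pq; have [_ _ _] := uS k; rewrite u2 ek => /(_ pq); apply; exact: (yP k.+1).
Qed.

Lemma aperiodic_iter x n : aperiodic (iter n sg x) <-> aperiodic x.
Proof.
split=> ax p q; last by rewrite -!iterD => /ax /addIn.
move=> e; have : iter p sg (iter n sg x) = iter q sg (iter n sg x).
  by rewrite -!iterD addnC (addnC q) !iterD e.
exact: ax.
Qed.

(** Locally constant data cannot tell a point from the aperiodic points that
    approximate it. *)
Lemma aperiodic_closed (V : Type) (g h : X -> V) :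
  (forall x, exists n, forall y, agree n x y -> g y = g x) ->
  (forall x, exists n, forall y, agree n x y -> h y = h x) ->
  forall x n, (forall y, agree n x y -> aperiodic y -> g y = h y) ->
  forall y, agree n x y -> g y = h y.
Proof.
move=> gc hc x n gh y xy.
have [p pP] := gc y; have [q qP] := hc y.
have [z [yz az]] := aperiodic_dense y (maxn n (maxn p q)).
have xz : agree n x z by apply: agree_trans xy (agreeW _ yz); exact: leq_maxl.
have py : agree p y z by apply: agreeW yz; rewrite !leq_max leqnn !orbT.
have qy : agree q y z by apply: agreeW yz; rewrite !leq_max leqnn !orbT.
by rewrite -(pP z py) -(qP z qy) gh.
Qed.

End Aperiodic.

(** * Locally constant functions and cocycles *)

Section LocallyConstant.
Variables (N : nat) (A : 'M[nat]_N).
Local Notation X := (shift_space A).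
Local Notation sg := (@sigma N A).
Implicit Types (x y z : X).

Definition lconst (V : Type) (g : X -> V) :=
  forall x, exists n, forall y, agree n x y -> g y = g x.

Lemma lconst_comp (V W : Type) (F : V -> W) (g : X -> V) :
  lconst g -> lconst (fun x => F (g x)).
Proof. by move=> gc x; have [n nP] := gc x; exists n => y /nP ->. Qed.

Lemma lconst_comp2 (V W T : Type) (F : V -> W -> T) (g : X -> V) (h : X -> W) :
  lconst g -> lconst h -> lconst (fun x => F (g x) (h x)).
Proof.
move=> gc hc x; have [m mP] := gc x; have [n nP] := hc x.
exists (maxn m n) => y xy.
by rewrite mP ?nP //; apply: agreeW xy; rewrite ?leq_maxl ?leq_maxr.
Qed.

Lemma lconst_continuous (V : Type) (g : X -> V) (t : X -> X) :
  continuous t -> lconst g -> lconst (fun x => g (t x)).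
Proof.
move=> /continuous_agree tc gc x; have [n nP] := gc (t x).
by have [m mP] := tc x n; exists m => y /mP /nP.
Qed.

Lemma iter_continuous n : continuous (iter n sg).
Proof.
apply/continuous_agree => x m; exists (n + m)%N => y; exact: agree_iter.
Qed.

Lemma lconst_cylinder mu : lconst (@cylinder N A mu).
Proof.
move=> x; exists (size mu) => y xy; apply/propext; split.
  by apply: cylinder_agree; exact: agree_sym.
exact: cylinder_agree.
Qed.

(** Whether a word can precede z only depends on the first letter of z. *)
Lemma splice x n z : agree 1 (iter n sg x) z ->
  exists y, agree n x y /\ iter n sg y = z.
Proof.
move=> xz; pose u i := if (i < n)%N then pt x i else pt z (i - n).
have uA i : A (u i) (u i.+1) = 1%N.
  rewrite /u; case: (ltngtP i.+1 n) => [lt|lt|e].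
  - exact: pt_edge.
  - by rewrite subSn ?pt_edge // -ltnS.
  - by rewrite e subnn (xz 0%N) // pt_iter addn0 -e pt_edge.
exists (mkpt uA); split; first by move=> i ni; rewrite pt_mkpt /u ni.
by apply: pt_inj => i; rewrite pt_iter pt_mkpt /u ltnNge leq_addr addKn.
Qed.

Lemma lconst_image mu : lconst (fun z => exists x, cylinder mu x /\ iter (size mu) sg x = z).
Proof.
suff h z y : agree 1 z y -> (exists x, cylinder mu x /\ iter (size mu) sg x = z) ->
    exists x, cylinder mu x /\ iter (size mu) sg x = y.
  move=> z; exists 1%N => y zy; apply/propext; split; apply: h => //.
  exact: agree_sym.
move=> zy [x [mx xz]]; rewrite -xz in zy; have [x' [xx' x'y]] := splice zy.
by exists x'; split=> //; exact: cylinder_agree mx.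
Qed.

Variable f : X -> int.
Hypothesis hf : continuous (f : X -> discrete_topology int).

Definition birkhoff n x : int := \sum_(0 <= i < n) f (iter i sg x).
Local Notation E := birkhoff.

Lemma birkhoffD m n x : E (m + n) x = E m x + E n (iter m sg x).
Proof. exact: ED. Qed.

Lemma lconst_f : lconst f.
Proof. exact: (@continuous_loc_const _ _ (discrete_topology int)). Qed.

Lemma lconst_birkhoff n : lconst (E n).
Proof.
rewrite /birkhoff; elim: n => [|n IH] x.
  by exists 0%N => y _; rewrite !big_nil.
have [m mP] := @lconst_comp2 _ _ _ +%R _ _ IH
  (lconst_continuous (@iter_continuous n) lconst_f) x.
by exists m => y /mP; rewrite !big_nat_recr.
Qed.

Definition germ (tau : X -> X) x k l m := forall y, agree m x y ->
  iter k sg (tau y) = iter l sg y /\ E k (tau y) = E l y.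

(** By compactness, exponents that are valid near each point can be chosen as
    functions of a prefix of fixed length, hence continuously. *)
Lemma Gamma_fP tau : Gamma_f_set f tau <->
  homeomorphism tau /\ forall x, exists k l m, germ tau x k l m.
Proof.
split=> [[[htau _] [k [l [kl r]]]]|[htau gm]].
  split=> // x; have [kc lc e] := kl.
  have [m mP] := @lconst_comp2 _ _ _ pair _ _ (continuous_loc_const kc)
    (continuous_loc_const lc) x.
  exists (k x), (l x), m => y /mP [kE lE]; rewrite -kE -lE; split=> //.
  by have := r y; rewrite (rho_cocycleE _ _ kl) => /subr0_eq.
suff [k [l [kl r]]] : exists k l, orbit_cocycles tau k l /\
    forall x, rho_cocycle f k l x tau = 0.
  by split; [split=> //|]; exists k, l.
have [m mP] : exists m, forall x, exists k l, germ tau x k l m.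
  apply: koenig => [x m n mn [k [l g]]|x y n xy [k [l g]]|x].
  - by exists k, l => y xy; apply: g; exact: agreeW xy.
  - by exists k, l => z yz; apply: g; exact: agree_trans xy yz.
  - by have [k [l [m g]]] := gm x; exists m, k, l.
have [F FP] : {F : seq 'I_N -> nat * nat | forall x, germ tau x (F (pre x m)).1 (F (pre x m)).2 m}.
  apply: cid; have [w|F FP] := @choice _ _ (fun (w : seq 'I_N) (kl : nat * nat) =>
      forall x, pre x m = w -> germ tau x kl.1 kl.2 m); last by exists F => x; exact: FP.
  have [[x xw]|nox] := pselect (exists x, pre x m = w); last first.
    by exists (0, 0)%N => x xw; case: nox; exists x.
  have [k [l g]] := mP x; exists (k, l) => y yw z yz; apply: g.
  by apply: agree_trans yz; apply/eq_pre; rewrite yw.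
have Fc : lconst (fun x => F (pre x m)) by move=> x; exists m => y /eq_pre ->.
have kl : orbit_cocycles tau (fun x => (F (pre x m)).1) (fun x => (F (pre x m)).2).
  split; last by move=> x; have [] := FP x x.
    exact: (loc_const_continuous (lconst_comp fst Fc)).
  exact: (loc_const_continuous (lconst_comp snd Fc)).
do 2!eexists; split; first exact: kl.
move=> x; rewrite (rho_cocycleE _ _ kl); apply/eqP; rewrite subr_eq0; apply/eqP.
by have [] := FP x x.
Qed.

End LocallyConstant.
(** * Roots of unity *)

Section UnitCircle.
Variable R : realType.
Local Notation C := (Cplx R).
Local Notation ex := (@expi2pi R).

Lemma expi0 : ex 0 = 1.
Proof. by rewrite /expi2pi mulr0 cos0 sin0. Qed.

Lemma expiD s t : ex (s + t) = ex s * ex t.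
Proof.
rewrite /expi2pi mulrDr cosD sinD; apply/eqP; rewrite eq_complex /=.
by apply/andP; split; apply/eqP; ring.
Qed.

Lemma expiN t : ex (- t) = (ex t)^*.
Proof. by rewrite /expi2pi mulrN cosN sinN. Qed.

Lemma expi_conjM t : ex t * (ex t)^* = 1.
Proof. by rewrite -expiN -expiD subrr expi0. Qed.

Lemma normc_expi t : Normc.normc (ex t) = 1.
Proof. by rewrite /Normc.normc /expi2pi cos2Dsin2 sqrtr1. Qed.

Lemma expi_half : ex (2^-1) = -1.
Proof.
rewrite /expi2pi mulrC mulrA mulVf ?mul1r ?pnatr_eq0 // cospi sinpi.
by apply/eqP; rewrite eq_complex /= oppr0 !eqxx.
Qed.

Lemma expi1 : ex 1 = 1.
Proof. by rewrite [1 in LHS]splitr mul1r expiD expi_half mulrNN mulr1. Qed.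

Lemma expi_nat n : ex n%:R = 1.
Proof. by elim: n => [|n IH]; rewrite ?expi0 // -natr1 expiD IH expi1 mul1r. Qed.

Lemma expi_int (n : int) : ex n%:~R = 1.
Proof. by case: n => n; rewrite ?NegzE ?mulrNz ?expiN -?pmulrn expi_nat ?rmorph1. Qed.

Lemma expi_eq1 t : 0 < t -> t < 1 -> ex t <> 1.
Proof.
move=> t0 t1 e; have : ex (t / 2 + t / 2) = 1 by rewrite -splitr.
rewrite expiD => /eqP; rewrite -expr2 sqrf_eq1 => /orP[] /eqP
  /(congr1 (fun z : R[i] => let: Complex _ y := z in y)).
  rewrite /= => /eqP; have -> : 2 * pi * (t / 2) = pi * t by field.
  by rewrite gt_eqF // sin_gt0_pi // mulr_gt0 ?pi_gt0 //= -[ltRHS]mulr1 ltr_pM2l ?pi_gt0.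
rewrite /= oppr0 => /eqP; have -> : 2 * pi * (t / 2) = pi * t by field.
by rewrite gt_eqF // sin_gt0_pi // mulr_gt0 ?pi_gt0 //= -[ltRHS]mulr1 ltr_pM2l ?pi_gt0.
Qed.

(** A geometric sum whose ratio is an M-th root of unity, nontrivial unless M
    divides m. *)
Lemma expi_sum (M : nat) (m : int) : (0 < M)%N ->
  \sum_(k < M) ex (m%:~R * (k%:R / M%:R)) = if (M%:Z %| m)%Z then M%:R else 0.
Proof.
move=> M0; have MR : (M%:R : R) != 0 by rewrite pnatr_eq0 -lt0n.
have Mz : M%:Z != 0 by rewrite -lt0n.
have E k : ex (m%:~R * (k%:R / M%:R)) = ex (m%:~R / M%:R) ^+ k.
  elim: k => [|k IH]; first by rewrite mul0r mulr0 expi0.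
  by rewrite exprS -IH -expiD; congr ex; rewrite -natr1; field.
under eq_bigr do rewrite E.
have [/dvdzP[j ->]|ndvd] := boolP (M%:Z %| m)%Z.
  under eq_bigr => k _ do rewrite intrM -pmulrn mulfK // expi_int expr1n.
  by rewrite sumr_const card_ord.
set z := ex _.
have zM : z ^+ M = 1.
  rewrite -E mulfV // mulr1; exact: expi_int.
have z1 : z != 1.
  apply/eqP => z1; move: ndvd => /negP; apply.
  pose r := (m %% M%:Z)%Z.
  have r0 : 0 <= r by exact: modz_ge0.
  have rM : r < M%:Z by exact: ltz_pmod.
  have zr : z = ex (r%:~R / M%:R).
    rewrite /z {1}(divz_eq m M%:Z) intrD intrM mulrDl -[M%:~R]pmulrn mulfK //.
    by rewrite expiD expi_int mul1r.
  apply/dvdz_mod0P; apply: contrapT => /eqP rn0.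
  apply: (@expi_eq1 (r%:~R / M%:R)); last by rewrite -zr.
    by rewrite divr_gt0 ?ltr0n // ltr0z lt_def rn0.
  by rewrite ltr_pdivrMr ?ltr0n // mul1r pmulrn ltr_int.
have := subrX1 z M; rewrite zM subrr => /esym/eqP; rewrite mulf_eq0 subr_eq0 (negbTE z1) /=.
by move/eqP.
Qed.

End UnitCircle.
(** * Subgroups and inner automorphisms *)

Section Groups.

Definition morphism_of (G H : groupType) (h : G -> H)
    (hM : {morph h : x y / (x * y)%g}) : {multiplicative G -> H} :=
  @Multiplicative.Pack G H h (Multiplicative.Class (@isMultiplicative.Axioms_ G H h hM)).

Definition mksub (G : groupType) (H : subgroup G) (x : G) (Hx : sg_set H x) : subGrp H :=
  exist _ x (mem_set Hx).

Lemma gvalP (G : groupType) (H : subgroup G) (x : subGrp H) : sg_set H (gval x).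
Proof. exact: set_mem (valP x). Qed.

Lemma gval_inj (G : groupType) (H : subgroup G) : injective (@gval G H).
Proof. exact: val_inj. Qed.

Lemma gvalM (G : groupType) (H : subgroup G) (x y : subGrp H) :
  gval (x * y)%g = (gval x * gval y)%g.
Proof. by []. Qed.

Lemma gval1 (G : groupType) (H : subgroup G) : gval (1%g : subGrp H) = 1%g.
Proof. by []. Qed.

End Groups.

Section Automorphisms.
Variables (R : realType) (O : cstarAlgType R) (F D : starSub O).

Definition Ad_fun (u : unitaryGroup F) (a : set_type F) : set_type F :=
  let: And3 Fu _ _ := uvalP u in
  exist _ (uval u * val a * star (uval u))
    (mem_set (ssM (ssM Fu (set_mem (valP a))) (ssS Fu))).

Lemma Ad_funE u a : val (Ad_fun u a) = uval u * val a * star (uval u).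
Proof. by rewrite /Ad_fun; case: (uvalP u). Qed.

Lemma Ad_funK u : cancel (Ad_fun u) (Ad_fun u^-1%g).
Proof.
move=> a; apply: val_inj; rewrite !Ad_funE.
have -> : uval u^-1%g = star (uval u) by [].
have [_ su us] := uvalP u.
by rewrite starK !mulrA su mul1r -mulrA su mulr1.
Qed.

Lemma Ad_funVK u : cancel (Ad_fun u^-1%g) (Ad_fun u).
Proof.
move=> a; apply: val_inj; rewrite !Ad_funE.
have -> : uval u^-1%g = star (uval u) by [].
have [_ su us] := uvalP u.
by rewrite starK !mulrA us mul1r -mulrA us mulr1.
Qed.

Definition Ad_bij u : selfBij (set_type F) := SelfBij (@Ad_funK u) (@Ad_funVK u).

Lemma Ad_bijE u a : val (Ad_bij u a) = uval u * val a * star (uval u).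
Proof. exact: Ad_funE. Qed.

Lemma Ad_bij_isAd u : is_Ad u (Ad_bij u). Proof. exact: Ad_bijE. Qed.

Lemma is_Ad_inj u (al be : selfBij (set_type F)) : is_Ad u al -> is_Ad u be -> al = be.
Proof. by move=> ual ube; apply: selfBijP => a; apply: val_inj; rewrite ual ube. Qed.

Lemma is_AdM u v (al be : selfBij (set_type F)) :
  is_Ad u al -> is_Ad v be -> is_Ad (u * v)%g (al * be)%g.
Proof.
move=> ual vbe a.
have -> : (al * be)%g a = al (be a) by [].
have -> : uval (u * v)%g = uval u * uval v by [].
by rewrite ual vbe starM !mulrA.
Qed.

Hypothesis DF : forall a, ss_set D a -> ss_set F a.

Lemma Ad_bij_inner u : normalizer_set D u -> inner_set D (Ad_bij u).
Proof.
move=> uN; split; first by exists u; exact: Ad_bij_isAd.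
have /normalizerE uE := uN.
apply/seteqP; split=> [_ [a Da <-]|b /= Db].
  by rewrite /= Ad_bijE; apply/uE.
have : ss_set D (val b) by [].
rewrite -{1}uN => -[a Da ab].
exists (exist _ a (mem_set (DF Da))) => //.
by apply: val_inj; rewrite Ad_bijE.
Qed.

Lemma inner_normalizer (u : unitaryGroup F) (al : selfBij (set_type F)) :
  inner_set D al -> is_Ad u al -> normalizer_set D u.
Proof.
move=> [_ alD] ual; apply/seteqP; split=> [_ [a Da <-]|b Db].
  pose a' : set_type F := exist _ a (mem_set (DF Da)).
  have : [set a : set_type F | ss_set D (val a)] (al a') by rewrite -alD; exists a'.
  by rewrite /= ual.
pose b' : set_type F := exist _ b (mem_set (DF Db)).
have : [set a : set_type F | ss_set D (val a)] b' by [].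
by rewrite -alD => -[a /= Da /(congr1 val)]; rewrite ual => e; exists (val a).
Qed.

End Automorphisms.

(** * The diagonal subalgebra as an algebra of functions *)

Section DiagonalCalculus.
Variables (R : realType) (N : nat) (A : 'M[nat]_N).
Hypotheses (hA01 : forall i j, A i j = 0%N \/ A i j = 1%N)
  (hAirr : irreducible A) (hAperm : ~~ is_perm_mx A).
Variables (O : cstarAlgType R) (S : 'I_N -> O).
Hypothesis hck : ck_family A S.
Local Notation X := (shift_space A).
Local Notation sg := (@sigma N A).
Local Notation C := (Cplx R).
Variable Phi : (X -> C) -> O.
Hypothesis hPhi : is_diagonal_iso S Phi.
Implicit Types (x y z : X) (mu nu : seq 'I_N) (g h : X -> C) (a b d : O).
Local Notation D := (DA A S).

Lemma lconst_cont g : lconst g -> continuous g.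
Proof. exact: loc_const_continuous. Qed.

Lemma cont_cst (c : C) : continuous ((fun=> c) : X -> C).
Proof. exact: cst_continuous. Qed.

Lemma contM g h : continuous g -> continuous h -> continuous (fun x => g x * h x).
Proof. by move=> gc hc x; exact: (@cvgM _ X (nbhs x) (nbhs_filter x) g h _ _ (gc x) (hc x)). Qed.

Lemma cont_comp g (t : X -> X) : continuous g -> continuous t ->
  continuous (fun x => g (t x)).
Proof. by move=> gc tc x; apply: continuous_comp; [exact: tc|exact: gc]. Qed.

Lemma cont_conj g : continuous g -> continuous (fun x => (g x)^* ).
Proof.
move=> gc x.
apply/(@cvgrPdist_lt C _ _ (nbhs x) (nbhs_filter x)) => e e0.
have /(@cvgrPdist_lt C _ _ (nbhs x) (nbhs_filter x))/(_ _ e0) := gc x.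
by move/nbhs_cylP=> [n nP]; apply/nbhs_cylP; exists n => y /nP; rewrite -rmorphB norm_conjC.
Qed.

Lemma PhiP (k : C) g h : continuous g -> continuous h ->
  Phi (fun x => k * g x + h x) = k *: Phi g + Phi h.
Proof. by move=> gc hc; have [/(_ _ _ gc hc)[PP _ _ _] _ _] := hPhi; exact: PP. Qed.

Lemma PhiM g h : continuous g -> continuous h ->
  Phi (fun x => g x * h x) = Phi g * Phi h.
Proof. by move=> gc hc; have [/(_ _ _ gc hc)[]] := hPhi. Qed.

Lemma PhiS g : continuous g -> Phi (fun x => (g x)^* ) = star (Phi g).
Proof. by move=> gc; have [/(_ _ _ gc gc)[]] := hPhi. Qed.

Lemma Phi_inj g h : continuous g -> continuous h -> Phi g = Phi h -> g = h.
Proof. by move=> gc hc; have [/(_ _ _ gc hc)[]] := hPhi. Qed.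

Lemma Phi_surj d : ss_set D d -> exists g, continuous g /\ Phi g = d.
Proof. by have [_ <- _] := hPhi => -[g]; exists g. Qed.

Lemma Phi_D g : continuous g -> ss_set D (Phi g).
Proof. by have [_ <- _] := hPhi; exists g. Qed.

Lemma Phi_cyl0 mu : admissible A mu ->
  Phi \1_(@cylinder N A mu) = Sword S mu * star (Sword S mu).
Proof. by have [_ _] := hPhi; apply. Qed.

Lemma Phi_comm g h : continuous g -> continuous h -> Phi g * Phi h = Phi h * Phi g.
Proof.
by move=> gc hc; rewrite -!PhiM //; congr Phi; apply/funext => x; rewrite mulrC.
Qed.

Lemma D_comm a b : ss_set D a -> ss_set D b -> a * b = b * a.
Proof. by move=> /Phi_surj[g [gc <-]] /Phi_surj[h [hc <-]]; exact: Phi_comm. Qed.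

Lemma Phi0 : Phi (fun=> 0) = 0.
Proof.
have := PhiM (@cont_cst 0) (@cont_cst 0).
have := PhiP (-1) (@cont_cst 0) (@cont_cst 0).
rewrite scaleN1r addNr => <- _; congr Phi; apply/funext => x.
by rewrite mulr0 addr0.
Qed.

Lemma PhiD g h : continuous g -> continuous h ->
  Phi (fun x => g x + h x) = Phi g + Phi h.
Proof.
move=> gc hc; rewrite -[Phi g]scale1r -PhiP //; congr Phi; apply/funext => x.
by rewrite mul1r.
Qed.

Lemma PhiZ (k : C) g : continuous g -> Phi (fun x => k * g x) = k *: Phi g.
Proof.
move=> gc; have := PhiP k gc (@cont_cst 0); rewrite Phi0 addr0 => <-.
by congr Phi; apply/funext => x; rewrite addr0.
Qed.

Definition ind (U : set X) : X -> C := \1_U.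

Lemma indT (U : set X) x : U x -> ind U x = 1.
Proof. by move=> Ux; rewrite /ind indicE mem_set. Qed.

Lemma indF (U : set X) x : ~ U x -> ind U x = 0.
Proof. by move=> Ux; rewrite /ind indicE memNset. Qed.

Lemma ind_eq (U V : set X) x y : (U x <-> V y) -> ind U x = ind V y.
Proof.
move=> UV; have [Ux|Ux] := pselect (U x); first by rewrite !indT //; exact/UV.
by rewrite !indF // => /UV.
Qed.

Lemma cont_ind (U : set X) : lconst U -> continuous (ind U).
Proof.
move=> Uc; apply: lconst_cont => x; have [n nP] := Uc x; exists n => y /nP Uxy.
by apply: ind_eq; rewrite Uxy.
Qed.

Lemma cont_cyl mu : continuous (ind (cylinder mu)).
Proof. exact/cont_ind/lconst_cylinder. Qed.
Hint Resolve cont_cyl : core.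

Lemma ind_mul (U V : set X) x : ind U x * ind V x = ind (U `&` V) x.
Proof.
have [Ux|Ux] := pselect (U x).
  by rewrite indT // mul1r; apply: ind_eq; split=> [|[]].
by rewrite (indF Ux) mul0r indF // => -[].
Qed.

Lemma admissible_nil : admissible A [::].
Proof.
have i0 : 'I_N.
  case: (N) (A) hAperm => [A0|n _ _]; last exact: ord0.
  by case/negP; apply/is_perm_mxP; exists 1%g; apply/matrixP => -[].
by have [x _] := ex_pt hA01 hAirr i0; exists x.
Qed.

Lemma Phi1 : Phi (fun=> 1) = 1.
Proof.
have -> : (fun=> 1) = \1_(cylinder [::]) :> (X -> C).
  by apply/funext => x; rewrite indicE mem_set.
by rewrite Phi_cyl0; [rewrite /Sword big_nil star1 mulr1|exact: admissible_nil].
Qed.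

Lemma admissible1 i : admissible A [:: i].
Proof.
by have [x xi] := ex_pt hA01 hAirr i; exists x; apply/cylinder_cons.
Qed.

Lemma Sword_cons i mu : Sword S (i :: mu) = S i * Sword S mu.
Proof. by rewrite /Sword big_cons. Qed.

Lemma Sword1 i : Sword S [:: i] = S i.
Proof. by rewrite /Sword big_seq1. Qed.

Lemma Sword_cat mu nu : Sword S (mu ++ nu) = Sword S mu * Sword S nu.
Proof. by rewrite /Sword big_cat. Qed.

Lemma range_proj i : S i * star (S i) = Phi (ind (cylinder [:: i])).
Proof. by rewrite Phi_cyl0 ?Sword1 //; exact: admissible1. Qed.

Lemma SK i : S i * star (S i) * S i = S i.
Proof. by have [] := hck. Qed.

Lemma range_projS i j : S i * star (S i) * S j = if i == j then S j else 0.
Proof.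
case: eqP => [->|ij]; first exact: SK.
rewrite -(SK j) mulrA !range_proj -PhiM //.
rewrite (_ : (fun x => _) = (fun=> 0)) ?Phi0 ?mul0r //.
apply/funext => x; rewrite ind_mul indF // => -[/cylinder_cons[xi _]].
by move=> /cylinder_cons[xj _]; apply: ij; rewrite -xi.
Qed.

(** S_j has range under S_j S_j^*, which lies under S_i^* S_i or is orthogonal to
    it according to A i j. *)
Lemma S_mul_edge i j : S i * S j = (S i * S j) *+ A i j.
Proof.
rewrite -{1}(SK i) -!mulrA (mulrA (star _)); have [_ _ ->] := hck.
rewrite mulr_suml (bigD1 j) //= big1 ?addr0 => [|k kj].
  by rewrite mulrnAl range_projS eqxx mulrnAr.
by rewrite mulrnAl range_projS (negbTE kj) mul0rn.
Qed.

Lemma Sword_nonadm mu : ~ admissible A mu -> Sword S mu = 0.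
Proof.
elim: mu => [na|i [|j mu] IH na].
- by case: na; exact: admissible_nil.
- by case: na; exact: admissible1.
rewrite Sword_cons; have [[x xmu]|nam] := pselect (admissible A (j :: mu)); last first.
  by rewrite IH ?mulr0.
rewrite Sword_cons mulrA S_mul_edge.
have [->|Aij] := hA01 i j; first by rewrite mulr0n mul0r.
have /cylinder_cons[xj _] := xmu.
have [|y [yi yx]] := @ex_cons _ _ i x; first by rewrite xj.
by case: na; exists y; apply/cylinder_cons; rewrite yx.
Qed.

Lemma Sword_range mu : Sword S mu * star (Sword S mu) = Phi (ind (cylinder mu)).
Proof.
have [adm|na] := pselect (admissible A mu); first by rewrite Phi_cyl0.
rewrite Sword_nonadm // mul0r -Phi0; congr Phi; apply/funext => x.
by rewrite indF // => xmu; apply: na; exists x.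
Qed.

(** Point evaluations are the only characters of C(X): if c is continuous and
    c(y) is nonzero, then c divides the indicator of a small cylinder around y. *)
Lemma character_eval (chi : (X -> C) -> C) y :
  (forall k g h, continuous g -> continuous h ->
     chi (fun x => k * g x + h x) = k * chi g + chi h) ->
  (forall g h, continuous g -> continuous h ->
     chi (fun x => g x * h x) = chi g * chi h) ->
  (forall n, chi (ind (cylinder (pre y n))) = 1) ->
  forall g, continuous g -> chi g = g y.
Proof.
move=> chiP chiM chi1 g gc; apply: contrapT => ne.
have one_c := @cont_cst 1.
have chi_one : chi (fun=> 1) = 1.
  have := chiM _ _ one_c (@cont_cyl (pre y 0)); rewrite chi1 mulr1 => <-.
  by rewrite -[RHS](chi1 0%N); congr chi; apply/funext => x; rewrite mul1r.
pose c x := - chi g * 1 + g x.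
have cc : continuous c.
  move=> x; apply: (@cvgD _ _ X (nbhs x) (nbhs_filter x) _ _ _ _ _ (gc x)).
  exact: cvg_cst.
have chic : chi c = 0.
  have e : chi c = - chi g * chi (fun=> 1) + chi g by exact: (chiP (- chi g) (fun=> 1) g one_c gc).
  by rewrite e chi_one mulr1 addNr.
have cy : c y != 0 by rewrite /c mulr1 addrC subr_eq0; apply/eqP => /esym.
have /nbhs_cylP[n nP] : nbhs y [set x | c x != 0].
  exact: (@cvgr_neq0 _ _ _ (nbhs y) (nbhs_filter y) c _ (cc y) cy).
pose d x := ind (cylinder (pre y n)) x / c x.
have dc : continuous d.
  move=> x; have [xy|xy] := pselect (agree n y x).
    apply: (@cvgM _ X (nbhs x) (nbhs_filter x) _ _ _ _ (@cont_cyl _ x)).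
    exact: (@cvgV _ X (nbhs x) (nbhs_filter x) c _ (nP _ xy) (cc x)).
  have d0 z : agree n x z -> d z = 0.
    move=> xz; rewrite /d indF ?mul0r // => /cylinder_pre yz; apply: xy.
    exact: agree_trans yz (agree_sym xz).
  move=> U; rewrite d0 // => U0; apply/nbhs_cylP; exists n => z /d0 dz.
  by rewrite /= dz; exact: nbhs_singleton U0.
have := chiM _ _ cc dc; rewrite chic mul0r => e.
suff cd : (fun x => c x * d x) = ind (cylinder (pre y n)).
  by have /eqP := chi1 n; rewrite -cd e eq_sym oner_eq0.
apply/funext => x; rewrite /d.
have [/cylinder_pre xy|xy] := pselect (cylinder (pre y n) x).
  by rewrite mulrCA divff ?mulr1 //; exact: (nP x xy).
by rewrite (indF xy) mul0r mulr0.
Qed.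


(** * Intertwining relations between the generators and the diagonal *)

Lemma DA_closed (u : nat -> O) l : (forall n, ss_set D (u n)) ->
  (fun n => cnorm (u n - l)) @ \oo --> (0 : R) -> ss_set D l.
Proof.
move=> uD ul B BX; have [[Bcl _] _] := BX.
by apply: Bcl ul => n; exact: uD.
Qed.

Lemma DA_min (B : set O) : is_cstar_sub B ->
  (forall mu, admissible A mu -> B (Sword S mu * star (Sword S mu))) ->
  ss_set D `<=` B.
Proof. by move=> Bsub Bgen a; apply; split=> // _ [mu amu <-]; exact: Bgen. Qed.

Lemma D_range mu : ss_set D (Phi (ind (cylinder mu))).
Proof. exact: (Phi_D (@cont_cyl mu)). Qed.

Lemma PhiI (U V : set X) : lconst U -> lconst V ->
  Phi (ind U) * Phi (ind V) = Phi (ind (U `&` V)).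
Proof.
move=> Uc Vc; rewrite -(PhiM (cont_ind Uc) (cont_ind Vc)).
by congr Phi; apply/funext => x; exact: ind_mul.
Qed.

Lemma cyl_proj mu : Phi (ind (cylinder mu)) * Phi (ind (cylinder mu)) = Phi (ind (cylinder mu)).
Proof. by rewrite (PhiI (@lconst_cylinder _ _ mu) (@lconst_cylinder _ _ mu)) setIid. Qed.

Definition out_set i : set X := [set z | A i (pt z 0) = 1%N].

Lemma lconst_out i : lconst (out_set i).
Proof. by move=> x; exists 1%N => y xy; rewrite /out_set /= (xy 0%N). Qed.

Lemma domain_proj i : star (S i) * S i = Phi (ind (out_set i)).
Proof.
have [_ _ ->] := hck.
have E (r : seq 'I_N) : \sum_(j <- r) (S j * star (S j)) *+ A i j =
    Phi (fun x => \sum_(j <- r) ind (cylinder [:: j]) x *+ A i j) /\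
    continuous (fun x => \sum_(j <- r) ind (cylinder [:: j]) x *+ A i j).
  elim: r => [|j r [IH cr]].
    have -> : (fun x => \sum_(j <- [::]) ind (cylinder [:: j]) x *+ A i j) = (fun=> 0).
      by apply/funext => x; rewrite big_nil.
    by rewrite big_nil Phi0; split=> //; exact: cont_cst.
  have -> : (fun x => \sum_(k <- j :: r) ind (cylinder [:: k]) x *+ A i k) =
     (fun x => (A i j)%:R * ind (cylinder [:: j]) x +
               \sum_(k <- r) ind (cylinder [:: k]) x *+ A i k).
    by apply/funext => x; rewrite big_cons mulr_natl.
  split; last first.
    move=> x; apply: (@cvgD _ _ X (nbhs x) (nbhs_filter x) _ _ _ _ _ (cr x)).
    exact: (contM (@cont_cst _) (@cont_cyl _)).
  by rewrite big_cons (PhiP _ (@cont_cyl _) cr) -IH range_proj scaler_nat.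
have [-> _] := E (index_enum 'I_N); congr Phi; apply/funext => x.
rewrite (bigD1 (pt x 0)) //= big1 ?addr0 => [|j xj]; last first.
  by rewrite indF ?mul0rn // => /cylinder_cons[/esym e _]; rewrite e eqxx in xj.
rewrite (indT (U := cylinder _)); last exact/cylinder_cons.
have [A0|A1] := hA01 i (pt x 0).
  by rewrite A0 mulr0n indF // /out_set /= A0.
by rewrite A1 mulr1n indT.
Qed.

(** Conjugation by S_i is multiplicative on D because D commutes with the
    projection S_i^* S_i, so the elements of D mapped into D form a C*-algebra. *)
Lemma S_conj_D i a : ss_set D a -> ss_set D (S i * a * star (S i)).
Proof.
pose B : set O := [set a | ss_set D a /\ ss_set D (S i * a * star (S i))].
suff BD : ss_set D `<=` B by move=> /BD[].
apply: DA_min; last first.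
  move=> mu amu; split; first by rewrite Sword_range; exact: D_range.
  by rewrite mulrA -Sword_cons -mulrA -starM -Sword_cons Sword_range; exact: D_range.
have B1 : B 1.
  by split; [exact: ss1|rewrite mulr1 range_proj; exact: D_range].
have BP (k : C) (x y : O) : B x -> B y -> B (k *: x + y).
  move=> [Dx Sx] [Dy Sy]; split; first exact: ssP.
  by rewrite mulrDr mulrDl -scalerAr -scalerAl; exact: ssP.
have BM (x y : O) : B x -> B y -> B (x * y).
  move=> [Dx Sx] [Dy Sy]; split; first exact: ssM.
  have -> : S i * (x * y) * star (S i) = (S i * x * star (S i)) * (S i * y * star (S i)).
    have Q : x * (star (S i) * S i) = (star (S i) * S i) * x.
      by apply: D_comm => //; rewrite domain_proj; exact: (Phi_D (cont_ind (@lconst_out i))).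
    rewrite -{1}(SK i) !mulrA; congr (_ * _ * _).
    by rewrite -!mulrA (mulrA (star _)) -Q !mulrA.
  exact: ssM.
have BS (x : O) : B x -> B (star x).
  move=> [Dx Sx]; split; first exact: ssS.
  by have := ssS Sx; rewrite !starM starK mulrA.
split; last by exists (StarSub B1 BP BM BS).
move=> u l uB ul; split; first by apply: DA_closed ul => n; have [] := uB n.
apply: (@DA_closed (fun n => S i * u n * star (S i))); first by move=> n; have [] := uB n.
move/cvg_cnormP: ul => ul; apply/cvg_cnormP => e e0.
have s0 : 0 < cnorm (S i) * cnorm (S i) + 1 by rewrite ltr_wpDl // mulr_ge0 ?cnorm_ge0.
have [n0 nP] := ul _ (divr_gt0 e0 s0); exists n0 => n /nP.
rewrite ltr_pdivlMr // => h; rewrite -mulrBl -mulrBr; apply: le_lt_trans h.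
apply: le_trans (cnormM _ _) _; rewrite cnorm_starE.
have := cnormM (S i) (u n - l); have := cnorm_ge0 (S i); have := cnorm_ge0 (u n - l).
nra.
Qed.

Lemma sg_cont : continuous sg.
Proof. exact: (@iter_continuous _ A 1%N). Qed.

(** The compression of D by S_i is again a function on the shift space, and its
    value at a point of the i-th cylinder is a character, hence an evaluation. *)
Lemma S_intertw i g : continuous g -> S i * Phi g = Phi (fun x => g (sg x)) * S i.
Proof.
move=> gc.
have /choice[H HP] (g' : X -> C) : exists h, continuous g' ->
    continuous h /\ Phi h = S i * Phi g' * star (S i).
  have [gc'|] := pselect (continuous g'); last by move=> nc; exists g' => /nc.
  have [h [hc hE]] := Phi_surj (S_conj_D i (Phi_D gc')).
  by exists h.
have Hc g' (gc' : continuous g') := (HP _ gc').1.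
have HE g' (gc' : continuous g') := (HP _ gc').2.
have Hval y g' : continuous g' -> pt y 0 = i -> H g' y = g' (sg y).
  move=> gc' yi; apply: (@character_eval (fun k => H k y)) gc' => [k u v uc vc|u v uc vc|n].
  - have kuv : continuous (fun x => k * u x + v x).
      move=> x; apply: (@cvgD _ _ X (nbhs x) (nbhs_filter x) _ _ _ _ _ (vc x)).
      exact: (contM (@cont_cst k) uc).
    suff -> : H (fun x => k * u x + v x) = (fun x => k * H u x + H v x) by [].
    apply: Phi_inj; first exact: Hc.
      move=> x; apply: (@cvgD _ _ X (nbhs x) (nbhs_filter x) _ _ _ _ _ (Hc _ vc x)).
      exact: (contM (@cont_cst k) (Hc _ uc)).
    rewrite (HE _ kuv) (PhiP k (Hc _ uc) (Hc _ vc)) (HE _ uc) (HE _ vc) (PhiP k uc vc).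
    by rewrite mulrDr mulrDl -scalerAr -scalerAl.
  - have uvc := contM uc vc.
    suff -> : H (fun x => u x * v x) = (fun x => H u x * H v x) by [].
    apply: Phi_inj; [exact: Hc|exact: (contM (Hc _ uc) (Hc _ vc))|].
    rewrite (HE _ uvc) (PhiM (Hc _ uc) (Hc _ vc)) (HE _ uc) (HE _ vc) (PhiM uc vc).
    rewrite -{1}(SK i) !mulrA; congr (_ * _ * _).
    rewrite -!mulrA (mulrA (star _)) domain_proj.
    by rewrite (Phi_comm (cont_ind (@lconst_out i)) uc) -domain_proj !mulrA.
  - suff -> : H (ind (cylinder (pre (sg y) n))) = ind (cylinder (i :: pre (sg y) n)).
      by rewrite indT //; apply/cylinder_cons; split=> //; exact/cylinder_pre.
    apply: Phi_inj; [exact/Hc/cont_cyl|exact: cont_cyl|].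
    rewrite (HE _ (@cont_cyl _)) -!Sword_range mulrA -Sword_cons -mulrA -starM.
    by rewrite -Sword_cons.
have HpE : H g = (fun x => g (sg x) * ind (cylinder [:: i]) x).
  have Hp : H g = (fun x => ind (cylinder [:: i]) x * H g x).
    apply: Phi_inj; [exact: Hc|exact: (contM (@cont_cyl _) (Hc _ gc))|].
    by rewrite (PhiM (@cont_cyl _) (Hc _ gc)) (HE _ gc) -range_proj !mulrA SK.
  apply/funext => x; have [xi|xi] := pselect (cylinder [:: i] x).
    by rewrite indT // mulr1 Hval //; move/cylinder_cons: xi => [].
  by rewrite Hp (indF xi) mul0r mulr0.
have gsc := cont_comp gc sg_cont.
have e : Phi (H g) * S i = S i * Phi g.
  rewrite (HE _ gc) -mulrA domain_proj -mulrA.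
  rewrite (Phi_comm gc (cont_ind (@lconst_out i))) -domain_proj.
  by rewrite !mulrA SK.
by rewrite -e HpE (PhiM gsc (@cont_cyl _)) -mulrA -range_proj SK.
Qed.

Lemma Sword_intertw mu g : continuous g ->
  Sword S mu * Phi g = Phi (fun x => g (iter (size mu) sg x)) * Sword S mu.
Proof.
elim: mu g => [|i mu IH] g gc; first by rewrite /Sword big_nil mul1r mulr1.
rewrite Sword_cons -mulrA IH // !mulrA; congr (_ * _).
rewrite (S_intertw i (cont_comp gc (@iter_continuous _ A (size mu)))).
by congr (Phi _ * _); apply/funext => x; rewrite -iterSr.
Qed.

Lemma Phi_self U : lconst U -> star (Phi (ind U)) = Phi (ind U).
Proof.
move=> Uc; rewrite -(PhiS (cont_ind Uc)); congr Phi; apply/funext => x.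
by have [Ux|Ux] := pselect (U x); [rewrite indT ?rmorph1|rewrite indF ?rmorph0].
Qed.

Lemma cyl_self mu : star (Phi (ind (cylinder mu))) = Phi (ind (cylinder mu)).
Proof. exact: (Phi_self (@lconst_cylinder _ _ mu)). Qed.

Lemma Sword_star_intertw mu g : continuous g ->
  star (Sword S mu) * Phi (fun x => g (iter (size mu) sg x)) = Phi g * star (Sword S mu).
Proof.
move=> gc; have gc' := cont_conj gc.
have gs := cont_comp gc (@iter_continuous _ A (size mu)).
apply: (can_inj (@starK R O)); rewrite !starM starK -(PhiS gc) -(PhiS gs).
by rewrite (Sword_intertw mu gc').
Qed.

Lemma Sword_rangeK mu : Phi (ind (cylinder mu)) * Sword S mu = Sword S mu.
Proof.
elim: mu => [|i mu IH].
  rewrite -Sword_range /Sword big_nil star1 !mulr1 //.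
have -> : ind (cylinder (i :: mu)) =
    (fun x => ind (cylinder [:: i]) x * ind (cylinder mu) (sg x)) :> (X -> C).
  apply/funext => x; rewrite [X in _ * X](_ : _ = ind [set x | cylinder mu (sg x)] x).
    rewrite ind_mul; apply: ind_eq; rewrite cylinder_cons; split=> [[xi xm]|[xi xm]].
      by split=> //; apply/cylinder_cons.
    by split=> //; case/cylinder_cons: xi.
  exact: ind_eq.
rewrite (PhiM (@cont_cyl _) (cont_comp (@cont_cyl mu) sg_cont)) Sword_cons.
rewrite -mulrA (mulrA _ (S i)) -(S_intertw i (@cont_cyl mu)) -mulrA IH.
by rewrite mulrA -range_proj SK.
Qed.

Lemma Sword_starK mu : star (Sword S mu) * Phi (ind (cylinder mu)) = star (Sword S mu).
Proof. by rewrite -{2}(Sword_rangeK mu) starM cyl_self. Qed.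

(** The function z |-> a (mu z), extended by zero to the points z that cannot
    follow mu. *)
Definition graft mu (a : X -> C) z : C :=
  if pselect (exists x, cylinder mu x /\ iter (size mu) sg x = z) is left e
  then a (projT1 (cid e)) else 0.

Lemma graftE mu (a : X -> C) x : cylinder mu x -> graft mu a (iter (size mu) sg x) = a x.
Proof.
move=> xmu; rewrite /graft; case: pselect => [e|[]]; last by exists x.
case: (cid e) => y [ymu yx] /=; congr a.
exact: (cylinder_iter (erefl _) ymu xmu yx).
Qed.

Lemma graft0 mu (a : X -> C) z : ~ (exists x, cylinder mu x /\ iter (size mu) sg x = z) ->
  graft mu a z = 0.
Proof. by rewrite /graft; case: pselect. Qed.

Lemma graft_cont mu (a : X -> C) : continuous a -> continuous (graft mu a).
Proof.
move=> ac z U.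
have [[x [xmu <-]]|nz] := pselect (exists x, cylinder mu x /\ iter (size mu) sg x = z).
  rewrite graftE // => /ac/nbhs_cylP[n nP]; apply/nbhs_cylP; exists n.+1 => y xy.
  have [x' [xx' x'y]] := splice (agreeW (isT : 1 <= n.+1)%N xy).
  have x'mu : cylinder mu x' by exact: cylinder_agree xmu.
  rewrite /= -x'y graftE //; apply: nP => j jn.
  have [js|sj] := ltnP j (size mu); first exact: xx'.
  rewrite -(subnKC sj) -!pt_iter x'y xy // ltnS.
  by rewrite (leq_trans (leq_subr _ _)) // ltnW.
rewrite graft0 // => U0; have [n nP] := @lconst_image _ A mu z.
apply/nbhs_cylP; exists n => y /nP e; rewrite /= graft0; first exact: nbhs_singleton U0.
by move: nz; rewrite -e.
Qed.

Lemma Sword_graft mu (a : X -> C) : continuous a ->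
  Phi a * Sword S mu = Sword S mu * Phi (graft mu a).
Proof.
move=> ac; have gc := @graft_cont mu _ ac.
rewrite (Sword_intertw mu gc) -(Sword_rangeK mu) !mulrA.
have gs := cont_comp gc (@iter_continuous _ A (size mu)).
rewrite -(PhiM ac (@cont_cyl _)) -(PhiM gs (@cont_cyl _)); congr (Phi _ * _).
apply/funext => x; have [xmu|xmu] := pselect (cylinder mu x); first by rewrite graftE.
by rewrite (indF xmu) !mulr0.
Qed.

Definition image_set mu : set X :=
  [set z | exists x, cylinder mu x /\ iter (size mu) sg x = z].

(** For a word i mu, the domain projection of S_i is first cut down by S_mu, which
    turns it into the grafted indicator. *)
Lemma Sword_domain mu : star (Sword S mu) * Sword S mu = Phi (ind (image_set mu)).
Proof.
elim: mu => [|i mu IH].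
  rewrite /Sword big_nil star1 mulr1 -Phi1; congr Phi; apply/funext => x.
  by rewrite indT //; exists x.
have oc : continuous (ind (out_set i)) := cont_ind (@lconst_out i).
have gc := @graft_cont mu _ oc.
rewrite Sword_cons starM mulrA -(mulrA _ (star _)) domain_proj -mulrA.
rewrite (Sword_graft _ oc) mulrA IH -(PhiM (cont_ind (@lconst_image _ A mu)) gc).
congr Phi; apply/funext => z.
have [[x [xmu xz]]|nz] := pselect (image_set mu z); last first.
  rewrite (indF nz) mul0r indF // => -[x [/cylinder_cons[xi xmu] xz]].
  by apply: nz; exists (sg x); split=> //; rewrite -xz /= -iterS iterSr.
rewrite indT ?mul1r; last by exists x.
rewrite -xz graftE //; apply: ind_eq; rewrite /out_set /image_set /=; split.
  move=> Aix; have [y [yi yx]] := ex_cons Aix.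
  exists y; split; first by apply/cylinder_cons; rewrite yx.
  by rewrite -iterS iterSr yx.
move=> [y [/cylinder_cons[yi ymu]]]; rewrite -iterS iterSr => e.
have -> : x = sg y by exact: (cylinder_iter (erefl _) xmu ymu (esym e)).
by rewrite -yi; exact: pt_edge.
Qed.

(** The partial isometry S_mu S_nu^* implements the partial homeomorphism
    nu z |-> mu z. *)
Lemma word_intertw mu nu (a a' : X -> C) : continuous a -> continuous a' ->
  (forall x y, cylinder nu x -> cylinder mu y ->
     iter (size nu) sg x = iter (size mu) sg y -> a x = a' y) ->
  Sword S mu * star (Sword S nu) * Phi a = Phi a' * (Sword S mu * star (Sword S nu)).
Proof.
move=> ac ac' aa'; have gc := @graft_cont nu _ ac.
have gs := cont_comp gc (@iter_continuous _ A (size nu)).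
have gm := cont_comp gc (@iter_continuous _ A (size mu)).
have e1 : star (Sword S nu) * Phi a = Phi (graft nu a) * star (Sword S nu).
  rewrite -(Sword_star_intertw nu gc) -(Sword_starK nu) -!mulrA.
  rewrite -(PhiM (@cont_cyl nu) ac) -(PhiM (@cont_cyl nu) gs); congr (_ * Phi _).
  apply/funext => x; have [xnu|xnu] := pselect (cylinder nu x); first by rewrite graftE.
  by rewrite (indF xnu) !mul0r.
have ic : continuous (ind (image_set nu)) := cont_ind (@lconst_image _ A nu).
have im := cont_comp ic (@iter_continuous _ A (size mu)).
have e2 : Sword S mu * star (Sword S nu) = Phi (fun x => ind (cylinder mu) x *
    ind (image_set nu) (iter (size mu) sg x)) * (Sword S mu * star (Sword S nu)).
  rewrite (PhiM (@cont_cyl mu) im) !mulrA -(mulrA _ _ (Sword S mu)) -(Sword_intertw mu ic).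
  rewrite mulrA Sword_rangeK -Sword_domain -!mulrA; congr (_ * _).
  by rewrite Sword_range Sword_starK.
have kc := contM (@cont_cyl mu) im.
rewrite -mulrA e1 mulrA (Sword_intertw mu gc) -mulrA e2 !mulrA.
rewrite -(PhiM gm kc) -(PhiM ac' kc); congr (Phi _ * _ * _); apply/funext => y.
have [ymu|ymu] := pselect (cylinder mu y); last by rewrite (indF ymu) !mul0r !mulr0.
have [[x [xnu xy]]|ny] := pselect (image_set nu (iter (size mu) sg y)); last first.
  by rewrite (indF ny) !mulr0.
by rewrite -(aa' x y xnu ymu xy) -xy graftE.
Qed.

(** * Density of the linear span of the elements S_mu S_nu^* *)

Hypothesis hgen : cstar_gen (range S) = setT.

Definition word mu nu : O := Sword S mu * star (Sword S nu).

Definition wsum (s : seq (C * seq 'I_N * seq 'I_N)) : O :=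
  \sum_(t <- s) t.1.1 *: word t.1.2 t.2.

Definition inspan b := exists s, b = wsum s.

Lemma inspan0 : inspan 0.
Proof. by exists [::]; rewrite /wsum big_nil. Qed.

Lemma inspanD a b : inspan a -> inspan b -> inspan (a + b).
Proof. by move=> [s ->] [r ->]; exists (s ++ r); rewrite /wsum big_cat. Qed.

Lemma inspanZ (k : C) a : inspan a -> inspan (k *: a).
Proof.
move=> [s ->]; exists [seq (k * t.1.1, t.1.2, t.2) | t <- s].
by rewrite /wsum scaler_sumr big_map; apply: eq_bigr => t _; rewrite scalerA.
Qed.

Lemma inspan_word mu nu : inspan (word mu nu).
Proof. by exists [:: (1, mu, nu)]; rewrite /wsum big_seq1 scale1r. Qed.

Lemma inspanMn a n : inspan a -> inspan (a *+ n).
Proof. by move=> sa; rewrite -scaler_nat; exact: inspanZ. Qed.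

Lemma inspan_sum (I : Type) (r : seq I) (F : I -> O) :
  (forall i, inspan (F i)) -> inspan (\sum_(i <- r) F i).
Proof.
move=> sF; elim: r => [|i r IH]; rewrite ?big_nil ?big_cons; first exact: inspan0.
exact: inspanD.
Qed.

Lemma inspan_lin (T : O -> O) : (forall (k : C) a b, T (k *: a + b) = k *: T a + T b) ->
  (forall mu nu, inspan (T (word mu nu))) -> forall a, inspan a -> inspan (T a).
Proof.
move=> TP Tw _ [s ->]; elim: s => [|t s IH].
  rewrite /wsum big_nil (_ : T 0 = 0); first exact: inspan0.
  by have := TP (-1) 0 0; rewrite !scaleN1r !addNr.
rewrite /wsum big_cons TP; apply: inspanD IH; exact: inspanZ.
Qed.

Lemma star_S_mul i j : i != j -> star (S i) * S j = 0.
Proof.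
move=> ij; have -> : star (S i) = star (S i) * (S i * star (S i)).
  by have := congr1 (@star R O) (SK i); rewrite !starM starK => {1}<-.
by rewrite -!mulrA (mulrA (S i)) range_projS (negbTE ij) mulr0.
Qed.

Lemma inspan_starS i a : inspan a -> inspan (star (S i) * a).
Proof.
apply: (inspan_lin (T := fun a => star (S i) * a)) => [k b c|].
  by rewrite mulrDr scalerAr.
move=> [|j mu] nu.
  rewrite /word {1}/Sword big_nil mul1r -starM -Sword1 -Sword_cat.
  by have := inspan_word [::] (nu ++ [:: i]); rewrite /word {1}/Sword big_nil mul1r.
rewrite /word Sword_cons !mulrA; have [<-|ij] := eqVneq i j; last first.
  by rewrite star_S_mul // !mul0r; exact: inspan0.
have [_ _ ->] := hck; rewrite !mulr_suml; apply: inspan_sum => k.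
rewrite !mulrnAl; apply: inspanMn; case: mu => [|j' mu].
  rewrite {1}/Sword big_nil mulr1 -mulrA -starM -(Sword1 k) -Sword_cat.
  exact: inspan_word.
rewrite Sword_cons mulrA range_projS; case: eqP => _.
  by rewrite -Sword_cons; exact: inspan_word.
by rewrite !mul0r; exact: inspan0.
Qed.

Lemma inspan_S i a : inspan a -> inspan (S i * a).
Proof.
apply: (inspan_lin (T := fun a => S i * a)) => [k b c|mu nu].
  by rewrite mulrDr scalerAr.
by rewrite /word mulrA -Sword_cons; exact: inspan_word.
Qed.

(** The elements a such that a and a^* multiply the closure of the span into
    itself form a C*-algebra containing the generators. *)
Lemma word_dense b (e : R) : 0 < e -> exists s, cnorm (b - wsum s) <= e.
Proof.
pose cl (a : O) := forall e : R, 0 < e -> exists c, inspan c /\ cnorm (a - c) <= e.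
have clP (k : C) (a c : O) : cl a -> cl c -> cl (k *: a + c).
  move=> ca cc e' e0; have nk := normc_ge0 k.
  have [a' [sa aa]] := ca (e' / (2 * (Normc.normc k + 1))) ltac:(apply: divr_gt0 => //; lra).
  have [c' [sc ccc]] := cc (e' / 2) ltac:(by apply: divr_gt0).
  exists (k *: a' + c'); split; first by apply: inspanD => //; exact: inspanZ.
  rewrite opprD addrACA -scalerBr; apply: le_trans (cnormD _ _) _; rewrite cnormZ.
  move: aa; rewrite ler_pdivlMr; last by lra.
  have := cnorm_ge0 (a - a'); nra.
have cl_span a : inspan a -> cl a.
  by move=> sa e' e0; exists a; rewrite subrr cnorm0 ltW.
have cl_cl a : (forall e : R, 0 < e -> exists c, cl c /\ cnorm (a - c) <= e) -> cl a.
  move=> ca e' e0; have e2 : 0 < e' / 2 by apply: divr_gt0.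
  have [c [/(_ _ e2)[d [sd cd]] ac]] := ca _ e2.
  exists d; split=> //; apply: le_trans (cnorm_triangle c _ _) _.
  by rewrite [e']splitr lerD.
have cl_mul (x a : O) : (forall a, inspan a -> inspan (x * a)) -> cl a -> cl (x * a).
  move=> xs ca e' e0; have nx := cnorm_ge0 x.
  have [a' [sa aa]] := ca (e' / (cnorm x + 1)) ltac:(apply: divr_gt0 => //; lra).
  exists (x * a'); split; first exact: xs.
  rewrite -mulrBr; apply: le_trans (cnormM _ _) _.
  move: aa; rewrite ler_pdivlMr; last by lra.
  have := cnorm_ge0 (a - a'); nra.
pose B : set O := [set a | forall c, cl c -> cl (a * c) /\ cl (star a * c)].
suff BT : B b.
  have w1 : word [::] [::] = 1 by rewrite /word /Sword big_nil star1 mulr1.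
  have := cl_span _ (inspan_word [::] [::]); rewrite w1 => /BT[b1 _] e0.
  by have [_ [[s ->] bs]] := b1 _ e0; exists s; rewrite mulr1 in bs.
have : cstar_gen (range S) b by rewrite hgen.
apply; split; last first.
  move=> _ [i _ <-] c cc; split; apply: cl_mul => // a; first exact: inspan_S.
  exact: inspan_starS.
have B1 : B 1 by move=> c cc; rewrite star1 mul1r.
have BP (k : C) (x y : O) : B x -> B y -> B (k *: x + y).
  move=> Bx By c cc; have [x1 x2] := Bx c cc; have [y1 y2] := By c cc.
  by rewrite starD starZ !mulrDl -!scalerAl; split; exact: clP.
have BM (x y : O) : B x -> B y -> B (x * y).
  move=> Bx By c cc; rewrite starM -!mulrA; split.
    by have [/Bx[]] := By c cc.
  by have [_ /By[_]] := Bx c cc.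
have BS (x : O) : B x -> B (star x).
  by move=> Bx c cc; rewrite starK; have [] := Bx c cc.
split; last by exists (StarSub B1 BP BM BS).
move=> u l uB /cvg_cnormP ul c cc; have nc := cnorm_ge0 c.
have H e' : 0 < e' -> exists n, cnorm ((u n - l) * c) <= e' /\
    cnorm ((star (u n) - star l) * c) <= e'.
  move=> e0; have c1 : 0 < cnorm c + 1 by lra.
  have [n /(_ _ (leqnn n))] := ul _ (divr_gt0 e0 c1).
  rewrite ltr_pdivlMr // => h; exists n; rewrite -starB.
  have hh : cnorm (u n - l) * cnorm c <= e'.
    by apply: le_trans (ltW h); apply: ler_wpM2l; [exact: cnorm_ge0|rewrite lerDl].
  by split; apply: le_trans (cnormM _ _) _; rewrite ?cnorm_starE.
split; apply: cl_cl => e' /H[n [h1 h2]].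
  exists (u n * c); split; first by have [] := uB n c cc.
  by rewrite cnorm_distC -mulrBl.
exists (star (u n) * c); split; first by have [] := uB n c cc.
by rewrite cnorm_distC -mulrBl.
Qed.

(** * Compression by shrinking cylinders *)

Definition q x n : O := Phi (ind (cylinder (pre x n))).

Lemma q_self x n : star (q x n) = q x n. Proof. exact: cyl_self. Qed.

Lemma q_idem x n : q x n * q x n = q x n. Proof. exact: cyl_proj. Qed.

Lemma q_le1 x n : cnorm (q x n) <= 1.
Proof. exact: (cnorm_proj (q_self x n) (q_idem x n)). Qed.

Lemma q_norm x n : cnorm (q x n) = 1.
Proof.
apply: (cnorm_proj1 (q_self x n) (q_idem x n)); rewrite /q -Phi0.
move=> /(Phi_inj (@cont_cyl _) (@cont_cst 0)) /(congr1 (fun h => h x)) /eqP.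
by rewrite indT ?oner_eq0 //; exact/cylinder_pre.
Qed.

Lemma q_sub x n U : lconst U -> (forall y, agree n x y -> U y) ->
  q x n * Phi (ind U) = q x n.
Proof.
move=> Uc nU; rewrite /q PhiI //; last exact: lconst_cylinder.
congr Phi; apply/funext => y; apply: ind_eq.
by split=> [[]|/cylinder_pre xy] //; split; [exact/cylinder_pre|exact: nU].
Qed.

Lemma q_disj x n U : lconst U -> (forall y, agree n x y -> ~ U y) ->
  q x n * Phi (ind U) = 0.
Proof.
move=> Uc nU; rewrite /q PhiI //; last exact: lconst_cylinder.
rewrite -Phi0; congr Phi; apply/funext => y; rewrite indF // => -[/cylinder_pre].
exact: nU.
Qed.

Lemma q_cst x n g : continuous g -> (forall y, agree n x y -> g y = g x) ->
  Phi g * q x n = g x *: q x n.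
Proof.
move=> gc gx; rewrite /q -(PhiM gc (@cont_cyl _)) -(PhiZ _ (@cont_cyl _)).
congr Phi; apply/funext => y; have [xy|xy] := pselect (cylinder (pre x n) y).
  by rewrite gx //; exact/cylinder_pre.
by rewrite (indF xy) !mulr0.
Qed.

Lemma qW x m n : (m <= n)%N -> q x n * q x m = q x n.
Proof.
move=> mn; apply: q_sub; first exact: lconst_cylinder.
by move=> y /(agreeW mn) xy; exact/cylinder_pre.
Qed.

Lemma qWl x m n : (m <= n)%N -> q x m * q x n = q x n.
Proof. by move=> mn; rewrite -[LHS]starK starM !q_self qW // q_self. Qed.

Lemma comp_mono x m n b : (m <= n)%N ->
  cnorm (q x n * b * q x n) <= cnorm (q x m * b * q x m).
Proof.
move=> mn; rewrite -{1}(qW x mn) -{2}(qWl x mn).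
rewrite -!mulrA (mulrA b) (mulrA (q x m)) mulrA [X in X <= _]/=.
by apply: le_trans (cnorm_comp _ (q_le1 x n)); rewrite !mulrA.
Qed.

Lemma comp_zero x m n b : (m <= n)%N -> q x m * b * q x m = 0 -> q x n * b * q x n = 0.
Proof.
move=> mn e; apply: cnorm_eq0; apply/le_anti; rewrite cnorm_ge0 andbT.
by have := comp_mono x b mn; rewrite e cnorm0.
Qed.

(** Ad(u) acts on D = C(X) as the homeomorphism t, in the form that avoids the
    adjoint of u. *)
Definition covers (u : O) (t : selfBij X) := [/\ homeomorphism t, star u * u = 1,
  u * star u = 1 & forall g, continuous g -> u * Phi g = Phi (g \o bij_inv t) * u].

Lemma covers1 : covers 1 1%g.
Proof.
split; rewrite ?star1 ?mulr1 //; first by split=> x U.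
by move=> g _; rewrite mul1r mulr1.
Qed.

Lemma covers_star u t g : covers u t -> continuous g ->
  Phi g * star u = star u * Phi (g \o bij_inv t).
Proof.
move=> [[ct ct'] uu uu' uE] gc; have := uE _ gc => e.
by rewrite -[LHS]mul1r -uu -!mulrA (mulrA u) e -mulrA uu' mulr1.
Qed.

(** A small cylinder around x and its image under t must meet the domain and the
    range of S_mu S_nu^* in points that this partial isometry puts in
    correspondence; both shrink to x and t x. *)
Lemma covers_word_support u t x mu nu : covers u t ->
  (forall n, q x n * (star u * word mu nu) * q x n <> 0) ->
  [/\ cylinder nu x, cylinder mu (t x) &
      iter (size mu) sg (t x) = iter (size nu) sg x].
Proof.
move=> ut nz; have [[ct ct'] _ _ _] := ut.
have near n : exists y x', [/\ agree n x (bij_inv t y), agree n x x', cylinder nu x',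
    cylinder mu y & iter (size nu) sg x' = iter (size mu) sg y].
  apply: contrapT => no; apply: (nz n).
  have gc := graft_cont (mu := nu) (@cont_cyl (pre x n)).
  have gm := cont_comp gc (@iter_continuous _ A (size mu)).
  have tc := cont_comp (@cont_cyl (pre x n)) ct'.
  rewrite mulrA (covers_star ut (@cont_cyl _)) -!mulrA (mulrA (Sword S mu)).
  rewrite (word_intertw (mu := mu) (nu := nu) (@cont_cyl (pre x n)) gm); last first.
    by move=> z y znu ymu zy; rewrite -zy graftE.
  rewrite -{1}(Sword_rangeK mu) !mulrA -(mulrA (star u)) -(PhiM tc gm).
  rewrite -(mulrA (star u)) -(PhiM (contM tc gm) (@cont_cyl mu)).
  rewrite (_ : (fun z => _) = (fun=> 0)) ?Phi0 ?mulr0 ?mul0r //.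
  apply/funext => y; have [ymu|ymu] := pselect (cylinder mu y); last first.
    by rewrite (indF ymu) mulr0.
  have [xy|xy] := pselect (cylinder (pre x n) (bij_inv t y)); last first.
    by rewrite (indF xy) !mul0r.
  have [[x' [xnu e]]|nx] := pselect (image_set nu (iter (size mu) sg y)); last first.
    by rewrite (graft0 _ nx) mulr0 mul0r.
  rewrite -e graftE // [ind _ x']indF ?mulr0 ?mul0r // => /cylinder_pre xx'.
  by move/cylinder_pre: xy => xy; apply: no; exists y, x'; split.
have tn n m : exists y x', [/\ agree m (t x) y, agree n x x', cylinder nu x',
    cylinder mu y & iter (size nu) sg x' = iter (size mu) sg y].
  have /continuous_agree/(_ x m)[p pP] := ct.
  have [y [x' [xy xx' nx my e]]] := near (maxn n p); exists y, x'; split=> //.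
    rewrite -(bij_invK t y); apply: pP; apply: agreeW xy; exact: leq_maxr.
  apply: agreeW xx'; exact: leq_maxl.
split.
- have [y [x' [_ xx' nx _ _]]] := tn (size nu) 0%N.
  by apply: cylinder_agree nx; exact: agree_sym.
- have [y [x' [xy _ _ my _]]] := tn 0%N (size mu).
  by apply: cylinder_agree my; exact: agree_sym.
apply: agree_eq => n; have [y [x' [ty xx' _ _ e]]] := tn (size nu + n)%N (size mu + n)%N.
apply: agree_trans (agree_iter ty) _; rewrite -e; exact/agree_sym/agree_iter.
Qed.

(** For distinct words the support lemma would give x = nu z = mu z, which forces
    equal lengths at an aperiodic point. *)
Lemma aperiodic_comp_word x mu nu : aperiodic x -> exists n0, forall n, (n0 <= n)%N ->
  q x n * word mu nu * q x n =
  (if mu == nu then ind (cylinder mu) x else 0) *: q x n.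
Proof.
move=> ax; case: eqP => [<-|mn].
  exists (size mu) => n sn; rewrite /word Sword_range.
  have [xmu|xmu] := pselect (cylinder mu x).
    rewrite indT // scale1r q_sub ?q_idem //; first exact: lconst_cylinder.
    by move=> y /(agreeW sn) xy; exact: cylinder_agree xmu.
  rewrite indF // scale0r q_disj ?mul0r //; first exact: lconst_cylinder.
  by move=> y /(agreeW sn) /agree_sym xy ymu; apply: xmu; exact: cylinder_agree ymu.
have [n0 e0] : exists n, q x n * (star 1 * word mu nu) * q x n = 0.
  apply: contrapT => /forallNP nz.
  have [nx mx /ax e] := covers_word_support covers1 nz.
  by apply: mn; rewrite -nx -e -[LHS]mx.
rewrite star1 mul1r in e0.
by exists n0 => n n0n; rewrite scale0r; exact: comp_zero e0.
Qed.

(** The conditional expectation onto D, up to an error, as a function depending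
    on finitely many coordinates. *)
Lemma approx_diagonal b (e : R) : 0 < e -> exists K g,
  (forall x y, agree K x y -> g y = g x :> C) /\
  forall x, aperiodic x -> exists n0, forall n, (n0 <= n)%N ->
    cnorm (q x n * b * q x n - g x *: q x n) <= e.
Proof.
move=> e0; have [s bs] := word_dense b e0.
pose g x : C := \sum_(t <- s) t.1.1 * (if t.1.2 == t.2 then ind (cylinder t.1.2) x else 0).
exists (\max_(t <- s) size t.1.2), g; split.
  move=> x y xy; apply: eq_big_seq => t ts; case: ifP => // _; congr (_ * _).
  have xyt : agree (size t.1.2) x y.
    by apply: agreeW xy; rewrite (big_rem t ts) /= leq_max leqnn.
  by apply: ind_eq; split; apply: cylinder_agree; [exact: agree_sym|].
move=> x ax; have [n0 nP] : exists n0, forall n, (n0 <= n)%N ->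
    q x n * wsum s * q x n = g x *: q x n.
  rewrite /wsum /g; elim: (s) => [|t r [n1 IH]].
    by exists 0%N => n _; rewrite !big_nil mulr0 mul0r scale0r.
  have [n2 n2P] := aperiodic_comp_word t.1.2 t.2 ax.
  exists (maxn n1 n2) => n; rewrite geq_max => /andP[/IH h1 /n2P h2].
  by rewrite !big_cons mulrDr mulrDl -scalerAr -scalerAl h1 h2 scalerA scalerDl.
exists n0 => n /nP <-; rewrite -mulrBl -mulrBr.
exact: le_trans (cnorm_comp _ (q_le1 x n)) bs.
Qed.

Lemma fix_diagonal (phi : starHom O O) :
  (forall mu, admissible A mu -> phi (word mu mu) = word mu mu) ->
  forall a, ss_set D a -> phi a = a.
Proof.
move=> fmu; pose B : set O := [set a | phi a = a].
apply: (@DA_min B); last exact: fmu.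
have B1 : B 1 by exact: rmorph1.
have BP (k : C) (x y : O) : B x -> B y -> B (k *: x + y).
  by rewrite /B /= => Bx By; rewrite linearP /= Bx By.
have BM (x y : O) : B x -> B y -> B (x * y).
  by rewrite /B /= => Bx By; rewrite rmorphM /= Bx By.
have BS (x : O) : B x -> B (star x).
  by rewrite /B /= => Bx; rewrite star_homP Bx.
split; last by exists (StarSub B1 BP BM BS).
move=> u l uB /cvg_cnormP ul; apply/eqP; rewrite -subr_eq0; apply/eqP/cnorm_small => e e0.
have [n /(_ _ (leqnn n)) h] := ul _ (divr_gt0 e0 (ltr0n R 2)).
apply: le_trans (cnorm_triangle (u n) _ _) _; rewrite [leRHS]splitr; apply: lerD.
  by rewrite -{1}(uB n) -linearB /= (le_trans (starHom_contr _ _)) // cnorm_distC ltW.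
exact: ltW.
Qed.

(** * Homeomorphisms induced by normalizing unitaries *)

Lemma Phi_sum (I : Type) (r : seq I) (F : I -> X -> C) :
  (forall i, continuous (F i)) ->
  continuous (fun x => \sum_(i <- r) F i x) /\
  Phi (fun x => \sum_(i <- r) F i x) = \sum_(i <- r) Phi (F i).
Proof.
move=> Fc; elim: r => [|i r [IHc IH]].
  have -> : (fun x => \sum_(i <- [::]) F i x) = (fun=> 0).
    by apply/funext => x; rewrite big_nil.
  by rewrite big_nil Phi0; split=> //; exact: cont_cst.
have -> : (fun x => \sum_(j <- i :: r) F j x) = (fun x => F i x + \sum_(j <- r) F j x).
  by apply/funext => x; rewrite big_cons.
rewrite big_cons -IH (PhiD (Fc i) IHc); split; last by [].
move=> x.
exact: (@cvgD _ _ X (nbhs x) (nbhs_filter x) _ _ _ _ (Fc i x) (IHc x)).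
Qed.

Lemma cylinder_partition n x (h : seq 'I_N -> C) :
  \sum_(w : n.-tuple 'I_N) h w * ind (cylinder w) x = h (pre x n).
Proof.
have sx : size (pre x n) == n by rewrite size_pre.
rewrite (bigD1 (Tuple sx)) //= indT ?mulr1; last exact/cylinder_pre.
rewrite big1 ?addr0 // => w wx; rewrite indF ?mulr0 // => /cylinderE.
rewrite size_tuple => xw; move/negP: wx; apply; apply/eqP/val_inj.
by rewrite /= xw.
Qed.

Lemma sum_cylinders n : \sum_(w : n.-tuple 'I_N) Phi (ind (cylinder w)) = 1.
Proof.
have [_ <-] := Phi_sum (index_enum _) (fun w : n.-tuple 'I_N => @cont_cyl w).
rewrite -Phi1; congr Phi; apply/funext => x.
rewrite -(cylinder_partition n x (fun=> 1)); apply: eq_bigr => w _.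
by rewrite mul1r.
Qed.

Lemma cont_sep x y : (forall g, continuous g -> g x = g y) -> x = y.
Proof.
move=> xy; apply: agree_eq => n; apply/cylinder_pre.
apply: contrapT => ny; have := xy _ (@cont_cyl (pre x n)).
rewrite indT ?indF //; last exact/cylinder_pre.
by move/eqP; rewrite oner_eq0.
Qed.

(** Gelfand duality for the endomorphism Ad(u) of D: by compactness some cylinder
    of each length is sent to a function equal to 1 at x, and these cylinders
    shrink to the image of x. *)
Lemma dual_map u : star u * u = 1 -> u * star u = 1 ->
  (forall a, ss_set D a -> ss_set D (u * a * star u)) ->
  exists th : X -> X, continuous th /\
    forall g, continuous g -> u * Phi g * star u = Phi (g \o th).
Proof.
move=> uu uu' uD.
have /choice[H HP] (g' : X -> C) : exists h, continuous g' ->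
    continuous h /\ Phi h = u * Phi g' * star u.
  have [gc'|] := pselect (continuous g'); last by move=> nc; exists g' => /nc.
  have [h [hc hE]] := Phi_surj (uD _ (Phi_D gc')).
  by exists h.
have Hc g' (gc' : continuous g') := (HP _ gc').1.
have HE g' (gc' : continuous g') := (HP _ gc').2.
have HM (v w : X -> C) (vc : continuous v) (wc : continuous w) :
    H (fun x => v x * w x) = (fun x => H v x * H w x).
  have vwc := contM vc wc.
  apply: Phi_inj; [exact: Hc|exact: (contM (Hc _ vc) (Hc _ wc))|].
  rewrite (HE _ vwc) (PhiM (Hc _ vc) (Hc _ wc)) (HE _ vc) (HE _ wc) (PhiM vc wc).
  by rewrite !mulrA -(mulrA _ (star u) u) uu mulr1.
have HP' k (v w : X -> C) (vc : continuous v) (wc : continuous w) :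
    H (fun x => k * v x + w x) = (fun x => k * H v x + H w x).
  have kvw : continuous (fun x => k * v x + w x).
    move=> x; apply: (@cvgD _ _ X (nbhs x) (nbhs_filter x) _ _ _ _ _ (wc x)).
    exact: (contM (@cont_cst k) vc).
  apply: Phi_inj; first exact: Hc.
    move=> x; apply: (@cvgD _ _ X (nbhs x) (nbhs_filter x) _ _ _ _ _ (Hc _ wc x)).
    exact: (contM (@cont_cst k) (Hc _ vc)).
  rewrite (HE _ kvw) (PhiP k (Hc _ vc) (Hc _ wc)) (HE _ vc) (HE _ wc) (PhiP k vc wc).
  by rewrite mulrDr mulrDl -scalerAr -scalerAl.
have H01 w x : H (ind (cylinder w)) x = 0 \/ H (ind (cylinder w)) x = 1.
  have e : (fun x => ind (cylinder w) x * ind (cylinder w) x) = ind (cylinder w).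
    by apply/funext => y; rewrite ind_mul setIid.
  have := HM _ _ (@cont_cyl w) (@cont_cyl w); rewrite e => /(congr1 (fun h => h x)).
  move/esym/eqP; rewrite -subr_eq0 -{3}[H _ x]mulr1 -mulrBr mulf_eq0 subr_eq0.
  by case/orP => /eqP; [left|right].
have HW m n y x : (m <= n)%N -> H (ind (cylinder (pre y m))) x = 0 ->
    H (ind (cylinder (pre y n))) x = 0.
  move=> mn h0.
  have -> : ind (cylinder (pre y n)) =
      (fun x => ind (cylinder (pre y n)) x * ind (cylinder (pre y m)) x) :> (X -> C).
    apply/funext => z; rewrite ind_mul; apply: ind_eq; split=> [yz|[]//].
    by split=> //; apply/cylinder_pre; apply: agreeW mn _; exact/cylinder_pre.
  by rewrite (HM _ _ (@cont_cyl _) (@cont_cyl _)) h0 mulr0.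
have /choice[th thP] x : exists y, forall n, H (ind (cylinder (pre y n))) x = 1.
  apply: contrapT => /forallNP noy.
  have [n nP] : exists n, forall y, H (ind (cylinder (pre y n))) x = 0.
    apply: koenig => [y m n mn|y z n /eq_pre yz|y]; first exact: HW.
      by rewrite yz.
    have /existsNP[n] := noy y.
    by case: (H01 (pre y n) x) => // h0 _; exists n.
  have Fc (w : n.-tuple 'I_N) := Hc _ (@cont_cyl w).
  have [sc sE] := Phi_sum (index_enum _) Fc.
  have e : (fun x => \sum_(w : n.-tuple 'I_N) H (ind (cylinder w)) x) = (fun=> 1).
    apply: (Phi_inj sc (@cont_cst 1)); rewrite sE Phi1.
    under eq_bigr => w _ do rewrite (HE _ (@cont_cyl w)).
    by rewrite -mulr_suml -mulr_sumr sum_cylinders mulr1.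
  move/(congr1 (fun h => h x))/eqP: e; rewrite big1 ?(eq_sym 0) ?oner_eq0 // => w _.
  have [[y yw]|na] := pselect (admissible A w).
    by have := nP y; rewrite -{1}(size_tuple w) (yw : pre y _ = _).
  have -> : ind (cylinder w) = (fun=> 0) :> (X -> C).
    by apply/funext => z; rewrite indF // => zw; apply: na; exists z.
  have -> : H (fun=> 0) = (fun=> 0); last by [].
  apply: (Phi_inj (Hc _ (@cont_cst 0)) (@cont_cst 0)).
  by rewrite (HE _ (@cont_cst 0)) Phi0 mulr0 mul0r.
have Hth g x : continuous g -> H g x = g (th x).
  move=> gc; apply: (@character_eval (fun k => H k x)) gc => [k v w vc wc|v w vc wc|n].
  - by rewrite HP'.
  - by rewrite HM.
  - exact: thP.
exists th; split.
  apply/continuous_agree => x n.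
  have hc := Hc _ (@cont_cyl (pre (th x) n)).
  have h1 : H (ind (cylinder (pre (th x) n))) x != 0 by rewrite thP oner_eq0.
  have /nbhs_cylP[m mP] := @cvgr_neq0 _ _ _ (nbhs x) (nbhs_filter x) _ _ (hc x) h1.
  exists m => y /mP; rewrite (Hth _ _ (@cont_cyl _)) => nz.
  apply/cylinder_pre; apply: contrapT => na; move: nz; rewrite indF ?eqxx //.
move=> g gc; rewrite -(HE _ gc); congr Phi; apply/funext => x; exact: Hth.
Qed.

Lemma normalizer_covers u : star u * u = 1 -> u * star u = 1 ->
  (forall a, ss_set D (u * a * star u) <-> ss_set D a) -> exists t, covers u t.
Proof.
move=> uu uu' uD.
have [th [thc thE]] := dual_map uu uu' (fun a => proj2 (uD a)).
have [] := @dual_map (star u); rewrite ?starK //.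
  by move=> a Da; apply/uD; rewrite !mulrA uu' mul1r -mulrA uu' mulr1.
move=> th' [thc' thE'].
have K1 : cancel th th'.
  move=> x; apply: cont_sep => g gc.
  suff e : g \o th' \o th = g by rewrite -{2}e.
  have gth' := cont_comp gc thc'.
  apply: (Phi_inj (cont_comp gth' thc) gc).
  rewrite -(thE _ gth') -(thE' _ gc).
  by rewrite !mulrA uu' mul1r -mulrA uu' mulr1.
have K2 : cancel th' th.
  move=> x; apply: cont_sep => g gc.
  suff e : g \o th \o th' = g by rewrite -{2}e.
  have gth := cont_comp gc thc.
  apply: (Phi_inj (cont_comp gth thc') gc).
  rewrite -(thE' _ gth) -(thE _ gc).
  by rewrite !mulrA uu mul1r -mulrA uu mulr1.
exists (SelfBij K2 K1); split=> //.
by move=> g gc; rewrite -(thE _ gc) -mulrA uu mulr1.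
Qed.

(** * Unitaries fixed by the gauge action have vanishing cocycle *)

Variable f : X -> int.
Hypothesis hf : continuous (f : X -> discrete_topology int).
Variable rho : R -> starAut O.
Hypothesis hrho : is_gauge_action S Phi f rho.
Local Notation E := (birkhoff f).

Definition phase t n x : C := expi2pi ((E n x)%:~R * t).

Lemma lconst_phase t n : lconst (phase t n).
Proof. exact: (lconst_comp (fun m : int => expi2pi (m%:~R * t)) (lconst_birkhoff hf n)). Qed.

Lemma phase_cont t n : continuous (phase t n).
Proof. exact/lconst_cont/lconst_phase. Qed.

Lemma phaseD t m n x : phase t (m + n) x = phase t m x * phase t n (iter m sg x).
Proof. by rewrite /phase birkhoffD intrD mulrDl expiD. Qed.

Lemma rho_Sword t mu : rho t (Sword S mu) = Phi (phase t (size mu)) * Sword S mu.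
Proof.
elim: mu => [|i mu IH].
  rewrite /Sword big_nil rmorph1 mulr1 -Phi1; congr Phi; apply/funext => x.
  by rewrite /phase /birkhoff big_nil mul0r expi0.
rewrite Sword_cons rmorphM /= IH hrho.
have -> : (fun x => expi2pi ((f x)%:~R * t)) = phase t 1.
  by apply/funext => x; rewrite /phase /birkhoff big_nat1.
rewrite -!mulrA (mulrA (S i)) (S_intertw i (@phase_cont t (size mu))) -mulrA !mulrA.
rewrite -(PhiM (@phase_cont t 1) (cont_comp (@phase_cont t (size mu)) sg_cont)).
by congr (Phi _ * _ * _); apply/funext => x; exact: (esym (phaseD t 1 (size mu) x)).
Qed.

Lemma phase_conj t n : Phi (phase t n) * star (Phi (phase t n)) = 1.
Proof.
rewrite -(PhiS (@phase_cont t n)) -(PhiM (@phase_cont t n) (cont_conj (@phase_cont t n))).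
by rewrite -Phi1; congr Phi; apply/funext => x; rewrite expi_conjM.
Qed.

Lemma rho_diagonal t a : ss_set D a -> rho t a = a.
Proof.
apply: fix_diagonal => mu _.
rewrite /word rmorphM /= star_homP rho_Sword starM mulrA -(mulrA (Phi _)).
rewrite Sword_range (Phi_comm (@phase_cont t (size mu)) (@cont_cyl mu)).
by rewrite -mulrA phase_conj mulr1.
Qed.

Lemma rho_word t mu nu : rho t (word mu nu) =
  Phi (phase t (size mu)) * word mu nu * star (Phi (phase t (size nu))).
Proof. by rewrite /word rmorphM /= star_homP !rho_Sword starM !mulrA. Qed.

Lemma q_rho t x n : rho t (q x n) = q x n.
Proof. exact: (rho_diagonal t (D_range (pre x n))). Qed.

(** If the cocycle were not zero, some automorphism rho_t would multiply the
    compression of u^* S_mu S_nu^* by -1, but it is close to a scalar multiple of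
    a projection fixed by rho_t. *)
Lemma cocycle_zero u t x mu nu (c : C) (d : R) n0 :
  covers u t -> (forall s, rho s u = u) ->
  (forall n, (n0 <= n)%N ->
     cnorm (q x n * (star u * word mu nu) * q x n - c *: q x n) <= d) ->
  (forall n, d < cnorm (q x n * (star u * word mu nu) * q x n)) ->
  E (size mu) (t x) = E (size nu) x.
Proof.
move=> ut ru close big; apply: contrapT => /eqP; rewrite -subr_eq0 => ne.
(* rho_s multiplies the compression by the value of expi2pi at s m = 1 / 2. *)
set m := _ - _ in ne; pose s : R := (m%:~R)^-1 / 2.
have [[ct ct'] _ _ _] := ut.
have [n1 n1P] := lconst_phase s (size nu) x.
have [n2 n2P] := lconst_continuous ct (lconst_phase s (size mu)) x.
pose n := maxn n0 (maxn n1 n2).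
have nn1 y : agree n x y -> agree n1 x y.
  by apply: agreeW; rewrite !leq_max leqnn !orbT.
have nn2 y : agree n x y -> agree n2 x y.
  by apply: agreeW; rewrite !leq_max leqnn !orbT.
set b := star u * word mu nu in close big; set qb := q x n * b * q x n.
have rb : rho s qb = - qb.
  rewrite /qb /b 3!rmorphM /= star_homP ru q_rho rho_word.
  have e1 : star (Phi (phase s (size nu))) * q x n = (phase s (size nu) x)^* *: q x n.
    rewrite -(PhiS (@phase_cont s (size nu))) (q_cst (cont_conj (@phase_cont s (size nu)))) //.
    by move=> y /nn1/n1P ->.
  have e2 : q x n * (star u * Phi (phase s (size mu))) =
      phase s (size mu) (t x) *: (q x n * star u).
    have pc := cont_comp (@phase_cont s (size mu)) ct.
    have -> : star u * Phi (phase s (size mu)) = Phi (fun y => phase s (size mu) (t y)) * star u.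
      rewrite (covers_star ut pc); congr (_ * Phi _); apply/funext => y /=.
      by rewrite bij_invK.
    rewrite mulrA /q (Phi_comm (@cont_cyl _) pc) -/(q x n) (q_cst pc) ?scalerAl //.
    by move=> y /nn2/n2P ->.
  rewrite !mulrA -(mulrA _ _ (Phi (phase s (size mu)))) e2 -!mulrA e1.
  rewrite -!scalerAr -!scalerAl !scalerA -scaleN1r !mulrA; congr (_ *: _).
  rewrite -expiN -expiD -mulNr -mulrDl addrC -intrN -intrD -/m /s mulrA mulfV ?intr_eq0 //.
  by rewrite mul1r expi_half.
have := close n (leq_maxl _ _); rewrite -/qb => c1.
have c2 : cnorm (- qb - c *: q x n) <= d.
  apply: le_trans c1; rewrite -{1}rb -{1}(q_rho s) -linearZ -linearB /=.
  exact: starHom_contr.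
have := cnormB (qb - c *: q x n) (- qb - c *: q x n).
rewrite opprB opprK subrKA -mulr2n => c3.
have c4 : cnorm (qb *+ 2) = 2 * cnorm qb.
  rewrite -scaler_nat cnormZ; congr (_ * _).
  have -> : (2%:R : C) = (2%:R : R)%:C%C by rewrite rmorph_nat.
  by rewrite normc_real normr_nat.
by have := big n; rewrite -/qb; rewrite c4 in c3; lra.
Qed.

(** Approximate u by a finite combination w of words. For each aperiodic x, the
    compressions of u^* w stay close to the projections themselves, so one of the
    finitely many compressions of u^* S_mu S_nu^* stays bounded below, and by the
    support lemma (mu, nu) describes t at x. Its lower bound is read off from a
    function of finitely many coordinates, so the same pair works at all aperiodic
    points of a cylinder whose length does not depend on x, and then by density at
    all its points. *)
Lemma covers_Gamma u t : covers u t -> (forall s, rho s u = u) -> Gamma_f_set f t.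
Proof.
move=> ut ru; have [[ct ct'] uu _ _] := ut; apply/Gamma_fP; split=> // x.
have [s us] := word_dense u (divr_gt0 ltr01 (ltr0n R 2)).
pose B : R := \sum_(w <- s) Normc.normc w.1.1.
have B0 : 0 <= B by apply: sumr_ge0 => w _; exact: normc_ge0.
(* With d as a bound for every word, w would contribute less than 1/2. *)
pose d : R := (2 * (B + 1))^-1.
have d0 : 0 < d by rewrite invr_gt0; lra.
have Bd : B * d < 1 / 2.
  have dE : d * (2 * (B + 1)) = 1 by rewrite mulVf //; apply/eqP; lra.
  have : 2 * (B * d) + 2 * d = 1 by rewrite -[RHS]dE; ring.
  lra.
pose e (w : C * seq 'I_N * seq 'I_N) := star u * word w.1.2 w.2.
have claim1 y : exists2 w, w \in s & forall n, d <= cnorm (q y n * e w * q y n).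
  apply: contrapT => noy.
  have [n nP] : exists n, forall w, w \in s -> cnorm (q y n * e w * q y n) <= d.
    have H w : w \in s -> exists n, cnorm (q y n * e w * q y n) <= d.
      move=> ws; apply: contrapT => /forallNP nn; apply: noy; exists w => // n.
      by rewrite ltW // ltNge; apply/negP/nn.
    elim: (s) H => [|w r IH] H; first by exists 0%N.
    have [n1 h1] := IH (fun v vr => H v (mem_behead (s := w :: r) vr)).
    have [n2 h2] := H w (mem_head _ _).
    exists (maxn n1 n2) => v; rewrite inE => /orP[/eqP->|/h1 {}h1].
      exact: le_trans (comp_mono _ _ (leq_maxr _ _)) h2.
    exact: le_trans (comp_mono _ _ (leq_maxl _ _)) h1.
  have sum_e : star u * wsum s = \sum_(w <- s) w.1.1 *: e w.
    by rewrite /wsum mulr_sumr; apply: eq_bigr => w _; rewrite -scalerAr.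
  have h1 : cnorm (q y n * (star u * wsum s) * q y n) <= B * d.
    rewrite sum_e mulr_sumr mulr_suml; apply: le_trans (cnorm_sum _ _ _) _.
    rewrite /B mulr_suml big_seq [leRHS]big_seq; apply: ler_sum => w ws.
    rewrite -scalerAr -scalerAl cnormZ ler_wpM2l ?normc_ge0 //; exact: nP.
  have h2 : cnorm (q y n * (star u * (u - wsum s)) * q y n) <= 1 / 2.
    apply: le_trans (cnorm_comp _ (q_le1 y n)) _; apply: le_trans us.
    apply: cnorm_pinj; rewrite cnorm_starE; exact: cnorm_isometry.
  have h3 : q y n * (star u * (u - wsum s)) * q y n + q y n * (star u * wsum s) * q y n = q y n.
    by rewrite -mulrDl -mulrDr -mulrDr subrK uu mulr1 q_idem.
  have := cnormD (q y n * (star u * (u - wsum s)) * q y n) (q y n * (star u * wsum s) * q y n).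
  by rewrite h3 q_norm; lra.
have d4 : 0 < d / 4 by rewrite divr_gt0.
have /choice[Kg KgP] (w : C * seq 'I_N * seq 'I_N) : exists Kg : nat * (X -> C),
    (forall x y, agree Kg.1 x y -> Kg.2 y = Kg.2 x) /\
    forall x, aperiodic x -> exists n0, forall n, (n0 <= n)%N ->
      cnorm (q x n * e w * q x n - Kg.2 x *: q x n) <= d / 4.
  by have [K [g P]] := approx_diagonal (e w) d4; exists (K, g).
pose K := \max_(w <- s) (Kg w).1.
have [x' [xx' ax']] := aperiodic_dense hA01 hAirr hAperm x K.
have [w ws wbig] := claim1 x'; have [gK gP] := KgP w.
have Kw : ((Kg w).1 <= K)%N by rewrite /K (big_rem w ws) /= leq_max leqnn.
have qg y n : cnorm ((Kg w).2 y *: q y n) = Normc.normc ((Kg w).2 y).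
  by rewrite cnormZ q_norm mulr1.
have g_big : 3 * (d / 4) <= Normc.normc ((Kg w).2 x').
  have [n0 /(_ _ (leqnn _)) h] := gP x' ax'.
  rewrite -(qg x' n0); have := wbig n0.
  by have := cnorm_leD (q x' n0 * e w * q x' n0) ((Kg w).2 x' *: q x' n0); lra.
have main y : agree K x y -> aperiodic y -> [/\ cylinder w.2 y, cylinder w.1.2 (t y),
    iter (size w.1.2) sg (t y) = iter (size w.2) sg y &
    E (size w.1.2) (t y) = E (size w.2) y].
  move=> xy ay; have [n0 h] := gP y ay.
  have x'y : agree (Kg w).1 x' y.
    by apply: agreeW Kw _; exact: agree_trans (agree_sym xx') xy.
  have gy : (Kg w).2 y = (Kg w).2 x' by exact: gK.
  have big n : d / 4 < cnorm (q y n * e w * q y n).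
    apply: lt_le_trans (comp_mono _ _ (leq_maxl n n0)); set m := maxn _ _.
    have := h m (leq_maxr _ _).
    have := cnorm_leD ((Kg w).2 y *: q y m) (q y m * e w * q y m).
    by rewrite qg gy cnorm_distC; lra.
  have nz n : q y n * e w * q y n <> 0.
    by move=> e0; have := big n; rewrite e0 cnorm0; lra.
  have [cy cty iy] := covers_word_support ut nz.
  by split=> //; exact: cocycle_zero ut ru h big.
exists (size w.1.2), (size w.2), K => y xy; split.
  apply: pt_inj => i.
  apply: (@aperiodic_closed _ _ hA01 hAirr hAperm _
    (fun y => pt (iter (size w.1.2) sg (t y)) i) (fun y => pt (iter (size w.2) sg y) i)) xy.
  - have lp : lconst (fun y => pt y i) by move=> z; exists i.+1 => z' ->.
    exact: (lconst_continuous ct (lconst_continuous (@iter_continuous _ A (size w.1.2)) lp)).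
  - have lp : lconst (fun y => pt y i) by move=> z; exists i.+1 => z' ->.
    exact: (lconst_continuous (@iter_continuous _ A (size w.2)) lp).
  - by move=> z xz az; have [_ _ ->] := main z xz az.
apply: (@aperiodic_closed _ _ hA01 hAirr hAperm _
    (fun y => E (size w.1.2) (t y)) (fun y => E (size w.2) y)) xy.
- exact: (lconst_continuous ct (lconst_birkhoff hf _)).
- exact: (lconst_birkhoff hf _).
- by move=> z xz az; have [] := main z xz az.
Qed.

(** * Fourier coefficients and the commutant of the diagonal *)

Variable gam : R -> starHom O O.
Hypothesis hgam : forall t i, gam t (S i) = expi2pi t *: S i.

Definition commD b := forall a, ss_set D a -> b * a = a * b.

Definition deg (w : C * seq 'I_N * seq 'I_N) : int := (size w.1.2)%:Z - (size w.2)%:Z.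

Definition degw mu nu : int := (size mu)%:Z - (size nu)%:Z.

Lemma gam_contr t b : cnorm (gam t b) <= cnorm b.
Proof. exact: starHom_contr. Qed.

Lemma gam_Sword t mu : gam t (Sword S mu) = expi2pi ((size mu)%:R * t) *: Sword S mu.
Proof.
elim: mu => [|i mu IH].
  by rewrite /Sword big_nil rmorph1 mul0r expi0 scale1r.
rewrite Sword_cons rmorphM /= IH hgam -scalerAl -scalerAr scalerA; congr (_ *: _).
by rewrite -expiD [size _]/= -[in RHS]natr1 mulrDl mul1r addrC.
Qed.

Lemma gam_word t mu nu : gam t (word mu nu) = expi2pi ((degw mu nu)%:~R * t) *: word mu nu.
Proof.
rewrite /word rmorphM /= star_homP !gam_Sword starZ -scalerAl -scalerAr scalerA.
by congr (_ *: _); rewrite -expiN -expiD -mulNr -mulrDl /degw rmorphB /= -!pmulrn.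
Qed.

Lemma gam_diagonal t a : ss_set D a -> gam t a = a.
Proof.
apply: fix_diagonal => mu _.
by rewrite gam_word /degw subrr mul0r expi0 scale1r.
Qed.

Lemma gam_commD t b : commD b -> commD (gam t b).
Proof.
by move=> bD a Da; rewrite -[a](gam_diagonal t Da) -!rmorphM bD.
Qed.

Lemma normc_nat n : Normc.normc (n%:R : C) = n%:R.
Proof.
have -> : (n%:R : C) = (n%:R : R)%:C%C by rewrite rmorph_nat.
by rewrite normc_real normr_nat.
Qed.

(** The m-th Fourier coefficient of b under the gauge action, computed with the
    M-th roots of unity. *)
Definition coef (m : int) M b : O :=
  (M%:R : C)^-1 *: \sum_(k < M) expi2pi (- m%:~R * (k%:R / M%:R)) *: gam (k%:R / M%:R) b.

Lemma coefP m M (k : C) a b : coef m M (k *: a + b) = k *: coef m M a + coef m M b.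
Proof.
rewrite /coef scalerA mulrC -scalerA -scalerDr; congr (_ *: _).
rewrite scaler_sumr -big_split; apply: eq_bigr => i _ /=.
by rewrite linearP /= scalerDr !scalerA mulrC.
Qed.

Lemma coefB m M a b : coef m M (a - b) = coef m M a - coef m M b.
Proof. by have := coefP m M (-1) b a; rewrite !scaleN1r addrC => ->; rewrite addrC. Qed.

Lemma coef0 m M : coef m M 0 = 0.
Proof. by have := coefB m M 0 0; rewrite !subrr. Qed.

Lemma coef_contr m M b : (0 < M)%N -> cnorm (coef m M b) <= cnorm b.
Proof.
move=> M0; have MR : (0 : R) < M%:R by rewrite ltr0n.
rewrite /coef cnormZ Normc.normcV normc_nat ler_pdivrMl //.
apply: le_trans (cnorm_sum _ _ _) _.
apply: (le_trans (y := \sum_(k < M) cnorm b)); last first.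
  by rewrite sumr_const card_ord mulr_natl.
by apply: ler_sum => k _; rewrite cnormZ normc_expi mul1r gam_contr.
Qed.

Lemma coef_word m M mu nu : (0 < M)%N ->
  coef m M (word mu nu) = if (M%:Z %| degw mu nu - m)%Z then word mu nu else 0.
Proof.
move=> M0; rewrite /coef.
under eq_bigr => k _ do rewrite gam_word scalerA -expiD -mulrDl addrC -rmorphN -rmorphD.
rewrite -scaler_suml expi_sum // scalerA; case: ifP => _; last by rewrite mulr0 scale0r.
by rewrite mulVf ?scale1r // pnatr_eq0 -lt0n.
Qed.

Lemma coef_commD m M b : commD b -> commD (coef m M b).
Proof.
move=> bD a Da; rewrite /coef -scalerAl -scalerAr mulr_suml mulr_sumr; congr (_ *: _).
by apply: eq_bigr => k _; rewrite -scalerAl -[RHS]scalerAr (gam_commD _ bD Da).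
Qed.

Lemma coef_fixed M b : (0 < M)%N -> (forall t, gam t b = b) -> coef 0 M b = b.
Proof.
move=> M0 bfix; rewrite /coef.
under eq_bigr => k _ do rewrite mulr0z oppr0 mul0r expi0 scale1r bfix.
rewrite sumr_const card_ord (_ : b *+ M = (M%:R : C) *: b); last by rewrite scaler_nat.
by rewrite scalerA mulVf ?scale1r // pnatr_eq0 -lt0n.
Qed.

(** Homogeneity of degree m is expressed by approximation, because the elements
    that occur are limits of averages. *)
Definition homog m b := forall e : R, 0 < e ->
  exists s, all (fun w => deg w == m) s /\ cnorm (b - wsum s) <= e.

Lemma dvdz_small (M : nat) (d : int) : (`|d| < M)%N -> (M%:Z %| d)%Z = (d == 0).
Proof.
move=> dM; apply/idP/eqP => [|->]; last exact: dvdz0.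
by move=> /dvdn_leq => /= h; apply/eqP; rewrite -absz_eq0; lia.
Qed.

Lemma coef_wsum m s : exists M0, forall M, (M0 <= M)%N ->
  (0 < M)%N /\ coef m M (wsum s) = wsum [seq w <- s | deg w == m].
Proof.
elim: s => [|w s [M0 IH]].
  by exists 1%N => M M1; split=> //; rewrite /wsum !big_nil coef0.
exists (maxn M0 `|deg w - m|.+1) => M; rewrite geq_max => /andP[/IH[MM h] wM].
split=> //; rewrite /wsum big_cons coefP; rewrite /wsum in h; rewrite h coef_word //.
rewrite -[degw _ _]/(deg w) dvdz_small // subr_eq0 /=.
by case: ifP => _; rewrite ?big_cons // scaler0 add0r.
Qed.

(** For a finite combination of words the averages are eventually constant. *)
Lemma coef_lim m b : exists c, (forall e : R, 0 < e -> exists M0, forall M, (M0 <= M)%N ->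
    (0 < M)%N /\ cnorm (coef m M b - c) <= e) /\ homog m c.
Proof.
have approx e : 0 < e -> exists s M0, all (fun w => deg w == m) s /\
    forall M, (M0 <= M)%N -> (0 < M)%N /\ cnorm (coef m M b - wsum s) <= e.
  move=> e0; have [s bs] := word_dense b e0; have [M0 M0P] := coef_wsum m s.
  exists [seq w <- s | deg w == m], M0; split; first exact: filter_all.
  move=> M /M0P[MM <-]; split=> //; rewrite -coefB.
  exact: le_trans (coef_contr _ _ MM) bs.
have [c /cvg_cnormP cP] : exists c, (fun M => cnorm (coef m M b - c)) @ \oo --> (0 : R).
  apply: cnorm_complete => e e0; have e3 : 0 < e / 3 by rewrite divr_gt0.
  have [s [M0 [_ M0P]]] := approx _ e3; exists M0 => p r Mp Mr.
  apply: le_lt_trans (cnorm_triangle (wsum s) _ _) _.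
  have [_ h1] := M0P p Mp; have [_ h2] := M0P r Mr.
  by rewrite [cnorm (wsum s - _)]cnorm_distC; lra.
exists c; split=> e e0.
  have [M0 M0P] := cP e e0; exists (maxn 1 M0) => M; rewrite geq_max => /andP[M1 /M0P h].
  by split=> //; exact: ltW.
have e2 : 0 < e / 2 by rewrite divr_gt0.
have [s [M0 [sm M0P]]] := approx _ e2; have [M1 M1P] := cP _ e2.
exists s; split=> //; apply: le_trans (cnorm_triangle (coef m (maxn M0 M1) b) _ _) _.
have [_ h1] := M0P _ (leq_maxl M0 M1); have := M1P _ (leq_maxr M0 M1).
by rewrite cnorm_distC; lra.
Qed.

Lemma coef_lim_commD m b c : commD b -> (forall e : R, 0 < e -> exists M0, forall M,
  (M0 <= M)%N -> (0 < M)%N /\ cnorm (coef m M b - c) <= e) -> commD c.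
Proof.
move=> bD bc a Da; apply/eqP; rewrite -subr_eq0; apply/eqP/cnorm_small => e e0.
have na := cnorm_ge0 a.
have a0 : 0 < 2 * (cnorm a + 1) by lra.
have [M /(_ _ (leqnn M))[_]] := bc _ (divr_gt0 e0 a0).
rewrite ler_pdivlMr // => h.
have -> : c * a - a * c = a * (coef m M b - c) - (coef m M b - c) * a.
  by rewrite mulrBl mulrBr (coef_commD m M bD Da) [RHS]addrC opprB subrKA.
apply: le_trans (cnormB _ _) _.
have := cnormM a (coef m M b - c); have := cnormM (coef m M b - c) a.
have := cnorm_ge0 (coef m M b - c); nra.
Qed.

Lemma homog_gam m b t : homog m b -> gam t b = expi2pi (m%:~R * t) *: b.
Proof.
move=> bm; apply/eqP; rewrite -subr_eq0; apply/eqP/cnorm_small => e e0.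
have [s [sm bs]] := bm _ (divr_gt0 e0 (ltr0n R 2)).
have gs : gam t (wsum s) = expi2pi (m%:~R * t) *: wsum s.
  rewrite /wsum linear_sum scaler_sumr; apply: eq_big_seq => w ws.
  by rewrite linearZ /= gam_word !scalerA (mulrC w.1.1) -(eqP (allP sm w ws)).
apply: le_trans (cnorm_triangle (gam t (wsum s)) _ _) _; rewrite [leRHS]splitr; apply: lerD.
  by rewrite -linearB; exact: le_trans (gam_contr _ _) bs.
by rewrite gs -scalerBr cnormZ normc_expi mul1r cnorm_distC.
Qed.

Lemma D_close b : (forall e : R, 0 < e -> exists a, ss_set D a /\ cnorm (b - a) <= e) ->
  ss_set D b.
Proof.
move=> bD; have /choice[u uP] (n : nat) : exists a, ss_set D a /\ cnorm (b - a) <= (n.+1%:R)^-1.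
  by apply: bD; rewrite invr_gt0 ltr0n.
apply: (@DA_closed u) => [n|]; first by have [] := uP n.
apply/cvg_cnormP => e e0.
have [n0 n0P] : exists n0, forall n, (n0 <= n)%N -> (n.+1%:R)^-1 < e.
  have /cvgrPdist_lt/(_ _ e0)[n0 _ n0P] := @cvg_harmonic R.
  exists n0 => n /n0P /=; rewrite sub0r normrN ger0_norm // invr_ge0 ler0n.
by exists n0 => n /n0P; apply: le_lt_trans; rewrite cnorm_distC; have [] := uP n.
Qed.

(** Pinching by a projection of D fixes the elements commuting with D and kills
    S_mu S_nu^* when mu and nu have the same length and differ. *)
Definition pinch mu b : O := let p := Phi (ind (cylinder mu)) in
  p * b * p + (1 - p) * b * (1 - p).

Lemma pinchP mu (k : C) a b : pinch mu (k *: a + b) = k *: pinch mu a + pinch mu b.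
Proof.
rewrite /pinch; set p := Phi _; move: (1 - p) => p'.
by rewrite !mulrDr !mulrDl -!scalerAr -!scalerAl scalerDr addrACA.
Qed.

Lemma pinch_contr mu b : cnorm (pinch mu b) <= cnorm b.
Proof.
rewrite /pinch; set p := Phi (ind (cylinder mu)).
have pp : p * p = p by exact: cyl_proj.
have sp : star p = p by exact: cyl_self.
have [p' p'E] : exists p', p' = 1 - p by exists (1 - p).
have pp' : p + p' = 1 by rewrite p'E addrC subrK.
have p_p' : p * p' = 0 by rewrite p'E mulrBr mulr1 pp subrr.
have p'_p : p' * p = 0 by rewrite p'E mulrBl mul1r pp subrr.
have p'p' : p' * p' = p' by rewrite {2}p'E mulrBr mulr1 p'_p subr0.
have sp' : star p' = p' by rewrite p'E starB star1 sp.
have v1 : cnorm (p - p') <= 1.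
  apply: cnorm_isometry; rewrite starB sp sp' mulrBr !mulrBl pp p'p' p_p' p'_p.
  by rewrite subr0 sub0r opprK.
have bE : b = (p * b * p + p' * b * p') + (p * b * p' + p' * b * p).
  rewrite addrACA (addrC (p' * b * p')) -!mulrDr.
  by rewrite pp' !mulr1 -mulrDl pp' mul1r.
have vE : (p - p') * b * (p - p') = (p * b * p + p' * b * p') - (p * b * p' + p' * b * p).
  rewrite mulrBr !mulrBl opprB opprD -!addrA; congr (_ + _).
  by rewrite addrC -addrA.
have -> : p * b * p + (1 - p) * b * (1 - p) = 2^-1 *: (b + (p - p') * b * (p - p')).
  have h (c Z Y : O) : c = Z + Y -> Z = 2^-1 *: (c + (Z - Y)).
    by move=> ->; rewrite (addrC Z Y) [X in _ *: X]addrC subrKA scaler_halfD.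
  by rewrite -p'E vE; exact: h.
apply: (le_trans (y := 2^-1 * (cnorm b + cnorm b))); last by lra.
rewrite cnormZ normc_half ler_wpM2l // ?invr_ge0 //; apply: le_trans (cnormD _ _) _.
by rewrite lerD2l cnorm_comp.
Qed.

Lemma pinch_commD mu b : commD b -> pinch mu b = b.
Proof.
move=> bD; rewrite /pinch; set p := Phi _.
have Dp : ss_set D p by exact: D_range.
have pp : p * p = p by exact: cyl_proj.
rewrite mulrBl mul1r -(bD _ Dp) -mulrA pp mulrBr mulr1 mulrBl -mulrA pp subrr subr0.
by rewrite addrC subrK.
Qed.

Lemma pinch0 mu : pinch mu 0 = 0.
Proof. by rewrite /pinch !mulr0 !mul0r addr0. Qed.

(** The elements mapping the complement of the mu-cylinder into the cylinder. *)
Definition off mu b := Phi (ind (cylinder mu)) * b = b /\ b * Phi (ind (cylinder mu)) = 0.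

Lemma pinch_off mu b : off mu b -> pinch mu b = 0.
Proof. by move=> [pb bp]; rewrite /pinch mulrBl mul1r pb bp subrr mul0r add0r. Qed.

Lemma off_pinch mu nu b : off mu b -> off mu (pinch nu b).
Proof.
rewrite /off /pinch; set p := Phi (ind (cylinder mu)); set r := Phi _ => -[pb bp].
have pr : p * r = r * p := Phi_comm (@cont_cyl mu) (@cont_cyl nu).
have pr' : p * (1 - r) = (1 - r) * p by rewrite mulrBr mulrBl mulr1 mul1r pr.
have h c : p * c = c * p -> p * (c * b * c) = c * b * c /\ c * b * c * p = 0.
  move=> pc; split; first by rewrite !mulrA pc -(mulrA c p) pb.
  by rewrite -mulrA -pc mulrA -(mulrA c) bp mulr0 mul0r.
have [h1 h2] := h _ pr; have [h3 h4] := h _ pr'.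
by split; [rewrite [LHS]mulrDr h1 h3|rewrite [LHS]mulrDl h2 h4 addr0].
Qed.

Definition pinches (l : seq (seq 'I_N)) b := foldr pinch b l.

Lemma pinchesP l (k : C) a b : pinches l (k *: a + b) = k *: pinches l a + pinches l b.
Proof. by elim: l => //= mu l ->; exact: pinchP. Qed.

Lemma pinches_contr l b : cnorm (pinches l b) <= cnorm b.
Proof. by elim: l => //= mu l; apply: le_trans; exact: pinch_contr. Qed.

Lemma pinches_commD l b : commD b -> pinches l b = b.
Proof. by move=> bD; elim: l => //= mu l ->; exact: pinch_commD. Qed.

Lemma pinches_off l mu b : off mu b -> mu \in l -> pinches l b = 0.
Proof.
move=> ob; have ol r : off mu (pinches r b) by elim: r => //= nu r; exact: off_pinch.
elim: l => //= nu l IH; rewrite inE => /orP[/eqP<-|/IH->]; last exact: pinch0.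
exact: pinch_off.
Qed.

Lemma commD_D a : ss_set D a -> commD a.
Proof. by move=> Da b Db; exact: D_comm. Qed.

Lemma off_word mu nu : size mu = size nu -> mu <> nu -> off mu (word mu nu).
Proof.
move=> sz mn; split; first by rewrite /word mulrA Sword_rangeK.
rewrite /word -Sword_starK -!mulrA -(PhiM (@cont_cyl nu) (@cont_cyl mu)).
rewrite (_ : (fun x => _) = (fun=> 0)) ?Phi0 ?mulr0 //.
apply/funext => x; rewrite ind_mul indF // => -[/cylinderE nx /cylinderE mx].
by apply: mn; rewrite -nx -mx sz.
Qed.

Lemma pinches_wsum s l : all (fun w => deg w == 0) s -> {subset [seq w.1.2 | w <- s] <= l} ->
  ss_set D (pinches l (wsum s)).
Proof.
have D0 : ss_set D 0 by rewrite -Phi0; exact: (Phi_D (@cont_cst 0)).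
elim: s => [_ _|w s IH /= /andP[w0 s0] sl].
  by rewrite /wsum big_nil pinches_commD //; exact: commD_D.
rewrite /wsum big_cons pinchesP; apply: (@ssP _ _ D); last first.
  by apply: IH => // mu ms; apply: sl; rewrite inE ms orbT.
have [e|/eqP ne] := eqVneq w.1.2 w.2.
  have Dw : ss_set D (word w.1.2 w.2) by rewrite /word e Sword_range; exact: D_range.
  by rewrite pinches_commD //; exact: commD_D.
have sz : size w.1.2 = size w.2.
  by move: w0; rewrite subr_eq0 => /eqP[].
by rewrite (pinches_off (off_word sz ne)) //; apply: sl; rewrite mem_head.
Qed.

(** Pinching an approximation by words of degree 0 leaves only its terms in D. *)
Lemma homog0_D b : commD b -> homog 0 b -> ss_set D b.
Proof.
move=> bD b0; apply: D_close => e e0; have [s [s0 bs]] := b0 e e0.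
pose l := [seq w.1.2 | w <- s].
exists (pinches l (wsum s)); split; first exact: pinches_wsum.
rewrite -{1}(pinches_commD l bD); apply: le_trans bs.
have -> : pinches l b - pinches l (wsum s) = pinches l (b - wsum s).
  by have := pinchesP l (-1) (wsum s) b; rewrite !scaleN1r addrC => ->; rewrite addrC.
exact: pinches_contr.
Qed.

Lemma commDM a b : commD a -> commD b -> commD (a * b).
Proof. by move=> aD bD c Dc; rewrite -mulrA bD // mulrA aD // mulrA. Qed.

Lemma commDS a : commD a -> commD (star a).
Proof.
move=> aD c Dc; apply: (can_inj (@starK R O)); rewrite !starM starK aD //; exact: ssS.
Qed.

(** Words of nonzero degree consist of two words of different lengths. *)
Lemma aperiodic_comp_homog x s m : aperiodic x -> m != 0 ->
  all (fun w => deg w == m) s ->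
  exists n0, forall n, (n0 <= n)%N -> q x n * wsum s * q x n = 0.
Proof.
move=> ax m0; elim: s => [_|w s IH /= /andP[/eqP wm /IH[n1 n1P]]].
  by exists 0%N => n _; rewrite /wsum big_nil mulr0 mul0r.
have [n2 n2P] := aperiodic_comp_word w.1.2 w.2 ax.
exists (maxn n1 n2) => n; rewrite geq_max => /andP[/n1P h1 /n2P h2].
have ne : w.1.2 == w.2 = false.
  by apply/eqP => e; move: m0; rewrite -wm /deg e subrr eqxx.
rewrite ne scale0r in h2.
by rewrite /wsum big_cons mulrDr mulrDl -scalerAr -scalerAl h2 scaler0 add0r.
Qed.

Lemma local_inverse g x : continuous g -> g x != 0 -> exists n h, continuous h /\
  Phi g * Phi h = q x n.
Proof.
move=> gc gx.
have /nbhs_cylP[n nP] := @cvgr_neq0 _ _ _ (nbhs x) (nbhs_filter x) g _ (gc x) gx.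
pose h y := ind (cylinder (pre x n)) y / g y.
have hc : continuous h.
  move=> z; have [xz|xz] := pselect (agree n x z).
    apply: (@cvgM _ X (nbhs z) (nbhs_filter z) _ _ _ _ (@cont_cyl _ z)).
    exact: (@cvgV _ X (nbhs z) (nbhs_filter z) g _ (nP _ xz) (gc z)).
  have d0 y : agree n z y -> h y = 0.
    move=> zy; rewrite /h indF ?mul0r // => /cylinder_pre xy; apply: xz.
    exact: agree_trans xy (agree_sym zy).
  move=> U; rewrite d0 // => U0; apply/nbhs_cylP; exists n => y /d0 dy.
  by rewrite /= dy; exact: nbhs_singleton U0.
exists n, h; split=> //; rewrite -(PhiM gc hc); congr Phi; apply/funext => y; rewrite /h.
have [/cylinder_pre xy|xy] := pselect (cylinder (pre x n) y).
  by rewrite mulrCA divff ?mulr1 //; exact: (nP y xy).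
by rewrite (indF xy) mul0r mulr0.
Qed.

(** If c commutes with D and is homogeneous of nonzero degree, then c^*c is a
    continuous function that vanishes at the aperiodic points. *)
Lemma homog_zero m c : m != 0 -> commD c -> homog m c -> c = 0.
Proof.
move=> m0 cD cm.
have ccD : commD (star c * c) by exact: commDM (commDS cD) cD.
have cc0 : homog 0 (star c * c).
  have fixed t : gam t (star c * c) = star c * c.
    rewrite rmorphM /= star_homP (homog_gam t cm) starZ -scalerAl -scalerAr scalerA.
    by rewrite mulrC expi_conjM scale1r.
  have [d [dP d0]] := coef_lim 0 (star c * c).
  suff -> : star c * c = d by [].
  apply/eqP; rewrite -subr_eq0; apply/eqP/cnorm_small => e /dP[M /(_ _ (leqnn M))[MM]].
  by rewrite coef_fixed.
have [g [gc gE]] := Phi_surj (homog0_D ccD cc0).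
have g0 x : aperiodic x -> g x = 0.
  move=> ax; apply/eqP/negPn/negP => gx.
  have [n1 [h [hc hE]]] := local_inverse gc gx.
  pose H := cnorm (Phi h); have H0 : 0 <= H := cnorm_ge0 _.
  (* This choice makes e^2 H smaller than 1. *)
  pose e := (1 + H)^-1.
  have e0 : 0 < e by rewrite invr_gt0; lra.
  have eH : e * (1 + H) = 1 by rewrite mulVf //; apply/eqP; lra.
  have [s [sm cs]] := cm e e0.
  have [n0 n0P] := aperiodic_comp_homog ax m0 sm.
  pose n := maxn n0 n1; have Dq : ss_set D (q x n) := D_range _.
  have cq : cnorm (c * q x n) <= e.
    have -> : c * q x n = q x n * (c - wsum s) * q x n.
      by rewrite mulrBr mulrBl (n0P n (leq_maxl _ _)) subr0 -(cD _ Dq) -mulrA q_idem.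
    exact: le_trans (cnorm_comp _ (q_le1 x n)) cs.
  have qE : q x n = star (c * q x n) * (c * q x n) * Phi h.
    have -> : star (c * q x n) * (c * q x n) = q x n * (star c * c).
      by rewrite starM q_self -!mulrA (mulrA (star c)) (ccD _ Dq) mulrA q_idem.
    by rewrite -gE -mulrA hE qW //; exact: leq_maxr.
  have := q_norm x n; rewrite {1}qE => nq.
  have := cnormM (star (c * q x n) * (c * q x n)) (Phi h); rewrite nq cnorm_star -/H.
  rewrite expr2 => h1; have x0 := cnorm_ge0 (c * q x n).
  have h2 : cnorm (c * q x n) * cnorm (c * q x n) <= e * e.
    by apply: ler_pM.
  have h3 := ler_wpM2r H0 h2.
  have h4 : e * e * H = e - e * e by rewrite -[X in X - _]mulr1 -eH; ring.
  have h5 : 0 < e * e by rewrite mulr_gt0.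
  have h6 : 0 <= e * H by rewrite mulr_ge0 // ltW.
  have h7 : e + e * H = 1 by rewrite -[RHS]eH; ring.
  by clear qE nq hE gE; lra.
have gz : g = fun=> 0.
  apply/funext => x; apply/eqP/negPn/negP => gx.
  have /nbhs_cylP[n nP] := @cvgr_neq0 _ _ _ (nbhs x) (nbhs_filter x) g _ (gc x) gx.
  have [y [xy ay]] := aperiodic_dense hA01 hAirr hAperm x n.
  by have := nP y xy; rewrite g0 // eqxx.
apply: cnorm_eq0; have := cnorm_star c; rewrite -gE gz Phi0 cnorm0 => /esym/eqP.
by rewrite sqrf_eq0 => /eqP.
Qed.

(** An index m with |m| < L occurs L - |m| times in the double sum, so this is the
    Fejer mean of the Fourier series of b. *)
Definition fejer L M b : O :=
  (L%:R : C)^-1 *: \sum_(i < L) \sum_(j < L) coef (i%:Z - j%:Z) M b.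

Lemma fejerP L M (k : C) a b : fejer L M (k *: a + b) = k *: fejer L M a + fejer L M b.
Proof.
rewrite /fejer scalerA mulrC -scalerA -scalerDr; congr (_ *: _).
rewrite scaler_sumr -big_split; apply: eq_bigr => i _ /=.
rewrite scaler_sumr -big_split; apply: eq_bigr => j _ /=.
exact: coefP.
Qed.

Lemma fejerB L M a b : fejer L M (a - b) = fejer L M a - fejer L M b.
Proof. by have := fejerP L M (-1) b a; rewrite !scaleN1r addrC => ->; rewrite addrC. Qed.

Lemma normc_sqr (z : C) : z * z^* = (Normc.normc z ^+ 2)%:C%C.
Proof.
case: z => a b; rewrite /Normc.normc sqr_sqrtr ?addr_ge0 ?sqr_ge0 //.
by apply/eqP; rewrite eq_complex /=; apply/andP; split; apply/eqP; ring.
Qed.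

(** The Fejer kernel is nonnegative and has total mass 1. *)
Lemma fejer_contr L M b : (0 < L)%N -> (L <= M)%N -> cnorm (fejer L M b) <= cnorm b.
Proof.
move=> L0 LM; have M0 : (0 < M)%N := leq_trans L0 LM.
pose Dk (k : nat) : C := \sum_(j < L) expi2pi (j%:R * (k%:R / M%:R)).
have kE (k : nat) : \sum_(i < L) \sum_(j < L)
    expi2pi (- (i%:Z - j%:Z)%:~R * (k%:R / M%:R) : R) = (Normc.normc (Dk k) ^+ 2)%:C%C.
  rewrite -normc_sqr /Dk rmorph_sum mulr_suml exchange_big; apply: eq_bigr => j _.
  rewrite mulr_sumr; apply: eq_bigr => i _ /=.
  by rewrite -expiN -expiD -mulNr -mulrDl rmorphB opprB /= -!pmulrn.
have FE : fejer L M b = (L%:R * M%:R : C)^-1 *: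
    \sum_(k < M) ((Normc.normc (Dk k) ^+ 2)%:C%C : C) *: gam (k%:R / M%:R) b.
  rewrite /fejer /coef invfM -scalerA; congr (_ *: _).
  under eq_bigr => i _ do rewrite -scaler_sumr exchange_big.
  rewrite -scaler_sumr exchange_big; congr (_ *: _); apply: eq_bigr => k _.
  rewrite -kE scaler_suml; apply: eq_bigr => i _.
  by rewrite scaler_suml.
have sumD : \sum_(k < M) Normc.normc (Dk k) ^+ 2 = L%:R * M%:R.
  have inj : injective (fun x : R => (x%:C%C : C)) by move=> x y [].
  apply: inj; rewrite /= rmorph_sum /=.
  under eq_bigr => k _ do rewrite -kE.
  rewrite exchange_big.
  under eq_bigr => i _.
    rewrite exchange_big.
    under eq_bigr => j _.
      under eq_bigr => k _ do rewrite -rmorphN /=.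
      rewrite expi_sum // dvdz_small; last by have := ltn_ord i; have := ltn_ord j; lia.
      over.
    rewrite (bigD1 i) //= subrr oppr0 eqxx big1 ?addr0 => [|j ji]; last first.
      by rewrite oppr_eq0 subr_eq0 eqz_nat -(inj_eq val_inj) in ji *; rewrite eq_sym (negbTE ji).
    over.
  by rewrite sumr_const card_ord rmorphM /= !rmorph_nat mulr_natl.
have LMR : (0 : R) < L%:R * M%:R by rewrite mulr_gt0 ?ltr0n.
rewrite FE cnormZ Normc.normcV Normc.normcM !normc_nat ler_pdivrMl // -sumD mulr_suml.
apply: le_trans (cnorm_sum _ _ _) _; apply: ler_sum => k _.
by rewrite cnormZ normc_real ger0_norm ?sqr_ge0 // ler_wpM2l ?sqr_ge0 // gam_contr.
Qed.

Lemma sum_geq L n : (L%:R - n%:R : R) <= \sum_(i < L) (n <= i)%N%:R.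
Proof.
elim: L => [|L IH]; first by rewrite big_ord0 sub0r oppr_le0.
rewrite big_ord_recr /= -natr1; case: (leqP n L) => nL.
  by rewrite addrAC lerD2r.
rewrite addr0; apply: (le_trans (y := 0)); last by apply: sumr_ge0.
by rewrite subr_le0 natr1 ler_nat.
Qed.

Lemma count_diagonal L (d : int) : L%:R - `|d|%:R <=
  (\sum_(i < L) \sum_(j < L) (i%:Z - j%:Z == d)%:R : R) <= L%:R.
Proof.
have row (i : 'I_L) : \sum_(j < L) (i%:Z - j%:Z == d)%:R =
    ((0 <= i%:Z - d) && (i%:Z - d < L%:Z))%:R :> R.
  have [/andP[i0 iL]|no] := boolP (_ && _).
    have jL : (`|i%:Z - d| < L)%N by lia.
    rewrite (bigD1 (Ordinal jL)) //= big1 ?addr0 => [|j ji].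
      by rewrite (_ : _ == _) //; apply/eqP; lia.
    suff -> : (i%:Z - j%:Z == d) = false by [].
    apply/eqP => e; move/negP: ji; apply; apply/eqP/val_inj => /=; lia.
  rewrite big1 // => j _; suff -> : (i%:Z - j%:Z == d) = false by [].
  by apply/eqP => e; move/negP: no; apply; have := ltn_ord j; lia.
under eq_bigr => i _ do rewrite row.
apply/andP; split; last first.
  apply: (le_trans (y := \sum_(i < L) 1)); last by rewrite sumr_const card_ord.
  by apply: ler_sum => i _; rewrite lern1 leq_b1.
case: d {row} => n.
  apply: le_trans (sum_geq L n) _; apply: ler_sum => i _.
  rewrite ler_nat; case: (leqP n i) => // ni.
  by rewrite (_ : _ && _) //; have := ltn_ord i; lia.
apply: le_trans (sum_geq L n.+1) _; rewrite (reindex_inj rev_ord_inj) /=.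
apply: ler_sum => i _; rewrite ler_nat.
case: (leqP n.+1 (L - i.+1)) => // ni.
by rewrite lt0b; have := ltn_ord i; lia.
Qed.

(** The L^2 terms of the sum retain the word once for each of its at least L - |d|
    representations of the degree d as a difference. *)
Lemma fejer_word L M mu nu : (0 < L)%N -> (L + `|degw mu nu| <= M)%N ->
  cnorm (word mu nu - fejer L M (word mu nu)) <=
    `|degw mu nu|%:R / L%:R * cnorm (word mu nu).
Proof.
move=> L0 LM; set d := degw mu nu; have M0 : (0 < M)%N by lia.
pose c : R := \sum_(i < L) \sum_(j < L) (i%:Z - j%:Z == d)%:R.
have LR : (0 : R) < L%:R by rewrite ltr0n.
have -> : word mu nu - fejer L M (word mu nu) = ((1 - c / L%:R)%:C%C : C) *: word mu nu.
  rewrite rmorphB rmorph1 scalerBl scale1r; congr (_ - _).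
  rewrite /fejer rmorphM /= fmorphV rmorph_nat mulrC -scalerA; congr (_ *: _).
  rewrite /c rmorph_sum scaler_suml; apply: eq_bigr => i _ /=.
  rewrite rmorph_sum scaler_suml; apply: eq_bigr => j _ /=.
  rewrite coef_word // dvdz_small; last by have := ltn_ord i; have := ltn_ord j; lia.
  rewrite -/d subr_eq0 eq_sym; case: eqP => _; first by rewrite scale1r.
  by rewrite scale0r.
rewrite cnormZ normc_real ler_wpM2r ?cnorm_ge0 //.
have /andP[c1 c2] := count_diagonal L d; rewrite -/c in c1 c2.
rewrite ger0_norm; last by rewrite subr_ge0 ler_pdivrMr // mul1r.
by rewrite lerBlDr -mulrDl ler_pdivlMr // mul1r; lra.
Qed.

Lemma fejer_wsum s (e : R) : 0 < e -> exists L M0, (0 < L)%N /\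
  forall M, (M0 <= M)%N -> (L <= M)%N /\ cnorm (wsum s - fejer L M (wsum s)) <= e.
Proof.
move=> e0; pose K := \sum_(w <- s) Normc.normc w.1.1 * (`|deg w|%:R * cnorm (word w.1.2 w.2)).
have K0 : 0 <= K.
  by apply: sumr_ge0 => w _; rewrite !mulr_ge0 ?normc_ge0 ?cnorm_ge0.
pose L := (Num.truncn (K / e)).+1; have LK : K / L%:R <= e.
  rewrite ler_pdivrMr ?ltr0n // mulrC -ler_pdivrMr //.
  by apply/ltW; apply: truncnS_gt; rewrite divr_ge0 // ltW.
exists L, (L + \max_(w <- s) `|deg w|)%N; split=> // M LM; split; first by lia.
apply: le_trans LK; rewrite /K mulr_suml.
have : forall r, {subset r <= s} -> cnorm (wsum r - fejer L M (wsum r)) <=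
    \sum_(w <- r) Normc.normc w.1.1 * (`|deg w|%:R * cnorm (word w.1.2 w.2)) / L%:R.
  elim=> [_|w r IH rs].
    rewrite /wsum !big_nil (_ : fejer L M 0 = 0) ?subrr ?cnorm0 //.
    by rewrite -(subrr (0 : O)) fejerB !subrr.
  rewrite /wsum !big_cons fejerP opprD addrACA -scalerBr; apply: le_trans (cnormD _ _) _.
  apply: lerD; last by apply: IH => v vr; apply: rs; rewrite inE vr orbT.
  rewrite cnormZ -mulrA ler_wpM2l ?normc_ge0 //.
  rewrite mulrAC; apply: fejer_word => //.
  apply: leq_trans LM; rewrite leq_add2l.
  have ws : w \in s by apply: rs; rewrite mem_head.
  by rewrite (big_rem w ws) /= leq_max leqnn.
by apply.
Qed.

(** Fejer summation reconstructs an element from its Fourier coefficients; only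
    the coefficient of index 0 survives in the commutant of D. *)
Lemma diagonal_maximal_abelian b : commD b -> ss_set D b.
Proof.
move=> bD; have [b0 [b0P b0h]] := coef_lim 0 b.
have b0c : commD b0 by exact: coef_lim_commD bD b0P.
have b0D := homog0_D b0c b0h.
suff /eqP : b - b0 = 0 by rewrite subr_eq0 => /eqP->.
pose c := b - b0; have cD : commD c.
  by move=> a Da; rewrite /c mulrBl mulrBr bD // b0c.
have c_lim m e : 0 < e -> exists M0, forall M, (M0 <= M)%N -> cnorm (coef m M c) <= e.
  move=> e0; have [->|m0] := eqVneq m 0.
    have [M0 M0P] := b0P e e0; exists M0 => M /M0P[MM].
    by rewrite /c coefB (coef_fixed MM (fun t => gam_diagonal t b0D)).
  have [cm [cmP cmh]] := coef_lim m c.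
  have cm0 := homog_zero m0 (coef_lim_commD cD cmP) cmh.
  by have [M0 M0P] := cmP e e0; exists M0 => M /M0P[_]; rewrite cm0 subr0.
apply: cnorm_small => e e0; have e4 : 0 < e / 4 by rewrite divr_gt0.
have [s cs] := word_dense c e4.
have [L [M0 [L0 LP]]] := fejer_wsum s e4.
have LR : (0 : R) < L%:R by rewrite ltr0n.
have /choice[G GP] (ij : 'I_L * 'I_L) : exists M0, forall M, (M0 <= M)%N ->
    cnorm (coef (ij.1%:Z - ij.2%:Z) M c) <= e / 4 / L%:R.
  by apply: c_lim; rewrite divr_gt0.
pose M := maxn M0 (\max_ij G ij).
have [LM h1] := LP M (leq_maxl _ _).
have h2 : cnorm (fejer L M c) <= e / 4.
  rewrite /fejer cnormZ Normc.normcV normc_nat ler_pdivrMl //.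
  have -> : L%:R * (e / 4) = \sum_(i < L) \sum_(j < L) (e / 4 / L%:R) :> R.
    rewrite !sumr_const !card_ord -[RHS]mulr_natl; congr (_ * _).
    by rewrite -[RHS]mulr_natr divfK // gt_eqF.
  apply: le_trans (cnorm_sum _ _ _) _; apply: ler_sum => i _.
  apply: le_trans (cnorm_sum _ _ _) _; apply: ler_sum => j _.
  apply: (GP (i, j)); apply: leq_trans (leq_maxr _ _).
  exact: (@leq_bigmax _ G).
have h3 : cnorm (fejer L M (wsum s) - fejer L M c) <= e / 4.
  by rewrite -fejerB; apply: le_trans (fejer_contr _ L0 LM) _; rewrite cnorm_distC.
have := cnorm_leD c (wsum s); have := cnorm_leD (wsum s) (fejer L M (wsum s)).
have := cnorm_leD (fejer L M (wsum s)) (fejer L M c).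
by rewrite -/c; lra.
Qed.

(** * Unitaries implementing a given element of the group *)

Section Table.
Variable t : selfBij X.
Hypothesis tG : Gamma_f_set f t.

(** On cylinders of large enough length n, t removes the prefix of length l, puts a
    fixed word in its place and keeps the rest, of which the n - l > 0 letters up
    to n are then absorbed into the word. As the last letters agree, t maps the
    cylinder onto the whole cylinder of the new word. *)
Lemma table : exists n (mu : seq 'I_N -> seq 'I_N), forall w, size w = n -> admissible A w ->
  (forall x, cylinder w x -> [/\ cylinder (mu w) (t x),
     iter (size (mu w)) sg (t x) = iter n sg x & E (size (mu w)) (t x) = E n x]) /\
  (forall y, cylinder (mu w) y -> cylinder w (bij_inv t y)).
Proof.
have /Gamma_fP[[ct ct'] gm] := tG.
pose P x n := exists k l, [/\ (l < n)%N, germ f t x k l n &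
  forall y, agree n x y -> agree k (t x) (t y)].
have [n nP] : exists n, forall x, P x n.
  apply: koenig => [x m n mn [k [l [ln g a]]]|x y n xy [k [l [ln g a]]]|x].
  - exists k, l; split; first exact: leq_trans mn.
      by move=> y /(agreeW mn)/g.
    by move=> y /(agreeW mn)/a.
  - exists k, l; split=> //; first by move=> z yz; apply: g; exact: agree_trans xy yz.
    move=> z yz; apply: agree_trans (agree_sym (a _ xy)) (a _ _).
    exact: agree_trans xy yz.
  - have [k [l [m g]]] := gm x; have /continuous_agree/(_ x k)[p pP] := ct.
    exists (maxn l.+1 (maxn m p)), k, l; split; first exact: leq_maxl.
      by move=> y xy; apply: g; apply: agreeW xy; rewrite !leq_max leqnn orbT.
    by move=> y xy; apply: pP; apply: agreeW xy; rewrite !leq_max leqnn !orbT.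
exists n.
suff /choice[mu muP] (w : seq 'I_N) : exists nu, size w = n -> admissible A w ->
    (forall x, cylinder w x -> [/\ cylinder nu (t x),
       iter (size nu) sg (t x) = iter n sg x & E (size nu) (t x) = E n x]) /\
    (forall y, cylinder nu y -> cylinder w (bij_inv t y)).
  by exists mu => w; exact: muP.
have [[sw [x xw]]|] := pselect (size w = n /\ admissible A w); last first.
  by move=> no; exists [::] => sw aw; case: no.
have wE : w = pre x n by rewrite -sw -[LHS]xw.
have [k [l [ln g a]]] := nP x.
pose nu := pre (t x) (k + (n - l)); exists nu => _ _.
have szn : size nu = (k + (n - l))%N by rewrite size_pre.
have first y : cylinder w y -> [/\ cylinder nu (t y),
    iter (size nu) sg (t y) = iter n sg y & E (size nu) (t y) = E n y].
  rewrite wE => /cylinder_pre xy; have [e1 e2] := g y xy; rewrite szn.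
  have e3 : iter (k + (n - l)) sg (t y) = iter n sg y.
    by rewrite addnC iterD e1 -iterD subnK // ltnW.
  split=> //; last first.
    rewrite -{2}(subnKC (ltnW ln)) !birkhoffD e2 e1.
    by [].
  apply/cylinder_pre => i ik; have [lt|ge] := ltnP i k; first exact: a.
  have [e1' _] := g x (@agree_refl _ _ n x).
  rewrite -(subnKC ge) -!pt_iter e1 e1' !pt_iter; apply: xy; lia.
split=> // y ymu.
have [n' nE] : exists n', n = n'.+1 by exists n.-1; rewrite prednK // (leq_ltn_trans _ ln).
pose j := (k + (n' - l))%N.
have jE : (k + (n - l) = j.+1)%N by rewrite /j nE subSn ?addnS //; lia.
move: (ymu); rewrite /nu => /cylinder_pre ya.
have ex' : iter j sg (t x) = iter n' sg x.
  have [e1 _] := g x (@agree_refl _ _ n x).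
  by rewrite /j addnC iterD e1 -iterD subnK //; lia.
have [|x' [xx' x'y]] := @splice _ _ x n' (iter j sg y).
  by rewrite -ex'; apply: agree_iter; rewrite addn1 -jE.
have x'w : cylinder w x'.
  rewrite wE nE; apply/cylinder_pre => i; rewrite ltnS leq_eqVlt => /orP[/eqP->|]; last exact: xx'.
  rewrite -[X in pt x' X]addn0 -[X in pt x X]addn0 -!pt_iter x'y -ex' !pt_iter.
  by apply: ya; rewrite jE addn0.
have [c1 c2 _] := first x' x'w.
have <- : t x' = y.
  apply: (cylinder_iter (erefl _) c1 ymu); rewrite c2 szn jE nE !iterS x'y.
  by [].
by rewrite bij_funK.
Qed.

End Table.

(** Near each point u is a single S_mu S_nu^* with coefficient 1, which singles out
    one unitary among all the u d with d unitary in D. *)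
Definition implements u (t : selfBij X) := forall x, exists k l m,
  (forall y, agree m x y -> iter k sg (t y) = iter l sg y) /\
  forall n, u * q x (l + n) = word (pre (t x) (k + n)) (pre x (l + n)).

Lemma star_word mu nu : star (word mu nu) = word nu mu.
Proof. by rewrite /word starM starK. Qed.

Lemma Sword_disj mu nu : (forall x, cylinder mu x -> ~ cylinder nu x) ->
  star (Sword S mu) * Sword S nu = 0.
Proof.
move=> dis; rewrite -(Sword_starK mu) -(Sword_rangeK nu) -!mulrA (mulrA (Phi _)).
rewrite -(PhiM (@cont_cyl mu) (@cont_cyl nu)).
rewrite (_ : (fun x => _) = (fun=> 0)) ?Phi0 ?mul0r ?mulr0 //.
by apply/funext => x; rewrite ind_mul indF // => -[/dis].
Qed.

Lemma SwordE mu : Sword S mu * (star (Sword S mu) * Sword S mu) = Sword S mu.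
Proof. by rewrite mulrA Sword_range Sword_rangeK. Qed.

(** The words of the table give partial isometries whose domains, and whose ranges,
    partition the shift space. *)
Lemma ex_implements t : Gamma_f_set f t ->
  exists u, [/\ covers u t, forall s, rho s u = u & implements u t].
Proof.
move=> tG; have [n [mu muP]] := table tG.
have /Gamma_fP[[ct ct'] _] := tG.
pose u := \sum_(w : n.-tuple 'I_N) word (mu w) w.
have [adm0 dom] : (forall w : n.-tuple 'I_N, ~ admissible A w -> Sword S w = 0) /\
    forall w : n.-tuple 'I_N, admissible A w ->
    star (Sword S (mu w)) * Sword S (mu w) = star (Sword S w) * Sword S w.
  split=> [w|w aw]; first exact: Sword_nonadm.
  have [h1 h2] := muP w (size_tuple w) aw.
  rewrite !Sword_domain; congr Phi; apply/funext => z; apply: ind_eq.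
  split=> [[y [ymu yz]]|[x [xw xz]]].
    have xw := h2 y ymu; exists (bij_inv t y); split=> //.
    by have [_ + _] := h1 _ xw; rewrite bij_invK yz size_tuple => ->.
  by have [c1 c2 _] := h1 x xw; exists (t x); split=> //; rewrite c2 -xz size_tuple.
have tuple_disj (w v : n.-tuple 'I_N) x : w <> v -> cylinder w x -> ~ cylinder v x.
  move=> wv /cylinderE xw /cylinderE xv; apply: wv; apply: val_inj.
  by rewrite /= -xw -xv !size_tuple.
have su : star u = \sum_(w : n.-tuple 'I_N) word w (mu w).
  by rewrite /u star_sum; apply: eq_bigr => w _; rewrite star_word.
have range_w (w : n.-tuple 'I_N) : word (mu w) w * word w (mu w) =
    Phi (fun y => ind (cylinder w) (bij_inv t y)).
  have [aw|na] := pselect (admissible A w); last first.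
    rewrite /word adm0 // star0 mulr0 mul0r -Phi0; congr Phi; apply/funext => y.
    by rewrite indF // => yw; apply: na; exists (bij_inv t y).
  rewrite /word -mulrA (mulrA (star (Sword S w))) -(dom w aw) mulrA SwordE Sword_range.
  have [h1 h2] := muP w (size_tuple w) aw.
  congr Phi; apply/funext => y; apply: ind_eq; split; first exact: h2.
  by move=> /h1[+ _ _]; rewrite bij_invK.
have uu : star u * u = 1.
  rewrite su /u mulr_suml -(sum_cylinders n); apply: eq_bigr => w _.
  rewrite mulr_sumr (bigD1 w) //= big1 ?addr0 => [|v vw].
    rewrite /word -mulrA (mulrA (star (Sword S (mu w)))).
    have [aw|na] := pselect (admissible A w); last first.
      by rewrite -Sword_range adm0 // !mul0r.
    by rewrite dom // mulrA SwordE Sword_range.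
  have [aw|na] := pselect (admissible A w); last by rewrite {1}/word adm0 // !mul0r.
  have [av|na] := pselect (admissible A v); last first.
    by rewrite {2}/word (adm0 v) // star0 !mulr0.
  rewrite /word -mulrA (mulrA (star (Sword S (mu w)))) Sword_disj ?mul0r ?mulr0 //.
  move=> y yw yv; have [_ /(_ y yw) w2] := muP w (size_tuple w) aw.
  have [_ /(_ y yv) v2] := muP v (size_tuple v) av.
  by apply: (tuple_disj w v _ _ w2 v2) => e; rewrite e eqxx in vw.
have uu' : u * star u = 1.
  have E1 : u * star u = \sum_(w : n.-tuple 'I_N) Phi (fun y => ind (cylinder w) (bij_inv t y)).
    rewrite su /u mulr_suml; apply: eq_bigr => w _.
    rewrite mulr_sumr (bigD1 w) //= big1 ?addr0 // => v vw.
    rewrite /word -mulrA (mulrA (star (Sword S w))) Sword_disj ?mul0r ?mulr0 //.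
    by move=> x; apply: tuple_disj => e; rewrite e eqxx in vw.
  have [_ E2] := Phi_sum (index_enum _) (fun w : n.-tuple 'I_N => cont_comp (@cont_cyl w) ct').
  rewrite E1 -E2 -Phi1; congr Phi; apply/funext => y.
  rewrite -(cylinder_partition n (bij_inv t y) (fun=> 1)); apply: eq_bigr => w _.
  by rewrite mul1r.
have uPhi g : continuous g -> u * Phi g = Phi (g \o bij_inv t) * u.
  move=> gc; rewrite /u mulr_suml mulr_sumr; apply: eq_bigr => w _.
  apply: (word_intertw gc (cont_comp gc ct')) => x y xw ymu xy.
  have aw : admissible A w by exists x.
  have [/(_ x xw)[c1 c2 _] _] := muP w (size_tuple w) aw.
  have -> : y = t x by apply: (cylinder_iter (erefl _) ymu c1); rewrite c2 -xy size_tuple.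
  by rewrite /= bij_funK.
exists u; split=> // [s|x].
  rewrite /u linear_sum; apply: eq_bigr => w _ /=; rewrite rho_word.
  have [aw|na] := pselect (admissible A w); last first.
    by rewrite /word adm0 // star0 !mulr0 mul0r.
  have [h1 h2] := muP w (size_tuple w) aw.
  have pc := cont_conj (@phase_cont s (size w)).
  have pm := @phase_cont s (size (mu w)).
  rewrite -(PhiS (@phase_cont s (size w))) -mulrA.
  rewrite (word_intertw (mu := mu w) (nu := w) pc (cont_comp pc ct')); last first.
    move=> x y xw ymu xy; have [c1 c2 _] := h1 x xw.
    have -> : y = t x by apply: (cylinder_iter (erefl _) ymu c1); rewrite c2 -xy size_tuple.
    by rewrite bij_funK.
  rewrite mulrA -(PhiM pm (cont_comp pc ct')) /word -{1}(Sword_rangeK (mu w)) !mulrA.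
  rewrite -(PhiM (contM pm (cont_comp pc ct')) (@cont_cyl (mu w))).
  rewrite -{2}(Sword_rangeK (mu w)); congr (Phi _ * _ * _); apply/funext => y.
  have [ymu|ymu] := pselect (cylinder (mu w) y); last by rewrite (indF ymu) mulr0.
  have [_ _ +] := h1 _ (h2 y ymu); rewrite bij_invK => eE.
  by rewrite /phase eE size_tuple expi_conjM mul1r.
have sx : size (pre x n) == n by rewrite size_pre.
pose w := Tuple sx; have wx : cylinder w x by exact/cylinder_pre.
have aw : admissible A w by exists x.
have [h1 h2] := muP w (size_tuple w) aw.
have [c1 c2 _] := h1 x wx.
exists (size (mu w)), n, n; split.
  move=> y xy; have yw : cylinder w y by exact/cylinder_pre.
  by have [_ -> _] := h1 y yw.
move=> m; have uq : u * q x (n + m) = word (mu w) w * q x (n + m).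
  rewrite /u mulr_suml (bigD1 w) //= big1 ?addr0 // => v vw.
  rewrite /word -mulrA /q -Sword_range (mulrA (star (Sword S v))).
  rewrite Sword_disj ?mul0r ?mulr0 // => y yv /cylinder_pre xy.
  apply: (tuple_disj v w y _ yv); first by move=> e; rewrite e eqxx in vw.
  by apply/cylinder_pre; apply: agreeW xy; exact: leq_addr.
rewrite uq /q -Sword_range /word; set gamma := pre x (n + m).
have gE : gamma = w ++ pre (iter n sg x) m by rewrite /gamma preD.
have tE : pre (t x) (size (mu w) + m) = mu w ++ pre (iter n sg x) m.
  by rewrite preD c2; congr (_ ++ _).
rewrite {1}gE tE !Sword_cat -!mulrA (mulrA (star (Sword S w))) -(dom w aw).
by rewrite !mulrA Sword_range Sword_rangeK.
Qed.

(** The exponents k and l may differ for u and v, but t being given, their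
    difference is determined at aperiodic points, hence near every point. *)
Lemma implements_uniq u v t : implements u t -> implements v t -> u = v.
Proof.
move=> ut vt.
have [n nP] : exists n, forall x, u * q x n = v * q x n.
  apply: koenig => [x m n mn e|x y n /eq_pre xy|x].
  - by rewrite -(qWl x mn) !mulrA e.
  - by rewrite /q xy.
  - have [k [l [m [g uE]]]] := ut x; have [k' [l' [m' [g' vE]]]] := vt x.
    have [y [xy ay]] := aperiodic_dense hA01 hAirr hAperm x (maxn m m').
    have e1 := g y (agreeW (leq_maxl _ _) xy); have e2 := g' y (agreeW (leq_maxr _ _) xy).
    have aty : aperiodic (t y) by apply/(aperiodic_iter _ k); rewrite e1; apply/aperiodic_iter.
    have kl : (k + l' = k' + l)%N.
      by apply: aty; rewrite (addnC k) (addnC k') !iterD e1 e2 -!iterD addnC.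
    by exists (l + l')%N; rewrite uE (addnC l) vE kl.
rewrite -[u]mulr1 -[v]mulr1 -(sum_cylinders n) !mulr_sumr; apply: eq_bigr => w _.
have [[x xw]|na] := pselect (admissible A w).
  have -> : tval w = pre x n by rewrite -[LHS]xw size_tuple.
  exact: nP.
by rewrite -Sword_range Sword_nonadm // mul0r !mulr0.
Qed.

(** For long prefixes the range of the word describing v is the domain of the word
    describing u. *)
Lemma implementsM u v (s t : selfBij X) : star v * v = 1 -> continuous t ->
  implements u s -> implements v t -> implements (u * v) (s * t)%g.
Proof.
move=> vv ct us vt x.
have [k [l [m [g vE]]]] := vt x; have [k' [l' [m' [g' uE]]]] := us (t x).
have /continuous_agree/(_ x m')[p pP] := ct.
exists (k' + k)%N, (l + l')%N, (maxn m p); split.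
  move=> y xy; have e1 := g y (agreeW (leq_maxl _ _) xy).
  have e2 := g' _ (pP _ (agreeW (leq_maxr _ _) xy)).
  change (iter (k' + k) sg (s (t y)) = iter (l + l') sg y).
  by rewrite addnC iterD e2 -iterD addnC iterD e1 -iterD addnC.
move=> n; change ((s * t)%g x) with (s (t x)).
rewrite -addnA -mulrA vE; set ga := pre x _; set be := pre (t x) _.
have vq : Sword S ga * (star (Sword S be) * Sword S be) * star (Sword S ga) =
    Sword S ga * star (Sword S ga).
  have := congr1 (fun a => star a * a) (vE (l' + n)%N).
  rewrite /= starM q_self -(mulrA (q x _)) (mulrA (star v) v) vv mul1r q_idem.
  rewrite star_word /word -/ga -/be.
  by rewrite /q -/ga -Sword_range => ->; rewrite !mulrA.
have Qb : star (Sword S be) * Sword S be * star (Sword S ga) = star (Sword S ga).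
  have QD : star (Sword S be) * Sword S be * (star (Sword S ga) * Sword S ga) =
      star (Sword S ga) * Sword S ga * (star (Sword S be) * Sword S be).
    rewrite !Sword_domain.
    exact: (Phi_comm (cont_ind (@lconst_image _ A be)) (cont_ind (@lconst_image _ A ga))).
  have gs : star (Sword S ga) * Sword S ga * star (Sword S ga) = star (Sword S ga).
    by rewrite -mulrA Sword_range Sword_starK.
  have e : star (Sword S ga) * Sword S ga * (star (Sword S be) * Sword S be) *
      star (Sword S ga) = star (Sword S ga).
    by rewrite -!mulrA; move: vq; rewrite -!mulrA => ->; rewrite mulrA gs.
  by rewrite -{1}gs mulrA QD.
have uq : u * Sword S be = word (pre (s (t x)) (k' + (k + n))) be * Sword S be.
  rewrite -{1}(Sword_rangeK be) mulrA; congr (_ * _).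
  have bE : be = pre (t x) (l' + (k + n)) by rewrite /be addnCA.
  by rewrite bE; exact: (uE (k + n)%N).
by rewrite {1}/word mulrA uq /word -!mulrA (mulrA (star _)) Qb addnA.
Qed.

(** * The exact sequences *)

Local Notation F := (fixed_sub rho).
Local Notation U := (unitaryGroup F).
Local Notation NU := (subGrp (normalizer F D)).
Local Notation Gf := (subGrp (Gamma_f f)).

Lemma D_sub_F a : ss_set D a -> ss_set F a.
Proof. by move=> Da s; exact: rho_diagonal. Qed.

Lemma covers_eq u v s t : covers u s -> covers v t ->
  (forall a, ss_set D a -> u * a * star u = v * a * star v) -> s = t.
Proof.
move=> [[cs cs'] su us uE] [[ct ct'] sv vs vE] uv.
have e : bij_inv s = bij_inv t.
  apply/funext => x; apply: cont_sep => g gc.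
  have : Phi (g \o bij_inv s) = Phi (g \o bij_inv t).
    have := uv _ (Phi_D gc); rewrite uE // vE // -!mulrA us vs !mulr1.
    by [].
  move/(Phi_inj (cont_comp gc cs') (cont_comp gc ct')).
  by move/(congr1 (fun h => h x)).
by apply: selfBijP => x; rewrite -{1}(bij_funK t x) -e bij_invK.
Qed.

Lemma coversM u v s t : covers u s -> covers v t -> covers (u * v) (s * t)%g.
Proof.
move=> [[cs cs'] su us uE] [[ct ct'] sv vs vE]; split.
- split=> x.
    by apply: (@continuous_comp _ _ _ t s); [exact: ct|exact: cs].
  by apply: (@continuous_comp _ _ _ (bij_inv s) (bij_inv t)); [exact: cs'|exact: ct'].
- by rewrite starM mulrA -(mulrA (star v)) su mulr1.
- by rewrite starM mulrA -(mulrA u) vs mulr1.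
- by move=> g gc; rewrite -mulrA vE // mulrA (uE _ (cont_comp gc ct')) -mulrA.
Qed.

Lemma covers_normalizer (u : U) t : covers (uval u) t -> normalizer_set D u.
Proof.
move=> [[ct ct'] su us uE].
have tu g : continuous g -> uval u * Phi g * star (uval u) = Phi (g \o bij_inv t).
  by move=> gc; rewrite uE // -mulrA us mulr1.
apply/seteqP; split=> [_ [a /Phi_surj[g [gc <-]] <-]|_ /Phi_surj[g [gc <-]]].
  by rewrite tu //; apply: Phi_D; exact: (cont_comp gc ct').
have gt := cont_comp gc ct; exists (Phi (fun x => g (t x))); first exact: (Phi_D gt).
by rewrite (tu _ gt); congr Phi; apply/funext => x; rewrite /= bij_invK.
Qed.

Lemma unitary_of u t : covers u t -> (forall s, rho s u = u) -> unitary_set F u.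
Proof. by move=> [_ su us _] ru; split. Qed.

Lemma ex_tau (u : NU) : exists t : Gf, covers (uval (gval u)) (gval t).
Proof.
have [Fu su us] := uvalP (gval u).
have /normalizerE uN : normalizer_set D (gval u) := gvalP u.
have [t ut] := normalizer_covers su us uN.
have tG : sg_set (Gamma_f f) t by exact: covers_Gamma ut Fu.
by exists (mksub tG).
Qed.

Definition tau (u : NU) : Gf := projT1 (cid (ex_tau u)).

Lemma tau_covers u : covers (uval (gval u)) (gval (tau u)).
Proof. exact: (projT2 (cid (ex_tau u))). Qed.

Lemma tauE (u : NU) (t : Gf) : covers (uval (gval u)) (gval t) -> tau u = t.
Proof. by move=> ut; apply: gval_inj; exact: covers_eq (tau_covers u) ut _. Qed.

Lemma tauM : {morph tau : u v / (u * v)%g}.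
Proof.
move=> u v; apply: tauE; rewrite gvalM.
exact: (coversM (tau_covers u) (tau_covers v)).
Qed.

Lemma incl_unitary (u : unitaryGroup D) : unitary_set F (uval u).
Proof. by have [Du su us] := uvalP u; split=> //; exact: D_sub_F. Qed.

Lemma covers_D u : ss_set D u -> star u * u = 1 -> u * star u = 1 -> covers u 1%g.
Proof.
move=> Du su us; split=> //; first by split=> x V.
move=> g gc; exact: (D_comm Du (Phi_D gc)).
Qed.

Lemma incl_covers (u : unitaryGroup D) : covers (uval (mkU (incl_unitary u))) 1%g.
Proof. by have [Du su us] := uvalP u; exact: covers_D. Qed.

Definition incl (u : unitaryGroup D) : NU :=
  @mksub _ (normalizer F D) _ (covers_normalizer (incl_covers u)).

Lemma inclE u : uval (gval (incl u)) = uval u. Proof. by []. Qed.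

Lemma inclM : {morph incl : u v / (u * v)%g}.
Proof. by move=> u v; apply/gval_inj/uval_inj. Qed.

Lemma tau_ker (u : NU) : tau u = 1%g <-> exists v, incl v = u.
Proof.
split=> [tu1|[x <-]]; last by apply: tauE; exact: incl_covers.
have [Fu su us] := uvalP (gval u).
have := tau_covers u; rewrite tu1 gval1 => -[_ _ _ uE].
have Du : ss_set D (uval (gval u)).
  by apply: diagonal_maximal_abelian => a /Phi_surj[g [gc <-]]; exact: uE.
have Uu : unitary_set D (uval (gval u)) by split.
by exists (mkU Uu); apply/gval_inj/uval_inj.
Qed.

Definition implementer (t : Gf) : O := projT1 (cid (ex_implements (gvalP t))).

Lemma implementerP t : [/\ covers (implementer t) (gval t),
  forall s, rho s (implementer t) = implementer t & implements (implementer t) (gval t)].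
Proof. exact: (projT2 (cid (ex_implements (gvalP t)))). Qed.

Lemma implementer_unitary t : unitary_set F (implementer t).
Proof. by have [ct ru _] := implementerP t; exact: unitary_of ct ru. Qed.

Lemma implementer_covers t : covers (uval (mkU (implementer_unitary t))) (gval t).
Proof. by have [] := implementerP t. Qed.

Definition lift (t : Gf) : NU :=
  @mksub _ (normalizer F D) _ (covers_normalizer (implementer_covers t)).

(** Both sides implement the product, and such a unitary is unique. *)
Lemma liftM : {morph lift : s t / (s * t)%g}.
Proof.
move=> s t; apply/gval_inj/uval_inj.
change (implementer (s * t)%g = implementer s * implementer t).
have [_ _ ist] := implementerP (s * t)%g; have [_ _ is_] := implementerP s.
have [[[ct _] vv _ _] _ it] := implementerP t.
exact: implements_uniq ist (implementsM vv ct is_ it).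
Qed.

Lemma tau_lift t : tau (lift t) = t.
Proof. by apply: tauE; exact: implementer_covers. Qed.

Local Notation IG := (subGrp (inner F D)).

Definition AdN (u : NU) : IG := @mksub _ (inner F D) _ (Ad_bij_inner D_sub_F (gvalP u)).

Lemma AdN_isAd u : is_Ad (gval u) (gval (AdN u)).
Proof. exact: Ad_bij_isAd. Qed.

Lemma AdNM : {morph AdN : u v / (u * v)%g}.
Proof.
move=> u v; apply: gval_inj; apply: (is_Ad_inj (AdN_isAd (u * v)%g)).
exact: (is_AdM (AdN_isAd u) (AdN_isAd v)).
Qed.

Lemma ex_q (al : IG) : exists u : NU, is_Ad (gval u) (gval al).
Proof.
have [[u ual] alD] := gvalP al.
by exists (@mksub _ (normalizer F D) _ (inner_normalizer D_sub_F (gvalP al) ual)).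
Qed.

Definition qmap (al : IG) : Gf := tau (projT1 (cid (ex_q al))).

Lemma qE (u : NU) al : is_Ad (gval u) (gval al) -> qmap al = tau u.
Proof.
rewrite /qmap; case: (cid (ex_q al)) => v /= val ual.
apply: gval_inj; apply: (covers_eq (tau_covers v) (tau_covers u)) => a Da.
have Fa := D_sub_F Da.
by have := val (exist _ a (mem_set Fa)); rewrite ual /= => ->.
Qed.

Lemma qM : {morph qmap : al be / (al * be)%g}.
Proof.
move=> al be; have [u ual] := ex_q al; have [v vbe] := ex_q be.
rewrite (qE ual) (qE vbe) -tauM; apply: qE; exact: is_AdM ual vbe.
Qed.

(** Exactness in the middle is maximality of D, surjectivity and the splitting come
    from the implementing unitaries. *)
Lemma exact_sequences :
  exists (i : {multiplicative unitaryGroup D -> NU}) (p : {multiplicative NU -> Gf}),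
    [/\ forall u, uval (gval (i u)) = uval u,
        forall u (a : X -> C), continuous a ->
          uval (gval u) * Phi a * star (uval (gval u)) = Phi (a \o bij_inv (gval (p u))),
        short_exact i p &
        exists (ad : {multiplicative unitaryGroup D -> IG}) (r : {multiplicative IG -> Gf}),
          [/\ forall u (a : set_type F),
                val (gval (ad u) a) = uval u * val a * star (uval u),
              forall (u : NU) (al : IG), is_Ad (gval u) (gval al) -> r al = p u,
              short_exact_mod (central_unitaries F D) ad r
            & splits r]].
Proof.
have adM : {morph AdN \o incl : u v / (u * v)%g}.
  by move=> u v; rewrite /= inclM AdNM.
exists (morphism_of inclM), (morphism_of tauM); split.
- exact: inclE.
- move=> u a ac; have [_ _ us uE] := tau_covers u.
  by rewrite uE // -mulrA us mulr1.
- split=> [x|y|z].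
  + split=> [/(congr1 (@gval _ _))/(congr1 (@uval _ _ _)) e|->]; first exact: uval_inj.
    by apply/gval_inj/uval_inj.
  + exact: tau_ker.
  + by exists (lift z); exact: tau_lift.
exists (morphism_of adM), (morphism_of qM); split.
- by move=> u a; exact: (AdN_isAd (incl u)).
- exact: qE.
- split=> [x|al|z].
  + have [Dx sx xs] := uvalP x; split=> [e a Fa|xc].
      have := AdN_isAd (incl x) (exist _ a (mem_set Fa)).
      have -> : AdN (incl x) = 1%g := e.
      rewrite gval1 inclE => /= e'.
      by rewrite [in RHS](e' : a = _) -!mulrA sx mulr1.
    apply: gval_inj; apply: (is_Ad_inj (AdN_isAd (incl x))) => a.
    rewrite inclE gval1 (xc _ (set_mem (valP a))) -mulrA xs mulr1.
    by [].
  + split=> [q1|[x <-]].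
      have [u ual] := ex_q al.
      have /tau_ker[x xu] : tau u = 1%g by rewrite -(qE ual).
      exists x; apply: gval_inj; apply: is_Ad_inj ual.
      by rewrite -xu; exact: AdN_isAd.
    change (qmap (AdN (incl x)) = 1%g); rewrite (qE (AdN_isAd (incl x))).
    by apply/tau_ker; exists x.
  + exists (AdN (lift z)); change (qmap (AdN (lift z)) = z).
    by rewrite (qE (AdN_isAd _)) tau_lift.
have sM : {morph AdN \o lift : s t / (s * t)%g}.
  by move=> s t; rewrite /= liftM AdNM.
exists (morphism_of sM) => z; change (qmap (AdN (lift z)) = z).
by rewrite (qE (AdN_isAd _)) tau_lift.
Qed.
End DiagonalCalculus.

Theorem theorem2p10 (R : realType) (N : nat) (A : 'M[nat]_N)
    (hA01 : forall i j, A i j = 0%N \/ A i j = 1%N)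
    (hAirr : irreducible A) (hAperm : ~~ is_perm_mx A)
    (O : cstarAlgType R) (S : 'I_N -> O) (hO : is_cuntz_krieger A S)
    (Phi : (shift_space A -> Cplx R) -> O) (hPhi : is_diagonal_iso S Phi)
    (f : shift_space A -> int)
    (hf : continuous (f : shift_space A -> discrete_topology int))
    (rho : R -> starAut O) (hrho : is_gauge_action S Phi f rho) :
  let D := DA A S in
  let F := fixed_sub rho in
  exists (incl : {multiplicative unitaryGroup D -> subGrp (normalizer F D)})
         (tau : {multiplicative subGrp (normalizer F D) -> subGrp (Gamma_f f)}),
    [/\ forall u, uval (gval (incl u)) = uval u,
        forall u (a : shift_space A -> Cplx R), continuous a ->
          uval (gval u) * Phi a * star (uval (gval u)) =
          Phi (a \o bij_inv (gval (tau u))),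
        short_exact incl tau &
        exists (ad : {multiplicative unitaryGroup D -> subGrp (inner F D)})
               (q : {multiplicative subGrp (inner F D) -> subGrp (Gamma_f f)}),
          [/\ forall u (a : set_type F),
                val (gval (ad u) a) = uval u * val a * star (uval u),
              forall (u : subGrp (normalizer F D)) (alpha : subGrp (inner F D)),
                is_Ad (gval u) (gval alpha) -> q alpha = tau u,
              short_exact_mod (central_unitaries F D) ad q
            & splits q]].
Proof.
move=> D F; have [hck hgen huniv] := hO.
(* The gauge automorphisms come from the universal property, applied to the
   family z S_i. *)
have /choice[gam hgam] (t : R) : exists phi : starHom O O,
    forall i, phi (S i) = expi2pi t *: S i.
  have [ckS ck1 ckD] := hck.
  have cancel_phase (a b : O) : (expi2pi t *: a) * star (expi2pi t *: b) = a * star b.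
    by rewrite starZ -scalerAl -scalerAr scalerA expi_conjM scale1r.
  apply: huniv; split=> [i||i].
  - by rewrite cancel_phase -scalerAr ckS.
  - by under eq_bigr => j _ do rewrite cancel_phase.
  - under eq_bigr => j _ do rewrite cancel_phase.
    by rewrite -ckD starZ -scalerAl -scalerAr scalerA mulrC expi_conjM scale1r.
exact: (exact_sequences hA01 hAirr hAperm hck hPhi hgen hf hrho hgam).
Qed.
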